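(* Let $(A,\mathfrak m)$ be a non-regular Gorenstein local ring of dimension $d\ge 1$ and let $N$ be a perfect $A$-module of dimension $t\ge 1$. Let $M$ be a non-free maximal Cohen-Macaulay $A$-module. Then for every integer $i\ge 1$, $$r_i^{\mathfrak m,N}(M)=t-1=s^i_{\mathfrak m,N}(M).$$
   Context: All rings are commutative Noetherian and all modules are finitely generated. $\lambda(-)$ denotes length. Over a Cohen-Macaulay local ring, a non-zero module $N$ is perfect if and only if it is Cohen-Macaulay of finite projective dimension. For a maximal Cohen-Macaulay $A$-module $M$ and $i\ge 1$, the functions $n\mapsto\lambda(\operatorname{Tor}_i^A(M,N/\mathfrak m^nN))$ and $n\mapsto\lambda(\operatorname{Ext}^i_A(M,N/\mathfrak m^nN))$ are known to agree with polynomials for $n\gg0$; $r_i^{\mathfrak m,N}(M)$ and $s^i_{\mathfrak m,N}(M)$, respectively, denote the degrees of these polynomials. The zero polynomial has degree $-1$. *)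

(* Defs.v *)
(* Modules over a commutative ring A are lmodType A; submodules
   and ideals are boolean predicates, which by the classical axioms of boolp
   range over all subsets. *)
From HB Require Import structures.
From mathcomp Require Import all_boot all_order all_algebra.
From mathcomp Require Import ring_quotient generic_quotient boolp.

Set Implicit Arguments.
Unset Strict Implicit.
Unset Printing Implicit Defensive.

Import Order.TTheory GRing.Theory Num.Theory.
Local Open Scope ring_scope.
Local Open Scope quotient_scope.

(* A supremum of natural numbers that is finite and attained. *)
Definition is_max (P : nat -> Prop) (l : nat) : Prop :=
  P l /\ forall k, P k -> (k <= l)%N.

Definition strict_chain (T : Type) (W : nat -> {pred T}) (l : nat) : Prop :=
  forall j, (j < l)%N ->
    {subset W j <= W j.+1} /\ exists2 x, x \in W j.+1 & x \notin W j.

Section Quotient.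
Variables (A : comNzRingType) (V : lmodType A) (W : submodClosed V).

Definition sub_zmod : {pred V} := W.
HB.instance Definition _ := GRing.isZmodClosed.Build V sub_zmod
  (GRing.submod_closedB (submodClosedP W)).

Definition quotmod := Quotient.quot sub_zmod.

HB.instance Definition _ := GRing.Zmodule.on quotmod.
HB.instance Definition _ := EqQuotient.on quotmod.

Lemma quotmod_eq (x y : V) :
  (\pi_quotmod x == \pi_quotmod y) = (x - y \in W).
Proof. exact: (esym (Quotient.idealrBE sub_zmod x y)). Qed.

Definition quot_scale (a : A) := lift_op1 quotmod ( *:%R a).

Lemma pi_scale a : {morph \pi_quotmod : x / a *: x >-> quot_scale a x}.
Proof.
move=> x; unlock quot_scale; apply/eqP; rewrite quotmod_eq -scalerBr.
by apply: rpredZ; rewrite -quotmod_eq reprK.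
Qed.

Lemma pi_addm : {morph \pi_quotmod : x y / x + y >-> x + y}.
Proof. by move=> x y; exact: (Quotient.pi_add sub_zmod). Qed.

Lemma quot_scaleA a b v : quot_scale a (quot_scale b v) = quot_scale (a * b) v.
Proof. by rewrite -[v]reprK -!pi_scale scalerA. Qed.
Lemma quot_scale1 : left_id 1 quot_scale.
Proof. by move=> v; rewrite -[v]reprK -!pi_scale scale1r. Qed.
Lemma quot_scaleDr : right_distributive quot_scale +%R.
Proof.
move=> a u v; rewrite -[v]reprK -[u]reprK -pi_addm -!pi_scale -pi_addm.
by rewrite scalerDr.
Qed.
Lemma quot_scaleDl v : {morph quot_scale^~ v : a b / a + b}.
Proof. by move=> a b; rewrite -[v]reprK -!pi_scale -pi_addm scalerDl. Qed.

HB.instance Definition _ := GRing.Zmodule_isLmodule.Build A quotmod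
  quot_scaleA quot_scale1 quot_scaleDr quot_scaleDl.

End Quotient.

Section Homology.
Variables (A : comNzRingType) (U V W : lmodType A).
Variables (f : {linear U -> V}) (g : {linear V -> W}).

Definition kerp : {pred V} := [pred x | g x == 0].

Lemma kerp_closed : submod_closed kerp.
Proof.
split=> [|a u v]; rewrite !inE ?linear0 // => /eqP gu /eqP gv.
by rewrite linearP gu gv scaler0 addr0.
Qed.
HB.instance Definition _ := GRing.isSubmodClosed.Build A V kerp kerp_closed.

Definition kermod := {x : V | x \in kerp}.
HB.instance Definition _ := SubChoice.on kermod.
HB.instance Definition _ := [SubChoice_isSubLmodule of kermod by <:].

Definition bndp : {pred kermod} := [pred z | `[< exists u, f u = val z >]].

Lemma bndp_closed : submod_closed bndp.
Proof.
split=> [|a z1 z2]; rewrite !inE.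
  by apply/asboolP; exists 0; rewrite !linear0.
move=> /asboolP[u1 h1] /asboolP[u2 h2]; apply/asboolP; exists (a *: u1 + u2).
by rewrite linearP h1 h2.
Qed.
HB.instance Definition _ := GRing.isSubmodClosed.Build A kermod bndp bndp_closed.

(* ker g / (ker g :&: im f) *)
Definition homology : lmodType A := quotmod bndp.

End Homology.

Section Ideals.
Variable A : comNzRingType.

Definition prime_ideal (p : {pred A}) : Prop :=
  idealr_closed p /\ prime_idealr_closed p.

Definition maximal_ideal (p : {pred A}) : Prop :=
  idealr_closed p /\
  forall q : {pred A}, idealr_closed q -> {subset p <= q} -> q =i p.

Definition is_local (m : {pred A}) : Prop :=
  maximal_ideal m /\ forall q, maximal_ideal q -> q =i m.

(* (x_1, ..., x_r) V *)
Definition seq_mul (V : lmodType A) (x : seq A) : {pred V} :=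
  [pred v | `[< exists y : nat -> V, v = \sum_(j < size x) x`_j *: y j >]].
Arguments seq_mul : clear implicits.

Definition noetherian : Prop :=
  forall I : {pred A^o}, submod_closed I ->
    exists x : seq A, I =i seq_mul A^o x.

(* I W : finite sums of products a *: w with a in I and w in W *)
Definition ideal_mul (V : lmodType A) (I : {pred A}) (W : {pred V}) : {pred V} :=
  [pred v | `[< exists2 s : seq (A * V),
    {in s, forall z, z.1 \in I /\ z.2 \in W} &
    v = \sum_(z <- s) z.1 *: z.2 >]].

Definition ideal_exp (I : {pred A}) (n : nat) : {pred A} :=
  iter n (ideal_mul (V := A^o) I) predT.

(* I^n V *)
Definition exp_mul (V : lmodType A) (I : {pred A}) (n : nat) : {pred V} :=
  ideal_mul (ideal_exp I n) predT.
Arguments exp_mul : clear implicits.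

Lemma exp_mul_closed V I n : submod_closed (exp_mul V I n).
Proof.
split=> [|c u v]; rewrite !inE.
  by apply/asboolP; exists [::]; rewrite ?big_nil.
move=> /asboolP[s1 h1 ->] /asboolP[s2 h2 ->]; apply/asboolP.
exists ([seq (z.1, c *: z.2) | z <- s1] ++ s2).
  move=> z; rewrite mem_cat => /orP[/mapP[y /h1 [] ? ? ->]|/h2] //=.
rewrite big_cat big_map scaler_sumr; congr (_ + _).
by apply: eq_bigr => z _ /=; rewrite !scalerA mulrC.
Qed.
HB.instance Definition _ V I n :=
  GRing.isSubmodClosed.Build A V (exp_mul V I n) (exp_mul_closed V I n).

(* V / I^n V *)
Definition quot_exp (V : lmodType A) (I : {pred A}) (n : nat) : lmodType A :=
  quotmod (exp_mul V I n).

End Ideals.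

Arguments seq_mul {A} V x _.
Arguments exp_mul {A} V I n _.

Section Invariants.
Variable A : comNzRingType.
Implicit Types V : lmodType A.

Definition fin_gen V : Prop :=
  exists x : seq V, forall v, exists c : nat -> A,
    v = \sum_(j < size x) c j *: x`_j.

(* A free module with a finite basis; a finitely generated module over a
   nonzero ring is free exactly when it is free in this sense. *)
Definition is_free V : Prop :=
  exists (n : nat) (f : {linear 'rV[A]_n -> V}), bijective f.

Definition has_length V (l : nat) : Prop :=
  is_max (fun k => exists W : nat -> {pred V},
    (forall j, submod_closed (W j)) /\ strict_chain W k) l.

Definition annihilator V : {pred A} := [pred a | `[< forall v : V, a *: v = 0 >]].

(* dim A/I = d *)
Definition dim_mod (I : {pred A}) (d : nat) : Prop :=
  is_max (fun k => exists p : nat -> {pred A},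
    (forall j, prime_ideal (p j) /\ {subset I <= p j}) /\ strict_chain p k) d.

Definition ring_dim (d : nat) : Prop := dim_mod (pred1 0) d.

Definition mod_dim V (d : nat) : Prop := dim_mod (annihilator V) d.

Definition regular_seq V (x : seq A) : Prop :=
  (forall k, (k < size x)%N -> forall v : V,
     x`_k *: v \in seq_mul V (take k x) -> v \in seq_mul V (take k x)) /\
  exists v : V, v \notin seq_mul V x.

Definition depth (m : {pred A}) V (r : nat) : Prop :=
  is_max (fun k => exists x : seq A,
    [/\ size x = k, {subset x <= m} & regular_seq V x]) r.

(* The zero module has no dimension in the sense of mod_dim, so that both
   notions below include being nonzero. *)
Definition cohen_macaulay (m : {pred A}) V : Prop :=
  exists2 r, depth m V r & mod_dim V r.

Definition max_cohen_macaulay (m : {pred A}) V : Prop :=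
  cohen_macaulay m V /\ exists2 d, ring_dim d & mod_dim V d.

(* m is generated by dim A elements *)
Definition regular_local (m : {pred A}) : Prop :=
  exists2 x : seq A, ring_dim (size x) & m =i seq_mul A^o x.

Definition projective V : Prop :=
  forall (U W : lmodType A) (g : {linear U -> W}) (f : {linear V -> W}),
    (forall w, exists u, g u = w) ->
    exists h : {linear V -> U}, forall v, g (h v) = f v.

Definition injective_mod V : Prop :=
  forall (U W : lmodType A) (g : {linear U -> W}) (f : {linear U -> V}),
    injective g ->
    exists h : {linear W -> V}, forall u, h (g u) = f u.

Definition exact_at (U V W : lmodType A) (f : U -> V) (g : V -> W) : Prop :=
  forall v, g v = 0 <-> exists u, f u = v.

(* a finite resolution ... -> P 1 -> P 0 -> V -> 0 by projectives *)
Definition finite_projdim V : Prop :=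
  exists (P : nat -> lmodType A) (d : forall j, {linear P j.+1 -> P j})
         (e : {linear P 0 -> V}),
  [/\ forall j, projective (P j),
      forall v, exists u, e u = v,
      exact_at (d 0) e,
      forall j, exact_at (d j.+1) (d j) &
      exists n, forall j, (n < j)%N -> forall u : P j, u = 0].

(* a finite resolution 0 -> V -> I 0 -> I 1 -> ... by injectives *)
Definition finite_injdim V : Prop :=
  exists (I : nat -> lmodType A) (d : forall j, {linear I j -> I j.+1})
         (e : {linear V -> I 0}),
  [/\ forall j, injective_mod (I j),
      injective e,
      exact_at e (d 0),
      forall j, exact_at (d j) (d j.+1) &
      exists n, forall j, (n < j)%N -> forall u : I j, u = 0].

Definition gorenstein_local (m : {pred A}) : Prop :=
  [/\ noetherian A, is_local m & finite_injdim A^o].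

(* Perfection over a Cohen-Macaulay local ring; over other rings this is not
   the usual condition grade V = projdim V. *)
Definition perfect (m : {pred A}) V : Prop :=
  [/\ exists v : V, v != 0, cohen_macaulay m V & finite_projdim V].

(* Resolution of V by the free modules F_j = A^(rank j); the differential
   F_(j+1) -> F_j is right multiplication of row vectors by diff j. *)
Record free_resolution V := FreeResolution {
  rank : nat -> nat;
  diff : forall j, 'M[A]_(rank j.+1, rank j);
  aug : {linear 'rV[A]_(rank 0) -> V};
  aug_surj : forall v, exists x, aug x = v;
  aug_exact : exact_at (fun x : 'rV_(rank 1) => x *m diff 0) aug;
  diff_exact : forall j, exact_at (fun x : 'rV_(rank j.+2) => x *m diff j.+1)
    (fun x : 'rV_(rank j.+1) => x *m diff j)
}.

End Invariants.

Section Existence.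
Variables (A : comNzRingType) (nA : noetherian A).

Lemma noetherian_rV n (W : {pred 'rV[A]_n}) : submod_closed W ->
  exists k (D : 'M[A]_(k, n)), forall x, x \in W <-> exists y, y *m D = x.
Proof.
elim: n W => [|n IHn] W [W0 Wlin].
  exists 0%N, 0 => x; split=> [_|_]; first by exists 0; apply/rowP; case.
  by rewrite (_ : x = 0) //; apply/rowP; case.
pose W1 := W : {pred 'rV[A]_(1 + n)}.
pose I : {pred A^o} := [pred a | `[< exists2 w, w \in W1 & w 0 0 = a >]].
have [x Ix] : exists x : seq A, I =i seq_mul A^o x.
  apply: nA; split=> [|a u v]; rewrite !inE.
    by apply/asboolP; exists 0; rewrite ?mxE.
  move=> /asboolP[u1 h1 <-] /asboolP[u2 h2 <-]; apply/asboolP.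
  by exists (a *: u1 + u2); [exact: Wlin | rewrite !mxE].
have IP a : a \in I <-> exists2 w, w \in W1 & w 0 0 = a.
  by rewrite inE; split=> /asboolP.
have [w hw] : exists w : 'I_(size x) -> 'rV[A]_(1 + n),
    forall j, w j \in W1 /\ w j 0 0 = x`_j.
  suff h (j : 'I_(size x)) : exists v, v \in W1 /\ v 0 0 = x`_j.
    by exists (fun j => sval (cid (h j))) => j; case: cid.
  have [|v Wv v0] := (IP x`_j).1; last by exists v.
  rewrite Ix inE; apply/asboolP; exists (fun k : nat => (k == j :> nat)%:R).
  rewrite (bigD1 j) //= eqxx [_ *: _]mulr1 big1 ?addr0 // => k kj.
  by rewrite (_ : (k == j :> nat) = false) ?scaler0 //; apply/negbTE.
have [|k [D hD]] := IHn [pred u | row_mx (0 : 'M_1) u \in W1].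
  split=> [|a u v]; rewrite !inE ?row_mx0 // => hu hv.
  rewrite (_ : row_mx _ _ = a *: row_mx 0 u + row_mx 0 v); first exact: Wlin.
  by rewrite scale_row_mx add_row_mx scaler0 addr0.
pose E : 'M[A]_(size x, 1 + n) := \matrix_j w j.
have WE y : y *m E \in W1.
  rewrite mulmx_sum_row; elim/big_ind: _ => //= [u v hu hv|j _].
    by rewrite -[u]scale1r; apply: Wlin.
  by rewrite rowK -[_ *: _]addr0; apply: Wlin => //; case: (hw j).
have WD y : y *m row_mx 0 D \in W1.
  by have /hD : exists z, z *m D = y *m D; [exists y | rewrite inE mul_mx_row mulmx0].
exists (size x + k)%N, (col_mx E (row_mx 0 D)) => v; split; last first.
  case=> y <-; rewrite -[y]hsubmxK mul_row_col -[_ *m E]scale1r.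
  by apply: Wlin.
move=> Wv; have : v 0 0 \in I by apply/IP; exists v.
rewrite Ix inE => /asboolP[c hc].
pose y1 : 'rV[A]_(size x) := \row_j c j.
pose u : 'rV[A]_(1 + n) := v - y1 *m E.
have Wu : u \in W1.
  by rewrite /u addrC -scaleN1r; apply: Wlin.
have u0 : lsubmx u = 0.
  apply/rowP => j; rewrite !ord1 !mxE (_ : lshift n 0 = 0); last exact: val_inj.
  rewrite hc (eq_bigr (fun j => y1 0 j * E j 0)) ?subrr // => l _.
  by rewrite !mxE (hw l).2 [_ *: _]mulrC.
have /hD [y2 hy2] : rsubmx u \in [pred u | row_mx (0 : 'M_1) u \in W1].
  by rewrite inE -u0 hsubmxK.
exists (row_mx y1 y2).
have e : y2 *m row_mx (0 : 'M_(k, 1)) D = u.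
  by rewrite mul_mx_row mulmx0 hy2 -u0 hsubmxK.
by rewrite mul_row_col [X in _ + X]e /u addrC subrK.
Qed.

Lemma free_resolution_exists (V : lmodType A) :
  fin_gen V -> inhabited (free_resolution V).
Proof.
case=> x hx.
pose f (y : 'rV[A]_(size x)) : V := \sum_j y 0 j *: x`_j.
have flin : linear f.
  move=> a u v; rewrite /f scaler_sumr -big_split /=; apply: eq_bigr => j _.
  by rewrite !mxE scalerDl scalerA.
pose fL : {linear 'rV[A]_(size x) -> V} :=
  HB.pack f (GRing.isLinear.Build _ _ _ _ f flin).
have step p q (D : 'M[A]_(p, q)) : exists E : {k & 'M[A]_(k, p)},
    exact_at (fun y : 'rV_(tag E) => y *m tagged E) (fun y : 'rV_p => y *m D).
  have [|k [E hE]] := @noetherian_rV p [pred y | y *m D == 0].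
    split=> [|a u v]; rewrite !inE ?mul0mx // => /eqP hu /eqP hv.
    by rewrite mulmxDl -scalemxAl hu hv scaler0 addr0.
  exists (Tagged (fun k => 'M[A]_(k, p)) E) => y; rewrite -hE inE; split=> [->|/eqP] //.
have [k0 [E0 hE0]] : exists k (D : 'M[A]_(k, size x)),
    exact_at (fun y : 'rV_k => y *m D) fL.
  have [|k [E hE]] := @noetherian_rV _ [pred y | fL y == 0].
    split=> [|a u v]; rewrite !inE ?linear0 // => /eqP hu /eqP hv.
    by rewrite linearP hu hv scaler0 addr0.
  by exists k, E => y; rewrite -hE inE; split=> [->|/eqP].
pose S := {p : nat & {q & 'M[A]_(p, q)}}.
pose next (s : S) : S :=
  let E := sval (cid (step _ _ (tagged (tagged s)))) in
  Tagged (fun p => {q & 'M[A]_(p, q)}) (Tagged (fun q => 'M_(tag E, q)) (tagged E)).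
pose s j := iter j next (Tagged (fun p => {q & 'M[A]_(p, q)})
   (Tagged (fun q => 'M[A]_(k0, q)) E0)).
pose rk j := tag (tagged (s j)).
pose D j : 'M[A]_(rk j.+1, rk j) := tagged (tagged (s j)).
constructor; apply: (@FreeResolution _ _ rk D fL _ hE0) => [v|j].
  by have [c ->] := hx v; exists (\row_j c j); apply: eq_bigr => j _; rewrite mxE.
rewrite /D /= /rk /=; exact: (svalP (cid (step _ _ (tagged (tagged (s j)))))).
Qed.

End Existence.

Section MatrixAction.
Variables (A : comNzRingType) (Q : lmodType A) (p q : nat) (D : 'M[A]_(p, q)).

(* A^p (x) Q = Q^p, and this is D (x) Q : Q^p -> Q^q. *)
Definition mx_act (y : {ffun 'I_p -> Q}) : {ffun 'I_q -> Q} :=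
  [ffun k => \sum_j D j k *: y j].

Lemma mx_act_linear : linear mx_act.
Proof.
move=> a u v; apply/ffunP => k; rewrite !ffunE scaler_sumr -big_split /=.
by apply: eq_bigr => j _; rewrite !ffunE scalerDr !scalerA mulrC.
Qed.
HB.instance Definition _ := GRing.isLinear.Build A _ _ _ mx_act mx_act_linear.

End MatrixAction.
Arguments mx_act {A} Q {p q} D y.

Section Derived.
Variables (A : comNzRingType) (M : lmodType A) (F : free_resolution M).
Variable Q : lmodType A.

(* Tor_i(M, Q) is the homology of F (x) Q, whose terms are Q^(rank i); up to
   isomorphism it does not depend on the resolution F of M. *)
Definition Tor (i : nat) : lmodType A :=
  match i with
  | 0 => homology (mx_act Q (diff F 0)) (\0 : {ffun 'I_(rank F 0) -> Q} -> Q)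
  | j.+1 => homology (mx_act Q (diff F j.+1)) (mx_act Q (diff F j))
  end.

(* Ext^i(M, Q) is the cohomology of Hom(F, Q): evaluation on the standard basis
   identifies Hom(A^p, Q) with Q^p, and composition with diff j becomes the
   action of its transpose. *)
Definition Ext (i : nat) : lmodType A :=
  match i with
  | 0 => homology (\0 : Q -> {ffun 'I_(rank F 0) -> Q}) (mx_act Q (diff F 0)^T)
  | j.+1 => homology (mx_act Q (diff F j)^T) (mx_act Q (diff F j.+1)^T)
  end.

End Derived.

(* The lengths of the L n agree for large n with a polynomial of degree e,
   where the zero polynomial has degree -1. *)
Definition length_degree (A : comNzRingType) (L : nat -> lmodType A) (e : int) :
    Prop :=
  exists2 P : {poly rat},
    exists n0, forall n, (n0 <= n)%N ->
      exists2 l, has_length (L n) l & P.[n%:R] = l%:R &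
    e = (size P)%:Z - 1.

(* r_i^{m,N}(M) = e and s^i_{m,N}(M) = e, computed from the resolution F of M *)
Definition Tor_degree (A : comNzRingType) (m : {pred A}) (N M : lmodType A)
    (F : free_resolution M) (i : nat) (e : int) : Prop :=
  length_degree (fun n => Tor F (quot_exp N m n) i) e.

Definition Ext_degree (A : comNzRingType) (m : {pred A}) (N M : lmodType A)
    (F : free_resolution M) (i : nat) (e : int) : Prop :=
  length_degree (fun n => Ext F (quot_exp N m n) i) e.

(* Main.v *)
(* X_i = im (F_i (x) N -> F_(i-1) (x) N) sits in G = N^(rank F_(i-1)).  As
   Tor_i(M, N) = 0, Tor_i(M, N/m^n N) = (X_i cap m^n G) / m^n X_i, so its length is
   eventually polynomial in n (Hilbert-Samuel), and by Artin-Rees its sums over n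
   are O(n^t).  Splitting off the part of the differential that is invertible modulo
   m leaves a submodule X_0 of X_i inside m G, so that m^(n-1) X_0 / m^n X_0 embeds
   in the homology; X_0 carries a regular sequence of length t, which gives the
   matching lower bound unless X_0 = 0.  In that case the differential splits, and
   since Hom(F, A) is exact M would be free.  The same argument applies to
   Hom(F, N/m^n N).

   The vanishing of Tor_i(M, N) and Ext^i(M, N) rests on Ext^i(M, A) = 0: A/m embeds
   in A/(y) for a maximal A-regular sequence y, so the injective dimension of A is at
   most the length of y, hence at most d, and M has a regular sequence of length d.
   Modules N of finite projective dimension then satisfy Ext^1(L, N) = 0 for all L
   with Ext^i(L, A) = 0, and both vanishing statements are instances of this, applied
   to the cokernels of F and of its dual.  *)
Require Import Defs.
From HB Require Import structures.
From mathcomp Require Import all_boot all_order all_algebra.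
From mathcomp Require Import ring_quotient generic_quotient boolp functions.
From mathcomp Require Import ring zify lra.
From mathcomp.multinomials Require freeg.

Set Implicit Arguments.
Unset Strict Implicit.
Unset Printing Implicit Defensive.

Import Order.TTheory GRing.Theory Num.Theory.
Local Open Scope ring_scope.

(** * Submodules and Noetherian modules *)

(** The resolution [F] need not be minimal, so non-freeness of [M] cannot be read off from entries
    of the differentials. What survives is that no differential [D] has an [E] with
    [D = D *m E *m D]; the matrix [E] of [inner_inverse] replaces the passage to a minimal
    resolution. A submodule of N^r does not inherit regular sequences. For [X_0] this needs
    exactness with coefficients in N/(x_1, ..., x_k)N for every k, which is why the vanishing
    criterion is shown to pass to quotients by regular elements. The same sequence x_1, ..., x_t
    also cuts [N] down to finite length, and this is where the exponent t of the upper bound comes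
    from. Artin-Rees compares the filtrations only up to a shift, and regular sequences control only
    cumulative Hilbert-Samuel functions. Hence growth is estimated for sums: these agree with a
    polynomial of degree t, and its difference polynomial has degree t - 1. Lengths are measured
    between submodules of one module, and graded modules are sequences of such submodules; Hilbert's
    theorem and Artin-Rees are thus statements about pairs W_n inside U_n. *)

Lemma pred_ext (T : Type) (P Q : T -> Prop) : (forall x, P x <-> Q x) -> P = Q.
Proof. by move=> h; apply/funext => x; apply/propext. Qed.

Section Submodules.
Variable A : comNzRingType.

Definition submod (V : lmodType A) (P : V -> Prop) : Prop :=
  P 0 /\ forall a u v, P u -> P v -> P (a *: u + v).

Definition subp (T : Type) (P Q : T -> Prop) : Prop := forall v, P v -> Q v.

Lemma subpp (T : Type) (P : T -> Prop) : subp P P. Proof. by []. Qed.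

Lemma subp_trans (T : Type) (Q P R : T -> Prop) : subp P Q -> subp Q R -> subp P R.
Proof. by move=> h1 h2 v /h1 /h2. Qed.

Definition sump (V : lmodType A) (P Q : V -> Prop) (v : V) : Prop :=
  exists p q, [/\ P p, Q q & v = p + q].

Definition capp (T : Type) (P Q : T -> Prop) (v : T) : Prop := P v /\ Q v.

Definition fullp (T : Type) (v : T) : Prop := True.

Definition nullp (V : lmodType A) (v : V) : Prop := v = 0.

Fixpoint spanp (V : lmodType A) (s : seq V) (v : V) : Prop :=
  if s is x :: s' then exists c w, spanp s' w /\ v = c *: x + w else v = 0.

(* a_1 U + ... + a_k U *)
Fixpoint mulp (V : lmodType A) (a : seq A) (U : V -> Prop) (v : V) : Prop :=
  if a is x :: a' then exists u w, [/\ U u, mulp a' U w & v = x *: u + w]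
  else v = 0.

Definition imgp (V V' : lmodType A) (f : V -> V') (U : V -> Prop) (v : V') : Prop :=
  exists2 u, U u & f u = v.

Section Basics.
Variable V : lmodType A.
Implicit Types P Q U W : V -> Prop.

Lemma submod0 P : submod P -> P 0. Proof. by case. Qed.
Lemma submodD P u v : submod P -> P u -> P v -> P (u + v).
Proof. by case=> _ h pu pv; rewrite -[u]scale1r; apply: h. Qed.
Lemma submodZ P a u : submod P -> P u -> P (a *: u).
Proof. by case=> p0 h pu; rewrite -[_ *: _]addr0; apply: h. Qed.
Lemma submodN P u : submod P -> P u -> P (- u).
Proof. by move=> hP pu; rewrite -scaleN1r; apply: submodZ. Qed.
Lemma submodB P u v : submod P -> P u -> P v -> P (u - v).
Proof. by move=> hP pu pv; apply: submodD => //; apply: submodN. Qed.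
Lemma submod_sum P (I : Type) (r : seq I) (R : pred I) (F : I -> V) :
  submod P -> (forall i, R i -> P (F i)) -> P (\sum_(i <- r | R i) F i).
Proof.
move=> hP hF; elim/big_rec: _ => [|i x Ri Px]; first exact: submod0.
by apply: submodD => //; apply: hF.
Qed.

Lemma submod_closedE P : submod_closed [pred v | `[< P v >]] <-> submod P.
Proof.
split=> [[h0 h]|[h0 h]]; split.
- by move: h0; rewrite inE => /asboolP.
- move=> a u v Pu Pv; have := h a u v; rewrite !inE.
  by move=> /(_ (asboolT Pu) (asboolT Pv)) /asboolP.
- by rewrite inE; apply/asboolP.
- by move=> a u v; rewrite !inE => /asboolP Pu /asboolP Pv; apply/asboolP/h.
Qed.

Lemma submod_pred (W : {pred V}) : submod_closed W -> submod (fun v => v \in W).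
Proof. by case=> h0 h; split. Qed.

Lemma submod_full : submod (fullp (T:=V)). Proof. by []. Qed.
Lemma submod_null : submod (@nullp V).
Proof. by split=> // a u v -> ->; rewrite scaler0 addr0. Qed.
Lemma submod_add P Q : submod P -> submod Q -> submod (sump P Q).
Proof.
move=> hP hQ; split; first by exists 0, 0; rewrite addr0; split=> //; apply: submod0.
move=> a u v [p [q [Pp Qq ->]]] [p' [q' [Pp' Qq' ->]]].
exists (a *: p + p'), (a *: q + q'); split; [exact: hP.2|exact: hQ.2|].
by rewrite scalerDr addrACA.
Qed.
Lemma submod_cap P Q : submod P -> submod Q -> submod (capp P Q).
Proof.
move=> hP hQ; split; first by split; apply: submod0.
by move=> a u v [Pu Qu] [Pv Qv]; split; [apply: hP.2|apply: hQ.2].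
Qed.
Lemma submod_span (s : seq V) : submod (@spanp V s).
Proof.
elim: s => [|x s IH] /=; first exact: submod_null.
split; first by exists 0, 0; rewrite scale0r addr0; split=> //; apply: submod0.
move=> a u v [c [w [sw ->]]] [c' [w' [sw' ->]]].
exists (a * c + c'), (a *: w + w'); split; first exact: IH.2.
by rewrite scalerDr scalerDl scalerA addrACA.
Qed.
Lemma submod_gen a U : submod U -> submod (mulp a U).
Proof.
move=> hU; elim: a => [|x s IH] /=; first exact: submod_null.
split; first by exists 0, 0; rewrite scaler0 addr0; split=> //; apply: submod0.
move=> a u v [c [w [uc sw ->]]] [c' [w' [uc' sw' ->]]].
exists (a *: c + c'), (a *: w + w'); split; [exact: hU.2|exact: IH.2|].
by rewrite !scalerDr !scalerA addrACA (mulrC a).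
Qed.

Lemma sumpl P Q : submod Q -> subp P (sump P Q).
Proof. by move=> hQ v Pv; exists v, 0; rewrite addr0; split=> //; apply: submod0. Qed.
Lemma sumpr P Q : submod P -> subp Q (sump P Q).
Proof. by move=> hP v Pv; exists 0, v; rewrite add0r; split=> //; apply: submod0. Qed.
Lemma sump_sub P Q U : submod U -> subp P U -> subp Q U -> subp (sump P Q) U.
Proof.
by move=> hU h1 h2 v [p [q [Pp Qq ->]]]; apply: submodD; [|apply: h1|apply: h2].
Qed.
Lemma sump_mono P Q P' Q' : subp P P' -> subp Q Q' -> subp (sump P Q) (sump P' Q').
Proof.
by move=> h1 h2 v [p [q [Pp Qq ->]]]; exists p, q; split=> //; [apply: h1|apply: h2].
Qed.

Lemma sump_null P : sump P (nullp (V := V)) = P.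
Proof.
apply: pred_ext => v; split=> [[u [_ [Pu -> ->]]]|Pv]; first by rewrite addr0.
by exists v, 0; rewrite addr0.
Qed.

Lemma spanp_sub s U : submod U -> (forall x, x \in s -> U x) -> subp (spanp s) U.
Proof.
move=> hU; elim: s => [|x s IH] /= hs v; first by move=> ->; apply: submod0.
case=> c [w [sw ->]]; apply: hU.2; first by apply: hs; rewrite mem_head.
by apply: IH => // y ys; apply: hs; rewrite inE ys orbT.
Qed.
Lemma mem_spanp (s : seq V) x : x \in s -> spanp s x.
Proof.
elim: s => // y s IH; rewrite inE => /orP[/eqP ->|/IH h] /=.
  exists 1, 0; rewrite scale1r addr0; split=> //; exact: submod0 (submod_span s).
by exists 0, x; rewrite scale0r add0r.
Qed.

Lemma mulp_mono a U W : subp U W -> subp (mulp a U) (mulp a W).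
Proof.
move=> h; elim: a => [|x a IH] v //= [u [w [Uu gw ->]]].
by exists u, w; split=> //; [apply: h|apply: IH].
Qed.
Lemma mulp_sub a U W : submod W -> (forall x u, x \in a -> U u -> W (x *: u)) ->
  subp (mulp a U) W.
Proof.
move=> hW; elim: a => [|x a IH] h v /=; first by move=> ->; apply: submod0.
case=> u [w [Uu gw ->]]; apply: submodD => //; first by apply: h; rewrite // mem_head.
by apply: IH gw => y z ya; apply: h; rewrite inE ya orbT.
Qed.
Lemma mem_mulp a U x u : submod U -> x \in a -> U u -> mulp a U (x *: u).
Proof.
move=> hU; elim: a => // y a IH; rewrite inE => /orP[/eqP ->|/IH h] Uu /=.
  by exists u, 0; rewrite addr0; split=> //; apply: submod0; apply: submod_gen.
by exists 0, (x *: u); rewrite scaler0 add0r; split=> //; [apply: submod0|apply: h].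
Qed.
Lemma mulp_subU a U : submod U -> subp (mulp a U) U.
Proof. by move=> hU; apply: mulp_sub => // x u _; apply: submodZ. Qed.
Lemma mulp_add a U W : submod U -> submod W ->
  mulp a (sump U W) = sump (mulp a U) (mulp a W).
Proof.
move=> hU hW; apply: pred_ext => v; split; last first.
  apply: sump_sub; first by apply: submod_gen; apply: submod_add.
    by apply: mulp_mono; apply: sumpl.
  by apply: mulp_mono; apply: sumpr.
apply: mulp_sub; first by apply: submod_add; apply: submod_gen.
move=> x u xa [p [q [Up Wq ->]]]; exists (x *: p), (x *: q); rewrite scalerDr.
by split=> //; apply: mem_mulp.
Qed.

End Basics.

Section Images.
Variables (V V' : lmodType A) (f : {linear V -> V'}).

Lemma submod_img (U : V -> Prop) : submod U -> submod (imgp f U).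
Proof.
move=> hU; split; first by exists 0; rewrite ?linear0 //; apply: submod0.
move=> a u v [u' Uu <-] [v' Uv <-]; exists (a *: u' + v'); first exact: hU.2.
by rewrite linearP.
Qed.
Lemma submod_preim (W : V' -> Prop) : submod W -> submod (fun v => W (f v)).
Proof.
move=> hW; split; first by rewrite linear0; apply: submod0.
by move=> a u v Wu Wv; rewrite linearP; apply: hW.2.
Qed.
Lemma submod_ker : submod (fun v => f v = 0).
Proof. exact: (submod_preim (submod_null V')). Qed.
Lemma imgp_mulp a (U : V -> Prop) : imgp f (mulp a U) = mulp a (imgp f U).
Proof.
apply: pred_ext => v; elim: a v => [|x a IH] v /=.
  by split=> [[u ->]|->]; rewrite ?linear0 //; exists 0; rewrite ?linear0.
split=> [[_ [u [w [Uu gw ->]]] <-]|[_ [w [[u Uu <-] /IH[w' gw <-] ->]]]].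
  exists (f u), (f w); rewrite linearP; split=> //; first by exists u.
  by apply/IH; exists w.
by exists (x *: u + w'); rewrite ?linearP //; exists u, w'.
Qed.
End Images.

Definition mklinear (U V : lmodType A) (f : U -> V) (fl : linear f) : {linear U -> V} :=
  HB.pack f (GRing.isLinear.Build _ _ _ _ f fl).

Lemma quotmod_pi (V : lmodType A) (W : submodClosed V) :
  exists p : {linear V -> quotmod W},
    (forall q, exists v, p v = q) /\ forall v, p v = 0 <-> v \in W.
Proof.
pose p := (\pi_(quotmod W))%qT : V -> quotmod W.
have pl : linear p.
  move=> a u v; rewrite /p /= pi_addm; congr (_ + _); exact: pi_scale.
exists (mklinear pl); split=> [q|v] /=; first by exists (repr q)%qT; rewrite /p reprK.
rewrite -[v in v \in W]subr0 -quotmod_eq.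
have -> : (0 : quotmod W) = p 0 by rewrite -[p]/(mklinear pl : V -> _) linear0.
by split=> /eqP.
Qed.

Lemma quo_exists (V : lmodType A) (P : V -> Prop) : submod P ->
  exists (Q : lmodType A) (p : {linear V -> Q}),
    (forall q, exists v, p v = q) /\ forall v, p v = 0 <-> P v.
Proof.
move=> /submod_closedE hP.
pose W0 : {pred V} := [pred v | `[< P v >]].
pose W : submodClosed V := HB.pack W0 (GRing.isSubmodClosed.Build A V W0 hP).
have [p [ps pk]] := quotmod_pi W; exists (quotmod W), p; split=> // v.
by rewrite pk inE; split=> /asboolP.
Qed.

Lemma factor_surj (L C X : lmodType A) (p : {linear L -> C}) (f : {linear L -> X}) :
  (forall c, exists v, p v = c) -> (forall v, p v = 0 -> f v = 0) ->
  exists h : {linear C -> X}, forall v, h (p v) = f v.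
Proof.
move=> ps pf; have [s hs] := choice ps; pose h c := f (s c).
have hp v : h (p v) = f v.
  by apply/eqP; rewrite -subr_eq0 -linearB; apply/eqP/pf; rewrite linearB /= hs subrr.
have hl : linear h.
  move=> a u v; have [u' <-] := ps u; have [v' <-] := ps v.
  by rewrite -linearP !hp linearP.
by exists (mklinear hl).
Qed.

Lemma factor_inj (K P L : lmodType A) (k : {linear K -> P}) (f : {linear L -> P}) :
  injective k -> (forall v, exists x, k x = f v) ->
  exists h : {linear L -> K}, forall v, k (h v) = f v.
Proof.
move=> ki fk; have [h hh] := choice fk.
have hl : linear h by move=> a u v; apply: ki; rewrite linearP !hh linearP.
by exists (mklinear hl).
Qed.

(** [kermod] already carries a module structure, so [P] is realised as the kernel of the projection
    onto the quotient by [P]. *)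
Lemma sub_exists (V : lmodType A) (P : V -> Prop) : submod P ->
  exists (S : lmodType A) (i : {linear S -> V}),
    injective i /\ forall v, P v <-> exists x, i x = v.
Proof.
move=> /quo_exists[Q [p [_ hp]]].
pose i (x : kermod p) : V := val x.
have il : linear i by [].
exists (kermod p), (mklinear il).
split; first exact: val_inj.
move=> v; split=> [/hp pv|[x <-]] /=; last first.
  by apply/hp/eqP; have := valP x.
have kv : v \in kerp p by rewrite inE pv.
by exists (exist _ v kv).
Qed.

Lemma free_lift n (P N : lmodType A) (p : {linear P -> N}) (f : {linear 'rV[A]_n -> N}) :
  (forall x, exists y, p y = x) -> exists g : {linear 'rV[A]_n -> P}, forall v, p (g v) = f v.
Proof.
move=> ps; have [s hs] := choice (fun i => ps (f (delta_mx 0 i))).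
pose g (v : 'rV[A]_n) := \sum_i v 0 i *: s i.
have gl : linear g.
  move=> a u v; rewrite /g scaler_sumr -big_split /=; apply: eq_bigr => i _.
  by rewrite !mxE scalerDl scalerA.
exists (mklinear gl) => v /=.
rewrite {2}[v]row_sum_delta !linear_sum; apply: eq_bigr => i _.
by rewrite !linearZ /= hs.
Qed.

End Submodules.
#[global] Hint Resolve subpp : core.

Section Noeth.
Variable A : comNzRingType.

Definition noeth (V : lmodType A) : Prop :=
  forall P : V -> Prop, submod P -> exists s, P = spanp s.

Definition fg (V : lmodType A) : Prop :=
  exists n (f : {linear 'rV[A]_n -> V}), forall v, exists x, f x = v.

Lemma fin_gen_fg (V : lmodType A) : fin_gen V -> fg V.
Proof.
move=> [x hx]; exists (size x).
pose f (y : 'rV[A]_(size x)) : V := \sum_j y 0 j *: x`_j.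
have flin : linear f.
  move=> a u v; rewrite /f scaler_sumr -big_split /=; apply: eq_bigr => j _.
  by rewrite !mxE scalerDl scalerA.
exists (mklinear flin) => v.
by have [c ->] := hx v; exists (\row_j c j); apply: eq_bigr => j _; rewrite mxE.
Qed.

Lemma fg_surj (V V' : lmodType A) (f : {linear V -> V'}) :
  fg V -> (forall v, exists x, f x = v) -> fg V'.
Proof.
move=> [n [g gs]] fs; exists n, (f \o g) => v.
by have [x <-] := fs v; have [y <-] := gs x; exists y.
Qed.

(** The preimage of [P] in the free module is the row space of a matrix [D], and the images of its
    rows span [P]. *)
Lemma fg_noeth (V : lmodType A) : noetherian A -> fg V -> noeth V.
Proof.
move=> nA [n [f fs]] P hP.
have /submod_closedE hW := submod_preim f hP.
have [k [D hD]] := noetherian_rV nA hW.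
exists [seq f (row i D) | i <- enum 'I_k]; apply: pred_ext => v; split.
  move=> Pv; have [x xv] := fs v.
  have [|y yx] := (hD x).1; first by rewrite inE; apply/asboolP; rewrite xv.
  rewrite -xv -yx mulmx_sum_row linear_sum; apply: submod_sum => [|i _]; first exact: submod_span.
  by rewrite linearZ; apply: submodZ; [apply: submod_span|apply: mem_spanp; apply: map_f; rewrite mem_enum].
apply: spanp_sub => // x /mapP[i _ ->].
have : row i D \in [pred v | `[< P (f v) >]] by apply/hD; exists (delta_mx 0 i); rewrite -rowE.
by rewrite inE => /asboolP.
Qed.

Lemma fg_submod (V S : lmodType A) (i : {linear S -> V}) :
  noeth V -> injective i -> fg S.
Proof.
move=> nV ii; have [s hs] := nV _ (submod_img i (submod_full S)).
have hx (j : 'I_(size s)) : exists y, i y = s`_j.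
  suff [y _ <-] : imgp i (@fullp S) s`_j by exists y.
  by rewrite hs; apply: mem_spanp; apply: mem_nth.
have [y hy] := choice hx.
pose f (u : 'rV[A]_(size s)) : S := \sum_j u 0 j *: y j.
have flin : linear f.
  move=> a u v; rewrite /f scaler_sumr -big_split /=; apply: eq_bigr => j _.
  by rewrite !mxE scalerDl scalerA.
exists (size s), (mklinear flin) => v /=.
have : spanp s (i v) by rewrite -hs; exists v.
have spanE t w : @spanp A V t w -> exists c : nat -> A, w = \sum_(j < size t) c j *: t`_j.
  elim: t w => [|z t IH] w /=; first by move=> ->; exists (fun=> 0); rewrite big_ord0.
  move=> [c [w' [/IH[c' ->] ->]]]; exists (fun j => if j is j'.+1 then c' j' else c).
  by rewrite big_ord_recl.
move=> /spanE[c hc]; exists (\row_j c j); apply: ii.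
rewrite hc linear_sum; apply: eq_bigr => j _ /=.
by rewrite linearZ /= hy mxE.
Qed.

Lemma fg_ker (V L : lmodType A) (p : {linear V -> L}) : noeth V ->
  exists (S : lmodType A) (i : {linear S -> V}),
    [/\ injective i, fg S & exact_at i p].
Proof.
move=> nV; have [S [i [ii iP]]] := sub_exists (submod_ker p).
by exists S, i; split=> //; exact: fg_submod ii.
Qed.

Lemma fg_rV n : fg 'rV[A]_n.
Proof. by exists n, (idfun : {linear 'rV[A]_n -> 'rV[A]_n}) => v; exists v. Qed.

Lemma fg_regular : fg A^o.
Proof.
pose f (u : 'rV[A]_1) : A^o := u 0 0.
have flin : linear f by move=> a u v; rewrite /f !mxE.
exists 1%N, (mklinear flin) => v /=.
by exists (const_mx v); rewrite /f mxE.
Qed.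

Lemma fg_ffun n (V : lmodType A) : fg V -> fg {ffun 'I_n -> V}.
Proof.
move=> [k [f fs]].
pose g (u : 'rV[A]_(n * k)) : {ffun 'I_n -> V} := [ffun i => f (row i (vec_mx u))].
have glin : linear g.
  by move=> a u v; apply/ffunP => i; rewrite !ffunE !linearP.
exists (n * k)%N, (mklinear glin) => v /=.
have [s hs] := choice (fun i => fs (v i)).
exists (mxvec (\matrix_i s i)); apply/ffunP => i.
by rewrite ffunE mxvecK rowK hs.
Qed.

Section Induction.
Variables (V : lmodType A) (nV : noeth V).

Lemma noeth_chain (C : nat -> V -> Prop) : (forall k, submod (C k)) ->
  (forall k, subp (C k) (C k.+1)) -> exists K, forall k, (K <= k)%N -> C k = C K.
Proof.
move=> hC Cs; have Cm i j : (i <= j)%N -> subp (C i) (C j).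
  elim: j => [|j IH]; first by rewrite leqn0 => /eqP ->.
  rewrite leq_eqVlt => /orP[/eqP -> //|]; rewrite ltnS => /IH h v /h; exact: Cs.
pose U v := exists k, C k v.
have hU : submod U.
  split; first by exists 0%N; apply: submod0.
  move=> a u v [i Ci] [j Cj]; exists (maxn i j); apply: (hC _).2.
    by apply: Cm Ci; rewrite leq_maxl.
  by apply: Cm Cj; rewrite leq_maxr.
have [s hs] := nV hU.
have [K hK] : exists K, forall x, x \in s -> C K x.
  have : forall x, x \in s -> U x by rewrite hs => x; apply: mem_spanp.
  elim: s {hs} => [|x s IH] h; first by exists 0%N.
  have [|K hK] := IH; first by move=> y ys; apply: h; rewrite inE ys orbT.
  have [k hk] := h x (mem_head _ _).
  exists (maxn k K) => y; rewrite inE => /orP[/eqP ->|/hK].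
    by apply: Cm hk; rewrite leq_maxl.
  by apply: Cm; rewrite leq_maxr.
exists K => k Kk; apply: pred_ext => v; split; last exact: Cm.
move=> Ckv; have : U v by exists k.
by rewrite hs; apply: spanp_sub.
Qed.

(** If [Phi] failed at [K0], every failing submodule would lie strictly inside another failing one;
    the chain chosen in this way contradicts [noeth_chain]. *)
Lemma noeth_ind (Phi : (V -> Prop) -> Prop) :
  (forall K, submod K ->
     (forall K', submod K' -> subp K K' -> K' <> K -> Phi K') -> Phi K) ->
  forall K, submod K -> Phi K.
Proof.
move=> step K0 hK0; apply: contrapT => nK0.
pose T := {K : V -> Prop | submod K /\ ~ Phi K}.
have next (K : T) : exists K' : T, subp (sval K) (sval K') /\ sval K' <> sval K.
  case: K => K /= [hK nK]; apply: contrapT => h; apply: nK; apply: step => // K' hK' KK' ne.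
  by apply: contrapT => nK'; apply: h; exists (exist _ K' (conj hK' nK')).
have [F hF] := choice next.
pose C k := sval (iter k F (exist _ K0 (conj hK0 nK0))).
have [||K hK] := @noeth_chain C.
- by move=> k; case: (svalP (iter k F (exist _ K0 (conj hK0 nK0)))).
- by move=> k; case: (hF (iter k F (exist _ K0 (conj hK0 nK0)))).
have := (hF (iter K F (exist _ K0 (conj hK0 nK0)))).2; apply.
exact: (hK K.+1 (leqnSn _)).
Qed.

Lemma noeth_max (S : (V -> Prop) -> Prop) (P0 : V -> Prop) : submod P0 -> S P0 ->
  (forall P, S P -> submod P) ->
  exists P, [/\ S P, subp P0 P & forall Q, S Q -> subp P Q -> Q = P].
Proof.
move=> hP0 SP0 Ssub.
have := @noeth_ind (fun K => S K ->
  exists P, [/\ S P, subp K P & forall Q, S Q -> subp P Q -> Q = P]).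
move=> /(_ _ P0 hP0 SP0); apply => K hK IH SK.
have [h|] := pselect (forall Q, S Q -> subp K Q -> Q = K); first by exists K; split=> // v.
move=> /existsNP[Q] /not_implyP[SQ] /not_implyP[KQ ne].
have [P [SP QP mP]] := IH Q (Ssub _ SQ) KQ ne SQ.
by exists P; split=> // v /KQ /QP.
Qed.

End Induction.

End Noeth.

(** * Primes, Nakayama and associated primes *)

Section Local.
Variable A : comNzRingType.
Hypothesis nA : noetherian A.

Definition ideal (I : A -> Prop) : Prop := submod (I : A^o -> Prop).

Definition primep (P : A -> Prop) : Prop :=
  [/\ ideal P, ~ P 1 & forall a b, P (a * b) -> P a \/ P b].

Lemma idealM (I : A -> Prop) a b : ideal I -> I b -> I (a * b).
Proof. by move=> hI Ib; apply: (submodZ a hI Ib). Qed.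

Lemma idealr_closedE (I : {pred A}) :
  idealr_closed I <-> ideal (fun a => a \in I) /\ 1 \notin I.
Proof.
split=> [[h0 h1 h]|[[h0 h] h1]].
  by split=> //; split=> // a u v Iu Iv; apply: h.
by split=> // a u v Iu Iv; apply: h.
Qed.

Lemma primep_pred (P : A -> Prop) : primep P ->
  prime_ideal [pred a | `[< P a >]].
Proof.
move=> [hP P1 hab]; split.
  apply/idealr_closedE; split; last by rewrite inE; apply/asboolP.
  by apply/submod_pred/(submod_closedE (V := A^o)).
move=> u v; rewrite inE => /asboolP/hab[h|h]; apply/orP; [left|right];
  by rewrite inE; apply/asboolP.
Qed.

Lemma prime_idealE (P : {pred A}) : prime_ideal P -> primep (fun a => a \in P).
Proof.
move=> [/idealr_closedE[hP P1] h]; split=> //; first by apply/negP.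
by move=> a b /h /orP.
Qed.

Lemma noeth_regular : noeth A^o. Proof. exact: fg_noeth nA (fg_regular A). Qed.

(** An ideal [P] maximal among those missing [S] is prime: if neither [a] nor [b] lies in [P], then
    [P + (a)] and [P + (b)] both meet [S], and the product of the two elements found would lie in
    [P] as soon as [a * b] does. *)
Lemma prime_avoiding_mult (S I : A -> Prop) : S 1 ->
  (forall a b, S a -> S b -> S (a * b)) -> ideal I -> (forall a, S a -> ~ I a) ->
  exists P, [/\ primep P, subp I P & forall a, S a -> ~ P a].
Proof.
move=> S1 SM hI SI.
have [||P [[hP SP] IP Pmax]] := @noeth_max _ _ noeth_regular
  (fun P => ideal P /\ forall a, S a -> ~ P a) I hI.
- by [].
- by move=> P [].
exists P; split=> //; split=> //; first exact: SP.
move=> a b Pab; apply: contrapT => /not_orP[nPa nPb].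
have key c : ~ P c -> exists s, S s /\ sump (P : A^o -> Prop) (fun z => exists y, z = y * c) s.
  move=> nPc; apply: contrapT => h.
  pose Q : A^o -> Prop := sump (P : A^o -> Prop) (fun z => exists y, z = y * c).
  have hc : ideal (fun z => exists y, z = y * c).
    split; first by exists 0; rewrite mul0r.
    move=> x _ _ [y ->] [y' ->]; exists (x * y + y').
    by rewrite mulrDl -mulrA.
  have hQ : submod Q by exact: submod_add.
  have QP : Q = P.
    apply: Pmax; last exact: sumpl.
    split=> // s Ss Qs; apply: h; by exists s.
  apply: nPc; rewrite -QP; apply: sumpr => //; by exists 1; rewrite mul1r.
have [s [Ss [p [_ [Pp [y ->] es]]]]] := key a nPa.
have [s' [Ss' [p' [_ [Pp' [y' ->] es']]]]] := key b nPb.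
apply: (SP (s * s')); first exact: SM.
have -> : s * s' = s' * p + (y * a) * p' + (y * y') * (a * b).
  by rewrite es es'; ring.
by apply: (submodD hP); [apply: (submodD hP)|]; apply: idealM.
Qed.

Variable m : {pred A}.
Hypothesis lm : is_local m.

Lemma ideal_max : ideal (fun a => a \in m).
Proof. by case: lm => -[/idealr_closedE[]]. Qed.

Lemma max_not1 : 1 \notin m.
Proof. by case: lm => -[/idealr_closedE[]]. Qed.

Lemma proper_sub_max (I : A -> Prop) : ideal I -> ~ I 1 -> forall a, I a -> a \in m.
Proof.
move=> hI I1; have [||P [[hP P1] IP Pmax]] := @noeth_max _ _ noeth_regular
  (fun P => ideal P /\ ~ P 1) I hI.
- by [].
- by move=> P [].
have mP : maximal_ideal [pred a | `[< P a >]].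
  split.
    apply/idealr_closedE; split; last by rewrite inE; apply/asboolP.
    by apply/submod_pred/(submod_closedE (V := A^o)).
  move=> q /idealr_closedE[hq q1] Pq a; rewrite inE.
  rewrite -(Pmax (fun a => a \in q)); first by rewrite asboolb.
    by split=> //; apply/negP.
  by move=> x Px; apply: Pq; rewrite inE; apply/asboolP.
by move=> a /IP Pa; rewrite -(lm.2 _ mP) inE; apply/asboolP.
Qed.

Lemma unit_notin_max a : a \notin m -> exists b, b * a = 1.
Proof.
move=> am; apply: contrapT => h; move/negP: am; apply.
apply: (@proper_sub_max (fun z => exists y, z = y * a)); last by exists 1; rewrite mul1r.
  split; first by exists 0; rewrite mul0r.
  by move=> x _ _ [y ->] [y' ->]; exists (x * y + y'); rewrite mulrDl -mulrA.
by move=> [y e]; apply: h; exists y.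
Qed.

Lemma max_primep : primep (fun a => a \in m).
Proof.
split; [exact: ideal_max|exact/negP/max_not1|] => a b abm.
apply: contrapT => /not_orP[/negP /unit_notin_max[c ca] bm]; apply: bm.
by rewrite -[b]mul1r -ca -mulrA; apply: (idealM _ ideal_max).
Qed.

Lemma prime_sub_max P : primep P -> forall a, P a -> a \in m.
Proof. by move=> [hP P1 _]; apply: proper_sub_max. Qed.

Lemma unit_one_sub a : a \in m -> exists b, b * (1 - a) = 1.
Proof.
move=> am; apply: unit_notin_max; apply/negP => h; move/negP: max_not1; apply.
by rewrite -[1](subrK a); apply: (submodD ideal_max).
Qed.

Lemma max_gens : exists a : seq A, (forall x, x \in a -> x \in m) /\
  forall x, x \in m -> mulp a (fullp (T := A^o)) x.
Proof.
have [x hx] := nA (I := m : {pred A^o}) ideal_max.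
exists x; split.
  move=> y /(nthP 0)[j jx <-]; rewrite hx inE; apply/asboolP.
  exists (fun k => (k == j)%:R); rewrite (bigD1 (Ordinal jx)) //= eqxx [_ *: _]mulr1.
  rewrite big1 ?addr0 // => k kj; rewrite (_ : (k == j :> nat) = false) ?scaler0 //.
  by apply/negbTE; apply: contraNneq kj => kj; apply/eqP/val_inj.
move=> y; rewrite hx inE => /asboolP[c ->].
apply: submod_sum => [|j _]; first exact: submod_gen.
by apply: mem_mulp => //; exact: mem_nth.
Qed.

(** Generators of [U] modulo [W] are discarded one at a time: modulo [W] and the remaining
    generators, [x] equals [c *: x] with [c] in [m], and [1 - c] is a unit. *)
Lemma nakayama (V : lmodType A) (U W : V -> Prop) (a : seq A) (s : seq V) :
  submod U -> submod W -> subp W U -> (forall x, x \in a -> x \in m) ->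
  (forall x, x \in s -> U x) -> subp U (sump W (spanp s)) ->
  subp U (sump W (mulp a U)) -> subp U W.
Proof.
move=> hU hW WU am; elim: s => [|x s IH] sU Us Ua.
  by move=> v /Us[w [z [Ww -> ->]]]; rewrite addr0.
have sU' y : y \in s -> U y by move=> ys; apply: sU; rewrite inE ys orbT.
have Ux : U x by apply: sU; rewrite mem_head.
have hWs : submod (sump W (spanp s)) by apply: submod_add => //; exact: submod_span.
apply: IH => //.
have red v : mulp a U v -> exists c, c \in m /\ sump W (spanp s) (v - c *: x).
  elim: a am {Ua} v => [|b a IHa] am v /=.
    move=> ->; exists 0; split; first exact: (submod0 ideal_max).
    by rewrite scale0r subr0; apply: submod0.
  case=> u [w [Uu gw ->]].
  have [|c [cm hc]] := IHa _ w gw; first by move=> y ya; apply: am; rewrite inE ya orbT.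
  have [w1 [_ [Ww1 [d [s1 [ss1 ->]]] ->]]] := Us _ Uu.
  exists (b * d + c); split.
    apply: (submodD ideal_max) => //; rewrite mulrC; apply: (idealM _ ideal_max).
    by apply: am; rewrite mem_head.
  have -> : b *: (w1 + (d *: x + s1)) + w - (b * d + c) *: x
     = b *: (w1 + s1) + (w - c *: x).
    rewrite !scalerDr scalerDl scalerA addrCA -[_ + w]addrA opprD addrACA subrr add0r.
    by rewrite -addrA.
  by apply: hWs.2 => //; exists w1, s1.
suff hx : sump W (spanp s) x.
  move=> v /Us[w [_ [Ww [c [s1 [ss1 ->]]] ->]]].
  rewrite addrCA; apply: (hWs.2) => //; by exists w, s1.
have [w [z [Ww gz xE]]] := Ua _ Ux.
have [c [cm hc]] := red _ gz.
have [b bE] := unit_one_sub cm.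
rewrite -[x]scale1r -bE -scalerA scalerBl scale1r {1}xE -addrA.
apply: submodZ => //; apply: submodD => //; exact: sumpl (submod_span s) _ Ww.
Qed.

(** * Associated primes *)

Section Ass.
Variables (V : lmodType A).
Implicit Types (W : V -> Prop) (v : V).

Definition colon W v (a : A) : Prop := W (a *: v).

Lemma ideal_colon W v : submod W -> ideal (colon W v).
Proof.
move=> hW; split; first by rewrite /colon scale0r; apply: submod0.
by move=> a x y Wx Wy; rewrite /colon scalerDl -scalerA; apply: hW.2.
Qed.

(** A colon ideal maximal among those of elements of [U] outside [W] is prime, because
    [colon W (b *: v')] contains [colon W v'] and competes with it unless [b *: v'] lies in [W].
    Starting from [colon W v] keeps [I] inside. *)
Lemma ass_exists U W (I : A -> Prop) v : submod U -> submod W -> U v -> ~ W v ->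
  subp I (colon W v) ->
  exists v', [/\ U v', ~ W v', primep (colon W v') & subp I (colon W v')].
Proof.
move=> hU hW Uv nv Iv.
have [|||P [[v' [Uv' nv'] <-] vP Pmax]] := @noeth_max _ _ noeth_regular
  (fun P => exists2 v', U v' /\ ~ W v' & colon W v' = P) (colon W v).
- exact: ideal_colon.
- by exists v.
- by move=> P [v' _ <-]; apply: ideal_colon.
exists v'; split=> //; last by move=> a /Iv /vP.
split; [exact: ideal_colon|by rewrite /colon scale1r|] => a b Wab.
have [|nb] := pselect (colon W v' b); [by right|left].
rewrite -(Pmax (colon W (b *: v'))).
- by rewrite /colon scalerA.
- by exists (b *: v') => //; split=> //; apply: submodZ.
by move=> c Wc; rewrite /colon scalerA mulrC -scalerA; apply: submodZ.
Qed.

Definition line v (w : V) : Prop := exists c : A, w = c *: v.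

Lemma submod_line v : submod (line v).
Proof.
split; first by exists 0; rewrite scale0r.
by move=> a _ _ [c ->] [d ->]; exists (a * c + d); rewrite scalerDl scalerA.
Qed.

Lemma colon_scale W v a : submod W -> primep (colon W v) -> ~ W (a *: v) ->
  colon W (a *: v) = colon W v.
Proof.
move=> hW [_ _ hp] nav; apply: pred_ext => b; rewrite /colon scalerA; split.
  by move=> /hp[].
by rewrite mulrC -scalerA; apply: submodZ.
Qed.

(* Q = (W : v) either is the prime of the first step of a
   prime filtration or comes from its next stage. *)
Lemma finitely_many_ass : noeth V -> forall W, submod W ->
  exists L : seq (A -> Prop), (forall P, List.In P L -> primep P) /\
    forall v, ~ W v -> primep (colon W v) -> List.In (colon W v) L.
Proof.
move=> nV; apply: (noeth_ind nV) => W hW IH.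
have [Wt|/existsNP[v0 nv0]] := pselect (forall v, W v).
  by exists [::]; split=> // v /(_ (Wt v)).
have [//|v1 [_ nv1 pv1 _]] := @ass_exists (fullp (T := V)) W (colon W v0) v0 (submod_full V) hW Logic.I nv0.
have [||| L [Lp LW]] := IH (sump W (line v1)).
- by apply: submod_add => //; apply: submod_line.
- by apply: sumpl; apply: submod_line.
- move=> e; apply: nv1; rewrite -e; apply: sumpr => //; by exists 1; rewrite scale1r.
exists (colon W v1 :: L); split; first by move=> P /= [<-|/Lp].
move=> v nv pv /=.
(* If a multiple of [v] outside [W] falls into [W + A v1], it is congruent modulo [W] to some
   [a *: v1], and the two colon primes agree. Otherwise enlarging [W] by [line v1] leaves
   [colon W v] unchanged and the induction hypothesis applies. *)
have [|h] := pselect (exists2 c, sump W (line v1) (c *: v) & ~ W (c *: v)).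
  case=> c [w [_ [Ww [a ->] e]]] ncv; left.
  have nav : ~ W (a *: v1).
    by move=> h; apply: ncv; rewrite e; apply: submodD.
  rewrite -(colon_scale hW pv1 nav) -(colon_scale hW pv ncv) e.
  apply: pred_ext => b; rewrite /colon [in X in _ <-> X]scalerDr; split.
    by move=> h; apply: submodD => //; apply: submodZ.
  by move=> h; rewrite -[b *: (a *: v1)](addKr (b *: w)) addrC; apply: submodB => //; apply: submodZ.
right; have e : colon (sump W (line v1)) v = colon W v.
  apply: pred_ext => b; split; last by apply: sumpl; apply: submod_line.
  by move=> hb; apply: contrapT => nb; apply: h; exists b.
rewrite -e; apply: LW; last by rewrite e.
by move=> hv; apply: h; exists 1; rewrite scale1r.
Qed.

End Ass.

(** The primes in [L] may be comparable. The induction is on the length of [L], because when a prime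
    [Q] of the tail lies inside the head [P] the recursive call is made on the list with [Q]
    deleted: avoiding [P] then avoids [Q]. *)
Lemma prime_avoidance (I : A -> Prop) (L : seq (A -> Prop)) : ideal I ->
  (forall P, List.In P L -> primep P /\ exists2 a, I a & ~ P a) ->
  exists2 a, I a & forall P, List.In P L -> ~ P a.
Proof.
move=> hI; have [n] := ubnP (size L); elim: n L => // n IH [|P L] sL hL.
  by exists 0 => //; apply: submod0 hI.
have [a Ia aL] : exists2 a, I a & forall Q, List.In Q L -> ~ Q a.
  by apply: IH => // Q QL; apply: hL; right.
have [Pa|nPa] := pselect (P a); last by exists a => // Q /= [<-|/aL].
have [pP [c0 Ic0 Pc0]] := hL P (or_introl erefl); have [hP P1 Pm] := pP.
(* b lies in I and in every prime of L, but not in P, unless a prime of L lies in P *)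
have [[Q QL QP]|h] := pselect (exists2 Q, List.In Q L & subp Q P).
  have [L' [sL' L'L LL']] : exists L' : seq (A -> Prop), [/\ (size L' < size L)%N,
      (forall R, List.In R L' -> List.In R L) & forall R, List.In R L -> R = Q \/ List.In R L'].
    elim: L {sL hL aL IH} QL => //= R L IHL [->|QL].
      exists L; split=> //= S; first by right.
      by case=> [->|]; [left|right].
    have [L' [s1 h1 h2]] := IHL QL; exists (R :: L'); split=> [|S|S] //=.
      by case=> [|/h1]; [left|right].
    by case=> [->|/h2[]]; [right; left|left|right; right].
  have [||b Ib bL] := IH (P :: L').
  - exact: leq_ltn_trans (_ : size (P :: L') <= size L)%N _.
  - by move=> R /= [<-|/L'L RL]; apply: hL; [left|right].
  exists b => // R /= [<-|/LL' [->|RL']].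
  - by apply: bL; left.
  - by move=> /QP; apply: bL; left.
  - by apply: bL; right.
have [b [Ib bL Pb]] : exists b, [/\ I b, forall Q, List.In Q L -> Q b & ~ P b].
  have : forall Q, List.In Q L -> ideal Q /\ exists2 c, Q c & ~ P c.
    move=> Q QL; have [[hQ _ _] _] := hL Q (or_intror QL); split=> //.
    apply: contrapT => nc; apply: h; exists Q => // c Qc.
    by apply: contrapT => nPc; apply: nc; exists c.
  elim: L {sL hL aL h IH} => [|Q L IHL] hQ.
    by exists c0.
  have [|b [Ib bL Pb]] := IHL; first by move=> R RL; apply: hQ; right.
  have [iQ [c Qc Pc]] := hQ Q (or_introl erefl).
  exists (c * b); split; first exact: idealM.
    move=> R /= [<-|RL]; first by rewrite mulrC; apply: idealM.
    by apply: idealM; [apply: (hQ R (or_intror RL)).1|apply: bL].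
  by move=> /Pm[].
(* [a] lies in [P] and in no prime of [L], while [b] lies in every prime of [L] but not in [P], so
   each prime contains exactly one of the two summands. *)
exists (a + b); first exact: submodD hI Ia Ib.
move=> Q /= [<-|QL] Qab.
  by apply: Pb; rewrite -[b](addKr a) addrC; apply: (submodB hP Qab Pa).
apply: (aL Q QL); rewrite -[a](addrK b).
by have [[hQ _ _] _] := hL Q (or_intror QL); apply: (submodB hQ Qab (bL _ QL)).
Qed.

(** [z] is chosen in [m] outside all associated primes of [V / W] other than [m]. If it is a zero
    divisor modulo [W], some associated prime contains it, and that prime must be [m]. *)
Lemma regular_or_socle (V : lmodType A) (W : V -> Prop) : noeth V -> submod W ->
  (exists2 z, z \in m & forall v, W (z *: v) -> W v) \/
  (exists2 v, ~ W v & forall a, a \in m -> W (a *: v)).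
Proof.
move=> nV hW; have [L [Lp LW]] := finitely_many_ass nV hW.
pose L' := seq.filter (fun P : A -> Prop => `[< P <> (fun a => a \in m : Prop) >]) L.
have inL' P : List.In P L' <-> List.In P L /\ P <> (fun a => a \in m : Prop).
  rewrite /L'; elim: L {Lp LW L'} => [|Q L IH] /=; first by split=> // -[].
  case: asboolP => hQ /=; split.
  - by case=> [<-|/IH[]]; split=> //; [left|right].
  - by case=> -[<-|h] ne; [left|right; apply/IH].
  - by move=> /IH[h ne]; split=> //; right.
  - by case=> -[e|h] ne; [case: hQ; rewrite e|apply/IH].
have [P /inL'[/Lp pP ne]|z zm zL] := @prime_avoidance (fun a => a \in m) L' ideal_max.
  split=> //; apply: contrapT => h; apply: ne; apply: pred_ext => a; split.
    exact: prime_sub_max.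
  by move=> am; apply: contrapT => nPa; apply: h; exists a.
have [|h] := pselect (forall v, W (z *: v) -> W v); first by left; exists z.
right; move/existsNP: h => [v /not_implyP[Wzv nv]].
have [|v' [_ nv' pv' hv']] := @ass_exists V (fullp (T := V)) W (fun a => a = z) v (submod_full V) hW Logic.I nv.
  by move=> a ->.
exists v' => // a am; apply: contrapT => nav.
have := LW v' nv' pv' => inL.
have /zL : List.In (colon W v') L'.
  by apply/inL'; split=> // e; apply: nav; have := congr1 (fun P => P a) e; rewrite /colon => ->.
by apply; apply: hv'.
Qed.

End Local.

(** * Length *)

Section Length.
Variable A : comNzRingType.

(* k strict inclusions ending at U, of submodules containing W *)
Fixpoint schain (V : lmodType A) (k : nat) (W U : V -> Prop) : Prop :=
  if k is k'.+1 then
    exists C, [/\ submod C, schain k' W C, subp C U & exists2 v, U v & ~ C v]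
  else subp W U.

(** The length of [U / W] without forming the quotient. Even a chain of length 0 requires [W] inside
    [U], so [finlen W U] includes this inclusion. *)
Definition rlength (V : lmodType A) (W U : V -> Prop) (l : nat) : Prop :=
  is_max (fun k => schain k W U) l.

Definition finlen (V : lmodType A) (W U : V -> Prop) : Prop := exists l, rlength W U l.

(** The value 0 stands in for an infinite length, so the rules for [lam] are stated under
    [finlen]. *)
Definition lam (V : lmodType A) (W U : V -> Prop) : nat :=
  if pselect (finlen W U) is left h then sval (cid h) else 0%N.

Section Basics.
Variable V : lmodType A.
Implicit Types W U C : V -> Prop.

Lemma lamP W U : finlen W U -> rlength W U (lam W U).
Proof. by rewrite /lam; case: pselect => // h _; case: cid. Qed.

Lemma len_uniq W U k l : rlength W U k -> rlength W U l -> k = l.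
Proof. by move=> [h1 h2] [h3 h4]; apply/eqP; rewrite eqn_leq h2 // h4. Qed.

Lemma lamE W U l : rlength W U l -> lam W U = l.
Proof. by move=> h; apply: (len_uniq (lamP _) h); exists l. Qed.

Lemma ch_top k W U U' : subp U U' -> schain k W U -> schain k W U'.
Proof.
case: k => [|k] h /=; first by move=> h' v /h'; apply: h.
by move=> [C [hC cC CU [v Uv Cv]]]; exists C; split=> //; [move=> x /CU /h|exists v => //; apply: h].
Qed.

Lemma ch_bot k W W' U : subp W' W -> schain k W U -> schain k W' U.
Proof.
move=> h; elim: k U => [|k IH] U /=; first by move=> h' v /h; apply: h'.
by move=> [C [hC cC CU ne]]; exists C; split=> //; apply: IH.
Qed.

Lemma ch_sub k W U : schain k W U -> subp W U.
Proof.
elim: k U => [|k IH] U //= [C [hC /IH cC CU _]] v /cC; exact: CU.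
Qed.

Lemma ch_cat a b W C U : submod C -> schain a W C -> schain b C U -> schain (a + b) W U.
Proof.
move=> hC aC; elim: b U => [|b IH] U /=; first by rewrite addn0 => h; apply: ch_top aC.
by rewrite addnS => -[D [hD cD DU ne]]; exists D; split=> //; apply: IH.
Qed.

(** By the modular law a strict inclusion remains strict after intersecting with [C] or after adding
    [C]. This is the upper bound in the additivity of length. *)
Lemma ch_split k W U C : submod W -> submod U -> submod C -> subp W C -> schain k W U ->
  exists a b, [/\ (k <= a + b)%N, schain a W (capp U C) & schain b C (sump U C)].
Proof.
move=> hW hU hC WC; elim: k U hU => [|k IH] U hU /=.
  move=> WU; exists 0%N, 0%N; split=> //=; first by move=> v Wv; split; [apply: WU|apply: WC].
  exact: sumpr.
move=> [D [hD cD DU [v Uv nDv]]].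
have [a [b [kab cha chb]]] := IH D hD cD.
have [[w [Uw Cw] nDw]|h] := pselect (exists2 w, capp U C w & ~ D w).
  exists a.+1, b; split=> //.
    exists (capp D C); split=> //; first exact: submod_cap.
      by move=> x [Dx Cx]; split=> //; apply: DU.
    by exists w => // -[].
  by apply: ch_top chb; apply: sump_mono.
exists a, b.+1; split; first by rewrite addnS.
  by apply: ch_top cha => x [Dx Cx]; split=> //; apply: DU.
exists (sump D C); split=> //; first exact: submod_add.
  exact: sump_mono.
exists v; first exact: sumpl.
case=> p [q [Dp Cq e]]; apply: nDv; rewrite e; apply: submodD => //.
apply: contrapT => nDq; apply: h; exists q => //; split=> //.
by rewrite -[q](addKr p) addrC -e; apply: submodB => //; apply: DU.
Qed.

Lemma is_max_exists (P : nat -> Prop) k l : P k -> (forall j, P j -> (j <= l)%N) ->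
  exists2 n, is_max P n & (n <= l)%N.
Proof.
move=> Pk hl.
have ex : exists k, `[< P k >] by exists k; apply/asboolP.
have ub i : `[< P i >] -> (i <= l)%N by move/asboolP/hl.
case: (ex_maxnP ex ub) => n /asboolP Pn hn; exists n; last exact: hl.
by split=> // j /asboolP; apply: hn.
Qed.

Lemma len_sub W U W' U' l : subp W W' -> subp W' U' -> subp U' U ->
  rlength W U l -> exists2 l', rlength W' U' l' & (l' <= l)%N.
Proof.
move=> h1 h2 h3 [_ hl]; apply: (@is_max_exists _ 0%N) => // j hj.
by apply: hl; apply: ch_top h3 (ch_bot h1 hj).
Qed.

Lemma fin_sub W U W' U' : subp W W' -> subp W' U' -> subp U' U -> finlen W U -> finlen W' U'.
Proof. by move=> h1 h2 h3 [l /(len_sub h1 h2 h3)[l' h _]]; exists l'. Qed.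

Lemma len_add W C U a b : submod W -> submod C -> submod U -> subp W C -> subp C U ->
  rlength W C a -> rlength C U b -> rlength W U (a + b).
Proof.
move=> hW hC hU WC CU [ca ha] [cb hb]; split; first exact: ch_cat ca cb.
move=> k /(ch_split hW hU hC WC)[a' [b' [kab cha chb]]].
apply: leq_trans kab _; apply: leq_add.
  by apply: ha; apply: ch_top cha => v [].
by apply: hb; apply: ch_top chb; apply: sump_sub.
Qed.

Lemma fin_add W C U : submod W -> submod C -> submod U -> subp W C -> subp C U ->
  finlen W C -> finlen C U -> finlen W U.
Proof. by move=> hW hC hU WC CU [a ha] [b hb]; exists (a + b)%N; apply: len_add hb. Qed.

Lemma lam_add W C U : submod W -> submod C -> submod U -> subp W C -> subp C U ->
  finlen W U -> lam W U = (lam W C + lam C U)%N.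
Proof.
move=> hW hC hU WC CU f; apply: lamE; apply: (@len_add _ C) => //; apply: lamP.
  by apply: fin_sub f.
by apply: fin_sub f.
Qed.

Lemma len_refl W : rlength W W 0.
Proof.
split=> [v //|[|k] //= [C [hC cC CW [v Wv nCv]]]].
by case: nCv; apply: ch_sub cC _ Wv.
Qed.

Lemma lam_gt0 W U : finlen W U -> submod W -> subp W U -> (exists2 v, U v & ~ W v) ->
  (0 < lam W U)%N.
Proof. by move=> f hW WU ne; apply: (lamP f).2 => /=; exists W. Qed.

Lemma lam_mono W U W' U' : subp W W' -> subp W' U' -> subp U' U ->
  finlen W U -> (lam W' U' <= lam W U)%N.
Proof.
move=> h1 h2 h3 f; have [l' h le] := len_sub h1 h2 h3 (lamP f).
by rewrite (lamE h).
Qed.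

End Basics.

Section Correspondence.
Variables (V V' : lmodType A) (f : {linear V -> V'}) (U : V -> Prop) (W' : V' -> Prop).
Hypotheses (hU : submod U) (hW' : submod W').

Definition preimp (v : V) : Prop := U v /\ W' (f v).

Lemma submod_preimU : submod preimp.
Proof. by apply: submod_cap => //; apply: submod_preim. Qed.

Lemma ch_img k : schain k preimp U -> schain k W' (sump (imgp f U) W').
Proof.
suff h C : submod C -> subp C U -> schain k preimp C -> schain k W' (sump (imgp f C) W').
  exact: h.
elim: k C => [|k IH] C hC CU /=.
  by move=> _; apply: sumpr; apply: submod_img.
move=> [D [hD cD DC [v Cv nDv]]]; exists (sump (imgp f D) W'); split.
- by apply: submod_add => //; apply: submod_img.
- by apply: IH => // x /DC /CU.
- by apply: sump_mono => // x [y Dy <-]; exists y => //; apply: DC.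
exists (f v); first by apply: sumpl => //; exists v.
case=> _ [w [[d Dd <-] Ww e]]; apply: nDv; rewrite -[v](subrK d); apply: submodD => //.
apply: (ch_sub cD); split; first by apply: submodB => //; apply: CU => //; apply: DC.
by rewrite linearB /= e [f d + w]addrC addrK.
Qed.

Lemma ch_preim k : schain k W' (sump (imgp f U) W') -> schain k preimp U.
Proof.
suff h C : submod C -> subp C (sump (imgp f U) W') -> schain k W' C ->
    schain k preimp (fun v => U v /\ C (f v)).
  have hS : submod (sump (imgp f U) W') by apply: submod_add => //; apply: submod_img.
  by move=> /(h _ hS (fun v h => h)) /ch_top; apply => v [].
elim: k C => [|k IH] C hC CU /=.
  by move=> WC v [Uv Wv]; split=> //; apply: WC.
move=> [D [hD cD DC [v Cv nDv]]]; exists (fun v => U v /\ D (f v)); split.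
- by apply: submod_cap => //; apply: submod_preim.
- by apply: IH => // x /DC /CU.
- by move=> x [Ux Dx]; split=> //; apply: DC.
have [_ [w [[u Uu <-] Ww e]]] := CU _ Cv.
have Dw : D w by apply: (ch_sub cD).
exists u; last by case=> _ Du; apply: nDv; rewrite e; apply: submodD.
by split=> //; rewrite -[f u](addrK w) -e; apply: submodB => //; apply: DC.
Qed.

(** The isomorphism of [U / (U cap f^-1 W')] with [(f U + W') / W']; lengths in different modules
    are compared through it. *)
Lemma len_corr l : rlength W' (sump (imgp f U) W') l <-> rlength preimp U l.
Proof.
split=> -[c h]; split.
- exact: ch_preim.
- by move=> k /ch_img/h.
- exact: ch_img.
- by move=> k /ch_preim/h.
Qed.

Lemma fin_corr : finlen W' (sump (imgp f U) W') <-> finlen preimp U.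
Proof. by split=> -[l /len_corr h]; exists l. Qed.

Lemma lam_corr : finlen preimp U -> lam W' (sump (imgp f U) W') = lam preimp U.
Proof. by move=> h; apply: lamE; apply/len_corr/lamP. Qed.

End Correspondence.

Lemma has_lengthE (V : lmodType A) l : has_length V l <-> rlength (nullp (V := V)) (fullp (T := V)) l.
Proof.
suff h k : (exists W : nat -> {pred V}, (forall j, submod_closed (W j)) /\ strict_chain W k)
    <-> schain k (nullp (V := V)) (fullp (T := V)).
  by split=> -[/h c m]; split=> // k /h; apply: m.
split=> [[W [hW sW]]|].
  have c j : (j <= k)%N -> schain j (nullp (V := V)) (fun v => v \in W j).
    elim: j => [|j IH] jk /=; first by move=> v ->; apply: (hW 0%N).1.
    have [s [x x1 x2]] := sW j jk; exists (fun v => v \in W j); split.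
    - exact: submod_pred.
    - by apply: IH; apply: ltnW.
    - exact: s.
    - by exists x => //; apply/negP.
  by apply: ch_top (c k (leqnn k)).
have : submod (fullp (T := V)) by [].
move: (fullp (T := V)) => U hU c.
suff [W [h1 h2 h3]] : exists W : nat -> {pred V}, [/\ forall j, submod_closed (W j),
    strict_chain W k & forall j, (k <= j)%N -> W j = [pred v | `[< U v >]]] by exists W.
elim: k U hU c => [|k IH] U hU /=.
  move=> _; exists (fun=> [pred v | `[< U v >]]); split=> // j.
  exact/submod_closedE.
move=> [C [hC /(IH _ hC)[W [h1 h2 h3]] CU [x Ux nCx]]].
exists (fun j => if (j <= k)%N then W j else [pred v | `[< U v >]]); split.
- by move=> j; case: ifP => // _; apply/submod_closedE.
- move=> j; rewrite ltnS leq_eqVlt => /orP[/eqP ->|jk].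
    rewrite eqxx ltnn h3 //; split; first by move=> y; rewrite !inE => /asboolP/CU/asboolP.
    by exists x; rewrite !inE; apply/asboolP.
  by rewrite jk orbT; apply: h2.
- by move=> j kj; rewrite leqNgt kj.
Qed.

End Length.

(** * Artin-Rees *)

Section Graded.
Variables (A : comNzRingType) (G : lmodType A).
Hypothesis nG : noeth G.
Implicit Types (U W Z : nat -> G -> Prop) (a : seq A).

(** [U] is read as the graded submodule of [G[T]] with component [U n] in degree [n], over a
    polynomial ring whose variables act as the elements of [a] times [T]. *)
Definition stable a U : Prop := forall x, x \in a -> forall n v, U n v -> U n.+1 (x *: v).

(** [U / W] is generated in bounded degrees. As every component is finitely generated over [A] when
    [G] is Noetherian, this is finite generation over the polynomial ring, and [evgen_sub] is a form
    of Hilbert's basis theorem. *)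
Definition evgen a U W : Prop := exists n0, forall n, (n0 <= n)%N ->
  subp (U n.+1) (sump (mulp a (U n)) (W n.+1)).

(* The graded submodule W + x U(-1). *)
Definition shift (x : A) U W n : G -> Prop :=
  if n is k.+1 then sump (W k.+1) (fun v => exists2 u, U k u & v = x *: u) else W 0%N.

Lemma submod_scale (x : A) (U : G -> Prop) : submod U ->
  submod (fun v => exists2 u, U u & v = x *: u).
Proof.
move=> hU; split; first by exists 0; rewrite ?scaler0 //; apply: submod0.
move=> b _ _ [u Uu ->] [u' Uu' ->]; exists (b *: u + u'); first exact: hU.2.
by rewrite scalerDr !scalerA mulrC.
Qed.

Section Shift.
Variables (x : A) (a : seq A) (U W : nat -> G -> Prop).
Hypotheses (hU : forall n, submod (U n)) (hW : forall n, submod (W n)).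
Hypotheses (WU : forall n, subp (W n) (U n)).
Hypotheses (sU : stable (x :: a) U) (sW : stable (x :: a) W).
Hypothesis (gU : evgen (x :: a) U W).

Lemma submod_shift n : submod (shift x U W n).
Proof. by case: n => [|n] //=; apply: submod_add => //; apply: submod_scale. Qed.

Lemma sub_shift n : subp (W n) (shift x U W n).
Proof. by case: n => [|n] //=; apply: sumpl; apply: submod_scale. Qed.

Lemma shift_sub n : subp (shift x U W n) (U n).
Proof.
case: n => [|n] /=; first exact: WU.
apply: sump_sub => // _ [u Uu ->]; apply: sU => //; exact: mem_head.
Qed.

Lemma stable_shift : stable a (shift x U W).
Proof.
move=> y ya [|n] v /=.
  by move=> Wv; apply: sumpl; [apply: submod_scale|apply: sW; rewrite ?inE ?ya ?orbT].
case=> p [_ [Wp [u Uu ->] ->]]; exists (y *: p), (x *: (y *: u)); split.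
- by apply: sW; rewrite ?inE ?ya ?orbT.
- by exists (y *: u) => //; apply: sU; rewrite ?inE ?ya ?orbT.
- by rewrite scalerDr !scalerA (mulrC x).
Qed.

Lemma evgen_shift : evgen a U (shift x U W).
Proof.
have [n0 h] := gU; exists n0 => n /h s v /s[_ [w [[u [g [Uu gg ->]]] Ww ->]]].
exists g, (w + x *: u); split=> //; last by rewrite -addrA addrC -addrA.
by exists w, (x *: u); split=> //; exists u.
Qed.

End Shift.

Lemma uniform_bound (P : nat -> nat -> Prop) n0 :
  (forall n k k', (k <= k')%N -> P n k -> P n k') ->
  (forall n, exists k, P n k) -> exists K, forall n, (n <= n0)%N -> P n K.
Proof.
move=> mono ex; elim: n0 => [|n0 [K hK]].
  by have [k hk] := ex 0%N; exists k => n; rewrite leqn0 => /eqP ->.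
have [k hk] := ex n0.+1; exists (maxn K k) => n; rewrite leq_eqVlt ltnS => /orP[/eqP ->|/hK].
  by apply: mono hk; rewrite leq_maxr.
by apply: mono; rewrite leq_maxl.
Qed.

(* Induction on a, comparing Z modulo x with the submodules (Z : x^k). *)
Theorem evgen_sub a : forall U W Z,
  (forall n, submod (U n)) -> (forall n, submod (W n)) -> (forall n, submod (Z n)) ->
  (forall n, subp (W n) (Z n)) -> (forall n, subp (Z n) (U n)) ->
  stable a U -> stable a W -> stable a Z -> evgen a U W -> evgen a Z W.
Proof.
elim: a => [|x a IH] U W Z hU hW hZ WZ ZU sU sW sZ gU.
  by have [n0 h] := gU; exists n0 => n /h s v /ZU /s.
have WU n : subp (W n) (U n) by move=> v /WZ /ZU.
pose W1 := shift x U W.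
have hW1 n : submod (W1 n) by exact: submod_shift.
have W1U n : subp (W1 n) (U n) by apply: (shift_sub (a := a)).
have sW1 : stable a W1 by exact: stable_shift.
have gU1 : evgen a U W1 by exact: evgen_shift.
have xh : x \in x :: a by exact: mem_head.
have ah y : y \in a -> y \in x :: a by move=> ya; rewrite inE ya orbT.
have sU' : stable a U by move=> y ya; apply: sU; apply: ah.
pose Zk k n v := U n v /\ Z (k + n)%N (x ^+ k *: v).
have hZk k n : submod (Zk k n).
  split; first by split; rewrite ?scaler0; apply: submod0.
  move=> b u v [Uu Zu] [Uv Zv]; split; first exact: (hU _).2.
  by rewrite scalerDr scalerA mulrC -scalerA; apply: (hZ _).2.
have Zk0 : Zk 0%N = Z.
  apply/funext => n; apply: pred_ext => v; rewrite /Zk expr0 scale1r add0n.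
  by split=> [[]//|Zv]; split=> //; apply: ZU.
have ZkS k n : subp (Zk k n) (Zk k.+1 n).
  by move=> v [Uv Zv]; split=> //; rewrite exprS -scalerA addSn; apply: sZ.
have Zkm k k' n : (k <= k')%N -> subp (Zk k n) (Zk k' n).
  elim: k' => [|k' IHk]; first by rewrite leqn0 => /eqP ->.
  by rewrite leq_eqVlt => /orP[/eqP -> //|/IHk h] v /h /ZkS.
have sZk k : stable (x :: a) (Zk k).
  move=> y ya n v [Uv Zv]; split; first exact: sU.
  by rewrite scalerA mulrC -scalerA addnS; apply: sZ.
have WZk k n : subp (W n) (Zk k n).
  by move=> v Wv; apply: (@Zkm 0%N) => //; rewrite Zk0; apply: WZ.
have ZkX k n u : U n u -> Zk k n.+1 (x *: u) <-> Zk k.+1 n u.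
  move=> Uu; rewrite /Zk exprSr -scalerA addnS addSn; split=> -[] //.
  by move=> _ h; split=> //; apply: sU.
(* [Y k] is [Zk k] modulo [W + x U]. Modulo [W + x U] the module [U] is generated using the shorter
   list [a], so the induction hypothesis applies to [Y k]. *)
pose Y k n := sump (Zk k n) (W1 n).
have hY k n : submod (Y k n) by exact: submod_add.
have Ym k k' n : (k <= k')%N -> subp (Y k n) (Y k' n).
  by move=> kk; apply: sump_mono => //; apply: Zkm.
have YU k n : subp (Y k n) (U n).
  by apply: sump_sub => // v [].
have sY k : stable a (Y k).
  move=> y ya n v [p [q [Zp Wq ->]]]; exists (y *: p), (y *: q); rewrite scalerDr.
  by split=> //; [apply: sZk => //; apply: ah|apply: sW1].
have gY k : evgen a (Y k) W1.
  apply: (IH U W1) => //.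
  by move=> n; apply: sumpr.
(* The union [Yi] of the [Y k] is again generated in bounded degrees. Up to degree [n0] finitely
   many ascending chains in [G] stop, and generation carries the equality to all higher degrees, so
   one [K] serves every degree. *)
have [K hK] : exists K, forall k n, (K <= k)%N -> Y k n = Y K n.
  pose Yi n v := exists k, Y k n v.
  have hYi n : submod (Yi n).
    split; first by exists 0%N; apply: submod0.
    move=> b u v [i Yu] [j Yv]; exists (maxn i j); apply: (hY _ _).2.
      by apply: Ym Yu; rewrite leq_maxl.
    by apply: Ym Yv; rewrite leq_maxr.
  have [n0 gn0] : evgen a Yi W1.
    apply: (IH U W1) => //.
    - by move=> n v Wv; exists 0%N; apply: sumpr.
    - by move=> n v [k /YU].
    - by move=> y ya n v [k Yv]; exists k; apply: sY.
  have [n k k' kk h v /h /(Ym _ _ _ kk) //|n|K hK] :=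
    @uniform_bound (fun n k => subp (Yi n) (Y k n)) n0.
    have [||k hk] := noeth_chain nG (C := fun k => Y k n) => //.
      by move=> k; apply: Ym.
    exists k => v [k' Yv]; rewrite -(hk (maxn k k')) ?leq_maxl //.
    by apply: Ym Yv; rewrite leq_maxr.
  have YiK n : subp (Yi n) (Y K n).
    elim: n => [|n IHn]; first exact: hK.
    have [/hK //|nn] := leqP n.+1 n0.
    move=> v /(gn0 n nn); apply: sump_sub => //; last exact: sumpr.
    apply: mulp_sub => // y u ya /IHn Yu; exact: sY.
  exists K => k n Kk; apply: pred_ext => v; split; last exact: Ym.
  by move=> Yv; apply: YiK; exists k.
(* The equality lifts from [Y] to [Zk] by induction on the degree: an element of [Zk k] differs from
   one of [Zk K] by [w + x *: u], where [u] lies in [Zk k.+1] one degree lower. *)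
have ZK k n : (K <= k)%N -> Zk k n = Zk K n.
  move=> Kk; apply: pred_ext => v; split; last exact: Zkm.
  elim: n k Kk v => [|n IHn] k Kk v Zv.
    have : Y K 0%N v by rewrite -(hK k) //; apply: sumpl.
    by case=> p [q [Zp /= /WZk Wq ->]]; apply: submodD.
  have : Y K n.+1 v by rewrite -(hK k) //; apply: sumpl.
  case=> p [_ [Zp [w [_ [Ww [u Uu ->] ->]]] e]].
  rewrite e; apply: submodD => //; apply: submodD => //; first exact: WZk.
  apply/ZkX => //; apply: ZkS; apply: (IHn k.+1); first exact: leqW.
  apply/ZkX => //.
  have -> : x *: u = v - p - w by rewrite e [p + _]addrC addrK [w + _]addrC addrK.
  by apply: submodB => //; [apply: submodB => //; apply: Zkm Zp|apply: WZk].
(* By [gY], elements of [Zk k] in high degree are generated up to a term [x *: u] with [u] in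
   [Zk k.+1]. Such terms are generated if [Zk k.+1] is, and for [K <= k] trivially, since then [u]
   already lies in [Zk k]. Descending from [K] to 0 reaches [Z]. *)
have step k : evgen (x :: a) (Zk k.+1) W \/ (K <= k)%N -> evgen (x :: a) (Zk k) W.
  have [n1 h1] := gY k; move=> hk.
  suff [n2 h2] : exists n2, forall n, (n2 <= n)%N -> forall u, U n u -> Zk k n.+1 (x *: u) ->
      sump (mulp (x :: a) (Zk k n)) (W n.+1) (x *: u).
    exists (maxn n1 n2) => n; rewrite geq_max => /andP[n1n n2n] v Zv.
    have : Y k n.+1 v by apply: sumpl.
    move=> /(h1 n n1n)[g [_ [gg [w [_ [Ww [u Uu ->] ->]]] e]]].
    move: gg; rewrite mulp_add // => -[g1 [g2 [gg1 gg2 eg]]].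
    have W1g2 : W1 n.+1 g2 by move: gg2; apply: mulp_sub => // y z ya; apply: sW1.
    have [w2 [_ [Ww2 [u2 Uu2 ->] e2]]] := W1g2.
    have Zg1 : Zk k n.+1 g1.
      by move: gg1; apply: mulp_sub => // y z ya; apply: sZk; apply: ah.
    have ev : v = g1 + (w2 + w) + x *: (u2 + u).
      by rewrite e eg e2 scalerDr !addrA; congr (_ + _); rewrite -!addrA; congr (_ + (_ + _)); rewrite addrC.
    rewrite ev; apply: submodD.
    - by apply: submod_add => //; apply: submod_gen.
    - exists g1, (w2 + w); split=> //; last exact: submodD.
      by exists 0, g1; rewrite scaler0 add0r; split=> //; apply: submod0.
    - apply: h2 => //; first exact: submodD.
      rewrite -[_ *: _](addKr (g1 + (w2 + w))) -ev addrC.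
      by apply: submodB => //; apply: submodD => //; apply: WZk; apply: submodD.
  case: hk => [[n2 h2]|Kk].
    exists n2.+1 => -[//|n] n2n u Uu /ZkX-/(_ Uu) Zu.
    have [g [w [gg Ww ->]]] := h2 n n2n _ Zu.
    rewrite scalerDr; exists (x *: g), (x *: w); split=> //; last exact: sW.
    have -> : x *: g = (x \*: idfun) g by [].
    move: gg; elim: (x :: a) g => [|y b IHb] g /=; first by move=> ->; rewrite scaler0.
    case=> u' [g' [Zu' /IHb gg' ->]]; exists (x *: u'), (x *: g'); split=> //.
      by apply/ZkX => //; case: Zu'.
    by rewrite /= scalerDr !scalerA mulrC.
  exists 0%N => n _ u Uu /ZkX-/(_ Uu) Zu.
  apply: sumpl => //; apply: mem_mulp => //.
  by rewrite ZK // -(ZK k.+1) // leqW.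
suff : forall j, evgen (x :: a) (Zk (K - j)%N) W.
  by move=> /(_ K); rewrite subnn Zk0.
elim=> [|j IHj]; first by apply: step; right; rewrite subn0.
have [jK|Kj] := ltnP j K; first by apply: step; left; rewrite subnSK.
by have -> : (K - j.+1 = K - j)%N by lia.
Qed.

End Graded.

(** * Hilbert polynomials *)

Section EventuallyPolynomial.

Definition fdiff (R : {poly rat}) : {poly rat} := R \Po ('X + 1%:P) - R.

Lemma fdiff_horner R x : (fdiff R).[x] = R.[x + 1] - R.[x].
Proof. by rewrite /fdiff hornerD hornerN horner_comp !hornerE. Qed.

Lemma fdiffD R S : fdiff (R + S) = fdiff R + fdiff S.
Proof. by rewrite /fdiff comp_polyD opprD addrACA. Qed.

Lemma fdiffZ c R : fdiff (c *: R) = c *: fdiff R.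
Proof. by rewrite /fdiff comp_polyZ scalerBr. Qed.

Lemma fdiffXn n : exists2 L : {poly rat}, (size L <= n)%N &
  fdiff 'X^(n.+1) = (n.+1%:R : rat) *: 'X^n + L.
Proof.
exists (\poly_(i < n) ('C(n.+1, i))%:R); first exact: size_poly.
rewrite /fdiff comp_Xn_poly exprD1n !big_ord_recr /= binn mulr1n addrK.
rewrite binSn scaler_nat addrC; congr (_ + _).
by rewrite poly_def; apply: eq_bigr => i _; rewrite scaler_nat.
Qed.

(** The leading term of [Q] is cancelled by [fdiff] of a multiple of the next monomial; the
    coefficient [c] divides by [n.+1], the leading coefficient of [fdiff 'X^(n.+1)]. *)
Lemma fdiff_onto (Q : {poly rat}) : exists2 R : {poly rat}, (size R <= (size Q).+1)%N & fdiff R = Q.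
Proof.
suff h m : (size Q <= m)%N -> exists2 R : {poly rat}, (size R <= m.+1)%N & fdiff R = Q by apply: h.
elim: m Q => [|n IH] Q sQ.
  exists 0; first by rewrite size_poly0.
  move: sQ; rewrite leqn0 size_poly_eq0 => /eqP ->.
  by rewrite /fdiff comp_poly0 subr0.
have [L sL eL] := fdiffXn n.
pose c := Q`_n / n.+1%:R.
have [|R sR eR] := IH (Q - fdiff (c *: 'X^(n.+1))).
  apply/leq_sizeP => j; rewrite leq_eqVlt => /orP[/eqP <-|nj].
    rewrite fdiffZ eL !(coefN, coefZ, coefD) coefXn eqxx (leq_sizeP _ _ sL) // addr0.
    by rewrite mulr1 /c divfK ?subrr // pnatr_eq0.
  rewrite fdiffZ eL !(coefN, coefZ, coefD) coefXn gtn_eqF // (leq_sizeP _ _ sL) 1?ltnW //.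
  by rewrite (leq_sizeP _ _ sQ) // mulr0 addr0 mulr0 oppr0 addr0.
exists (R + c *: 'X^(n.+1)); last by rewrite fdiffD eR subrK.
apply: leq_trans (size_polyD _ _) _; rewrite geq_max (leq_trans sR) //=.
by apply: leq_trans (size_scale_leq _ _) _; rewrite size_polyXn.
Qed.

Lemma size_fdiff R : R != 0 -> (size (fdiff R) < size R)%N.
Proof.
move=> R0; have sX : size ('X + 1%:P : {poly rat}) = 2%N by rewrite size_XaddC.
have sR : (size R > 0)%N by rewrite size_poly_gt0.
rewrite -(prednK sR) ltnS; apply/leq_sizeP => j; rewrite leq_eqVlt => /orP[/eqP <-|].
  rewrite coefB -!lead_coefE -{1}(size_comp_poly2 R sX) -lead_coefE lead_coef_comp ?sX //.
  by rewrite lead_coefXaddC expr1n mulr1 subrr.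
rewrite prednK // => sj; rewrite coefB !nth_default ?subrr //.
by rewrite size_comp_poly2.
Qed.

Definition evpoly (f : nat -> rat) : Prop :=
  exists P : {poly rat}, exists n0, forall n, (n0 <= n)%N -> f n = P.[n%:R].

Lemma evpoly_antidiff f : evpoly (fun n => f n.+1 - f n) -> evpoly f.
Proof.
move=> [Q [n0 hQ]]; have [R _ eR] := fdiff_onto Q.
exists (R + (f n0 - R.[n0%:R])%:P), n0 => n nn; rewrite hornerD hornerC.
rewrite -(subnK nn); elim: (n - n0)%N => [|k IH]; first by rewrite add0n addrC subrK.
have := hQ (k + n0)%N (leq_addl _ _); rewrite -eR fdiff_horner natr1 addSn => e.
by rewrite -[f _.+1](subrK (f (k + n0)%N)) e IH; ring.
Qed.

Lemma evpolyB f g : evpoly f -> evpoly g -> evpoly (fun n => f n - g n).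
Proof.
move=> [P [n1 hP]] [Q [n2 hQ]]; exists (P - Q), (maxn n1 n2) => n.
by rewrite geq_max => /andP[h1 h2]; rewrite hornerD hornerN hP // hQ.
Qed.

Lemma evpoly_shift f : evpoly f -> evpoly (fun n => f n.+1).
Proof.
move=> [P [n0 hP]]; exists (P \Po ('X + 1%:P)), n0 => n nn.
by rewrite horner_comp !hornerE natr1 hP // leqW.
Qed.

End EventuallyPolynomial.

(** Multiplication by [x] from degree [n] to degree [n.+1] of [U / W] has kernel [K / W] and
    cokernel [U / W1]. Both are killed by [x], so induction makes their lengths eventually
    polynomial, and the first difference of the length function is the difference of the two. *)
Theorem hilbert_poly (A : comNzRingType) (G : lmodType A) (nG : noeth G) (a : seq A) :
  forall U W : nat -> G -> Prop,
  (forall n, submod (U n)) -> (forall n, submod (W n)) -> (forall n, subp (W n) (U n)) ->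
  stable a U -> stable a W -> evgen a U W -> (forall n, finlen (W n) (U n)) ->
  evpoly (fun n => (lam (W n) (U n))%:R).
Proof.
elim: a => [|x a IH] U W hU hW WU sU sW gU fU.
  have [n0 h] := gU; exists 0, n0.+1 => -[//|n] nn; rewrite horner0.
  suff -> : U n.+1 = W n.+1 by rewrite (lamE (len_refl _)).
  apply: pred_ext => v; split; last exact: WU.
  by move=> /(h n nn)[_ [w [-> Ww ->]]]; rewrite add0r.
have xh : x \in x :: a by exact: mem_head.
have ah y : y \in a -> y \in x :: a by move=> ya; rewrite inE ya orbT.
pose W1 := shift x U W.
have hW1 n : submod (W1 n) by exact: submod_shift.
have WW1 n : subp (W n) (W1 n) by apply: sub_shift.
have W1U n : subp (W1 n) (U n) by apply: (shift_sub (a := a)).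
have C_poly : evpoly (fun n => (lam (W1 n) (U n))%:R).
  apply: IH => //; first by move=> y ya; apply: sU; apply: ah.
  - exact: stable_shift.
  - exact: evgen_shift.
  - by move=> n; apply: fin_sub (fU n).
pose K n := preimp (x \*: idfun : {linear G -> G}) (U n) (W n.+1).
have hK n : submod (K n) by exact: submod_preimU.
have KU n : subp (K n) (U n) by move=> v [].
have WK n : subp (W n) (K n).
  by move=> v Wv; split; [apply: WU|apply: sW].
have sK : stable (x :: a) K.
  move=> y ya n v [Uv Wv]; split; first exact: sU.
  by rewrite /= scalerA mulrC -scalerA; apply: sW.
have K_poly : evpoly (fun n => (lam (W n) (K n))%:R).
  apply: IH => //.
  - by move=> y ya; apply: sK; apply: ah.
  - by move=> y ya; apply: sW; apply: ah.
  (* As a graded submodule of [U], [K] is generated in bounded degrees over [x :: a]; since [x]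
     sends [K] into [W], the contribution of [x] is absorbed by [W]. *)
  - have [n0 h] := evgen_sub nG hU hW hK WK KU sU sW sK gU.
    exists n0 => n /h s v /s[_ [w [[u [g [[_ Ku] gg ->]]] Ww ->]]].
    exists g, (x *: u + w); split=> //; last by rewrite addrCA addrA.
    exact: submodD.
  - by move=> n; apply: fin_sub (fU n).
apply: evpoly_antidiff.
suff -> : (fun n => (lam (W n.+1) (U n.+1))%:R - (lam (W n) (U n))%:R : rat)
   = (fun n => (lam (W1 n.+1) (U n.+1))%:R - (lam (W n) (K n))%:R).
  by apply: evpolyB => //; exact: (evpoly_shift C_poly).
apply/funext => n.
rewrite (lam_add (hW n) (hK n) (hU n) (@WK n) (@KU n)) //.
rewrite (lam_add (hW n.+1) (hW1 n.+1) (hU n.+1) (@WW1 n.+1) (@W1U n.+1)) //.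
suff -> : lam (W n.+1) (W1 n.+1) = lam (K n) (U n) by rewrite !natrD; ring.
have -> : W1 n.+1 = sump (imgp (x \*: idfun : {linear G -> G}) (U n)) (W n.+1).
  apply: pred_ext => v; split=> [[w [_ [Ww [u Uu ->] ->]]]|[_ [w [[u Uu <-] Ww ->]]]].
    by exists (x *: u), w; split=> //; [exists u|rewrite addrC].
  by exists w, (x *: u); split=> //; [exists u|rewrite addrC].
by rewrite lam_corr //; apply: (fin_sub (@WK n) (@KU n) _ (fU n)).
Qed.

(** * Growth of the Hilbert-Samuel function *)

(** This is m^n X when [a] generates [m]; each power is by definition generated from the previous
    one, as [evgen] asks. *)
Fixpoint mpow (A : comNzRingType) (V : lmodType A) (a : seq A) (n : nat) (X : V -> Prop) : V -> Prop :=
  if n is k.+1 then mulp a (mpow a k X) else X.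

Lemma leq_expW k l e : (k <= l)%N -> (k ^ e <= l ^ e)%N.
Proof. by case: e => // e kl; rewrite leq_exp2r. Qed.

Section Growth.
Variables (A : comNzRingType) (nA : noetherian A) (m : {pred A}) (lm : is_local m).
Variables (a : seq A) (am : forall x, x \in a -> x \in m).
Hypothesis ma : forall x, x \in m -> mulp a (fullp (T := A^o)) x.
Variables (G : lmodType A) (nG : noeth G).
Implicit Types (X Y W U : G -> Prop).

Definition smul (v : G) (c : A^o) : G := c *: v.

Lemma smul_linear v : linear (smul v).
Proof. by move=> b c d; rewrite /smul scalerDl -scalerA. Qed.

Lemma max_mulp U x v : submod U -> x \in m -> U v -> mulp a U (x *: v).
Proof.
move=> hU /ma hx Uv; have : mulp a (imgp (mklinear (smul_linear v)) (fullp (T := A^o))) (x *: v).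
  by rewrite -imgp_mulp; exists x.
by apply: mulp_mono => _ [c _ <-]; apply: submodZ.
Qed.

Lemma submod_mpow n X : submod X -> submod (mpow a n X).
Proof. by move=> hX; elim: n => //= n; apply: submod_gen. Qed.

Lemma mpow_sub n X : submod X -> subp (mpow a n X) X.
Proof.
move=> hX; elim: n => //= n IH; apply: subp_trans IH.
by apply: mulp_subU; apply: submod_mpow.
Qed.

Lemma mpow_mono n X Y : subp X Y -> subp (mpow a n X) (mpow a n Y).
Proof. by move=> h; elim: n => //= n IH; apply: mulp_mono. Qed.

Lemma mpow_add k n X : mpow a (k + n) X = mpow a k (mpow a n X).
Proof. by elim: k => //= k ->. Qed.

Lemma mpow_leq k n X : submod X -> (k <= n)%N -> subp (mpow a n X) (mpow a k X).
Proof.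
move=> hX /subnK <-; rewrite mpow_add; apply: mpow_sub; exact: submod_mpow.
Qed.

Lemma mpow_stable n X x v : submod X -> x \in m -> mpow a n X v -> mpow a n.+1 X (x *: v).
Proof. by move=> hX xm hv; apply: max_mulp => //; apply: submod_mpow. Qed.

Lemma mpow_sum n X Y : submod X -> submod Y ->
  mpow a n (sump X Y) = sump (mpow a n X) (mpow a n Y).
Proof.
by move=> hX hY; elim: n => //= n ->; rewrite mulp_add //; apply: submod_mpow.
Qed.

Let maxi (x : A^o) : Prop := (x : A) \in m.

Lemma ch_max k (U : A^o -> Prop) : submod U -> schain k maxi U -> (k <= 1)%N.
Proof.
case: k => [|[|k]] // hU [C [hC [D [hD cD DC [x Cx nDx]]] CU [y Uy nCy]]].
have mD z : z \in m -> D z by exact: (ch_sub cD).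
suff : C 1 by move=> C1; case: nCy; rewrite -[y]mulr1; apply: (submodZ y hC C1).
have xm : x \notin m by apply/negP => /mD.
have [b <-] := unit_notin_max nA lm xm; exact: (submodZ b hC Cx).
Qed.

(* Prime filtration whose factors are all A/m. *)
Lemma fin_of_primes U W (I : A -> Prop) : submod U -> submod W -> subp W U ->
  (forall b v, I b -> U v -> W (b *: v)) ->
  (forall P, primep P -> subp I P -> forall x, x \in m -> P x) -> finlen W U.
Proof.
move=> hU hW WU IU hI.
suff h : forall K, submod K -> subp W K -> subp K U -> finlen K U by exact: h.
apply: (noeth_ind nG) => K hK IH WK KU.
have [UK|/existsNP[v /not_implyP[Uv nKv]]] := pselect (subp U K).
  have -> : K = U by apply: pred_ext => v; split; [apply: KU|apply: UK].
  by exists 0%N; apply: len_refl.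
have [|v' [Uv' nv' pv' Iv']] := @ass_exists A nA G U K I v hU hK Uv nKv.
  by move=> b Ib; apply: WK; apply: IU.
have cm : colon K v' = maxi.
  apply: pred_ext => x; split; first exact: (prime_sub_max nA lm).
  exact: (hI _ pv').
have hK' : submod (sump (line v') K) by apply: submod_add => //; apply: submod_line.
have KK' : subp K (sump (line v') K) by apply: sumpr; apply: submod_line.
have K'U : subp (sump (line v') K) U.
  by apply: sump_sub => // _ [c ->]; apply: submodZ.
apply: (fin_add hK hK' hU) => //.
  have -> : sump (line v') K = sump (imgp (mklinear (smul_linear v')) (fullp (T := A^o))) K.
    congr (sump _ _); apply: pred_ext => w; split=> [[c ->]|[c _ <-]]; last by exists c.
    by exists c.
  apply/fin_corr => //.
  have -> : preimp (mklinear (smul_linear v')) (fullp (T := A^o)) K = maxi.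
    by rewrite -cm; apply: pred_ext => c; split=> [[]|].
  have [||n h _] := @is_max_exists (fun k => schain k maxi (fullp (T := A^o))) 0%N 1%N.
  - by [].
  - by move=> j; apply: ch_max.
  by exists n.
apply: IH => //; last exact: subp_trans KK'.
move=> e; apply: nv'; rewrite -e; apply: sumpl => //; by exists 1; rewrite scale1r.
Qed.

Lemma fin_mpow n X : submod X -> finlen (mpow a n X) X.
Proof.
move=> hX; have hn := submod_mpow n hX.
apply: (@fin_of_primes _ _ (fun b => forall v, X v -> mpow a n X (b *: v))) => //.
- exact: mpow_sub.
- by move=> b v h /h.
move=> P [hP P1 PM] IP x xm.
have : P (x ^+ n).
  apply: IP => v Xv; elim: n {hn} => [|n IH]; first by rewrite expr0 scale1r.
  by rewrite exprS -scalerA; apply: mpow_stable.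
elim: n {hn IP} => [|n IH]; first by rewrite expr0.
by rewrite exprS => /PM[].
Qed.

Section Chi.
Variables (X : G -> Prop) (hX : submod X).

(** The Hilbert-Samuel function of [X / Y]; below, [quosX] divides [X / Y] by the elements of [xs]
    and [regp] says that they form a regular sequence on it. *)
Definition chi Y n : nat := lam (sump (mpow a n X) Y) X.

Definition quoX Y (x : A) : G -> Prop := sump (fun v => exists2 u, X u & v = x *: u) Y.

Fixpoint quosX Y (xs : seq A) : G -> Prop :=
  if xs is x :: xs' then quosX (quoX Y x) xs' else Y.

Fixpoint regp Y (xs : seq A) : Prop :=
  if xs is x :: xs' then
    (forall v, X v -> Y (x *: v) -> Y v) /\ regp (quoX Y x) xs'
  else exists2 v, X v & ~ Y v.

Lemma submod_quoX Y x : submod Y -> submod (quoX Y x).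
Proof. by move=> hY; apply: submod_add => //; apply: submod_scale. Qed.

Lemma quoX_sub Y x : subp Y X -> subp (quoX Y x) X.
Proof. by move=> YX; apply: sump_sub => // _ [u Xu ->]; apply: submodZ. Qed.

Lemma submod_powX Y n : submod Y -> submod (sump (mpow a n X) Y).
Proof. by move=> hY; apply: submod_add => //; apply: submod_mpow. Qed.

Lemma powX_sub Y n : subp Y X -> subp (sump (mpow a n X) Y) X.
Proof. by move=> YX; apply: sump_sub => //; apply: mpow_sub. Qed.

Lemma fin_powX Y n : submod Y -> subp Y X -> finlen (sump (mpow a n X) Y) X.
Proof.
move=> hY YX; apply: (fin_sub _ _ _ (fin_mpow n hX)) => //; last exact: powX_sub.
by apply: sumpl.
Qed.

Lemma chi_mono Y k n : submod Y -> subp Y X -> (k <= n)%N -> (chi Y k <= chi Y n)%N.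
Proof.
move=> hY YX kn; apply: lam_mono => //; last exact: fin_powX.
  by apply: sump_mono => //; apply: mpow_leq.
exact: powX_sub.
Qed.

Lemma chi0 Y : submod Y -> subp Y X -> chi Y 0 = 0%N.
Proof.
move=> hY YX; rewrite /chi (_ : sump _ _ = X); first exact: lamE (len_refl X).
by apply: pred_ext => v; split; [apply: powX_sub|apply: sumpl].
Qed.

Lemma chi_quo Y x n : submod Y -> subp Y X ->
  chi Y n = (lam (preimp (x \*: idfun : {linear G -> G}) X (sump (mpow a n X) Y)) X
             + chi (quoX Y x) n)%N.
Proof.
move=> hY YX; set W := sump (mpow a n X) Y.
have hW : submod W by exact: submod_powX.
pose C := sump (imgp (x \*: idfun : {linear G -> G}) X) W.
have CE : C = sump (mpow a n X) (quoX Y x).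
  apply: pred_ext => v; split.
    move=> [_ [_ [[u Xu <-] [p [q [Pp Yq ->]] ->]]]].
    exists p, (x *: u + q); split=> //; last by rewrite addrCA.
    by exists (x *: u), q; split=> //; exists u.
  move=> [p [_ [Pp [_ [q [[u Xu ->] Yq ->]]] ->]]].
  exists (x *: u), (p + q); split=> //; last by rewrite addrCA.
    by exists u.
  by exists p, q.
have hC : submod C by rewrite CE; apply: submod_powX; apply: submod_quoX.
have WC : subp W C by apply: sumpr; apply: submod_img.
have CX : subp C X by rewrite CE; apply: powX_sub; apply: quoX_sub.
rewrite /chi (lam_add hW hC hX WC CX); last exact: fin_powX.
rewrite -/W CE; congr (_ + _)%N; rewrite -CE /C lam_corr //.
apply/fin_corr => //; apply: (fin_sub _ WC CX (fin_powX n hY YX)) => //.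
Qed.

(** As [x] maps [m^n X + Y] into [m^(n+1) X + Y], the increment of [chi Y] at [n] is at most
    [chi (quoX Y x) n.+1]. Summation raises the exponent by one for each element, starting from the
    finite length of the last quotient. *)
Lemma chi_le xs : (forall x, x \in xs -> x \in m) -> forall Y, submod Y -> subp Y X ->
  finlen (quosX Y xs) X -> exists C, forall n, (chi Y n <= C * n.+1 ^ size xs)%N.
Proof.
elim: xs => [|x xs IH] xm Y hY YX /= fY.
  exists (lam Y X) => n; rewrite expn0 muln1; apply: lam_mono => //; last exact: powX_sub.
  by apply: sumpr; apply: submod_mpow.
have [||||C hC] := IH _ (quoX Y x).
- by move=> y ys; apply: xm; rewrite inE ys orbT.
- exact: submod_quoX.
- exact: quoX_sub.
- exact: fY.
exists C => n; apply: (@leq_trans (n * (C * n.+1 ^ size xs))%N); last first.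
  by rewrite mulnCA leq_mul2l expnS leq_mul2r leqnSn !orbT.
elim: n => [|n IHn]; first by rewrite chi0.
rewrite (chi_quo x n.+1 hY YX) mulSn addnC; apply: leq_add; first exact: hC.
apply: (@leq_trans (chi Y n)); last first.
  by apply: leq_trans IHn _; rewrite !leq_mul2l leq_expW ?leqnSn ?orbT.
apply: lam_mono => //; last exact: fin_powX; last by move=> v [].
move=> v hv; split; first exact: powX_sub hv.
case: hv => p [q [Pp Yq ->]]; rewrite /= scalerDr; exists (x *: p), (x *: q); split=> //.
  by apply: mpow_stable => //; apply: xm; rewrite mem_head.
exact: submodZ.
Qed.

(** Artin-Rees for [(x X + Y) / Y] inside [X / Y] writes [x *: v] as [x *: u] modulo [Y], with [u]
    in m^n X; regularity then cancels [x]. *)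
Lemma artin_rees_regular Y x : x \in m -> submod Y -> subp Y X ->
  (forall v, X v -> Y (x *: v) -> Y v) ->
  exists e, forall n v, X v -> sump (mpow a (n + e) X) Y (x *: v) -> sump (mpow a n X) Y v.
Proof.
move=> xm hY YX reg.
pose U n := sump (mpow a n X) Y.
pose Z n := capp (quoX Y x) (U n).
have hU n : submod (U n) by exact: submod_powX.
have hQ := submod_quoX x hY.
have hZ n : submod (Z n) by exact: submod_cap.
have sY : stable a (fun=> Y) by move=> y ya n v; apply: submodZ.
have sU : stable a U.
  move=> y ya n v [p [q [Pp Yq ->]]]; exists (y *: p), (y *: q); rewrite scalerDr.
  by split=> //; [apply: mpow_stable => //; apply: am|apply: submodZ].
have sZ : stable a Z.
  by move=> y ya n v [Qv Uv]; split; [apply: submodZ|apply: sU].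
have [||||n0 h] := @evgen_sub A G nG a U (fun=> Y) Z hU _ hZ _ _ sU sY sZ.
- by [].
- by move=> n v Yv; split; [apply: sumpr => //; apply: submod_scale|apply: sumpr => //; apply: submod_mpow].
- by move=> n v [].
- exists 0%N => n _; apply: sump_mono => //; apply: mulp_mono.
  by apply: sumpl.
have Zk k : subp (Z (k + n0)%N) (sump (mpow a k (quoX Y x)) Y).
  elim: k => [|k IH]; first by move=> v [Qv _]; apply: sumpl.
  move=> v; rewrite addSn => /(h _ (leq_addl _ _)) [g [y [gg Yy ->]]].
  have : mulp a (sump (mpow a k (quoX Y x)) Y) g by apply: mulp_mono gg.
  rewrite mulp_add //; last exact: submod_mpow.
  case=> p [q [Pp Yq ->]]; exists p, (q + y); split=> //; last by rewrite addrA.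
  by apply: submodD => //; apply: mulp_subU Yq.
have xk k v : mpow a k (quoX Y x) v -> exists u y, [/\ mpow a k X u, Y y & v = x *: u + y].
  rewrite /quoX mpow_sum //; last exact: submod_scale.
  case=> p [q [Pp Yq ->]]; have Yq' : Y q by apply: mpow_sub Yq.
  suff : imgp (x \*: idfun : {linear G -> G}) (mpow a k X) p.
    by move=> [u hu <-]; exists u, q.
  move: Pp.
  have -> : (fun v => exists2 u, X u & v = x *: u) = imgp (x \*: idfun : {linear G -> G}) X.
    apply: pred_ext => w; split=> [[u Xu ->]|[u Xu <-]]; by exists u.
  elim: k p {Yq} => [|k IHk] p //=.
  by rewrite imgp_mulp; apply: mulp_mono.
exists n0 => n v Xv hv.
have [p [y [/xk[u [y' [hu Yy' ->]]] Yy e]]] : sump (mpow a n (quoX Y x)) Y (x *: v).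
  apply: Zk; split=> //; exists (x *: v), 0; rewrite addr0; split=> //; first by exists v.
  exact: submod0.
exists u, (v - u); split=> //; last by rewrite addrC subrK.
apply: reg; first by apply: submodB => //; apply: mpow_sub hu.
rewrite scalerBr e -[_ + y]addrA [_ - _]addrC addKr; exact: submodD.
Qed.

(** A discrete mean value inequality; it supplies the factor [(size xs).+1] in the constant of
    [chi_ge]. *)
Lemma leq_expS k s : (k.+1 ^ s.+1 <= k ^ s.+1 + s.+1 * k.+1 ^ s)%N.
Proof.
elim: s => [|s IH]; first by rewrite !expn1 expn0; lia.
rewrite expnS; apply: leq_trans (leq_mul (leqnn _) IH) _.
have : (k ^ s.+1 <= k.+1 ^ s.+1)%N by rewrite leq_exp2r.
rewrite !expnS; move: (k ^ s)%N (k.+1 ^ s)%N => u v; nia.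
Qed.

(** For regular [x], [artin_rees_regular] bounds the kernel term of [chi_quo] from below by [chi Y]
    at an argument smaller by a fixed shift. So [chi Y] gains at least a value of [chi (quoX Y x)]
    over each block of fixed length. With no element left, Nakayama gives [chi Y k > 0]. *)
Lemma chi_ge xs : (forall x, x \in xs -> x \in m) -> forall Y, submod Y -> subp Y X ->
  regp Y xs -> exists c E, (0 < E)%N /\
    forall k, (0 < k)%N -> (k ^ size xs <= c * chi Y (E * k))%N.
Proof.
elim: xs => [|x xs IH] xm Y hY YX /=.
  move=> [v Xv nYv]; exists 1%N, 1%N; split=> // k k0; rewrite expn0 !mul1n.
  apply: lam_gt0; [exact: fin_powX|exact: submod_powX|exact: powX_sub|].
  apply: contrapT => h; apply: nYv; have [s hs] := nG hX.
  apply: (@nakayama A nA m lm G X Y a s) => //.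
  - by rewrite hs => y; apply: mem_spanp.
  - by rewrite hs; apply: sumpr.
  - move=> w Xw; apply: contrapT => nw; apply: h; exists w => // -[p [q [Pp Yq e]]].
    apply: nw; exists q, p; split=> //; last by rewrite addrC.
    rewrite -(prednK k0) in Pp; apply: mulp_mono Pp; exact: mpow_sub.
move=> [reg hreg].
have xsm y : y \in xs -> y \in m by move=> ys; apply: xm; rewrite inE ys orbT.
have xm' : x \in m by apply: xm; rewrite mem_head.
have hQ := submod_quoX x hY; have QX := @quoX_sub Y x YX.
have [c [E [E0 hc]]] := IH xsm _ hQ QX hreg.
have [e he] := artin_rees_regular xm' hY YX reg.
have step f n : (e <= f)%N -> (chi Y n + chi (quoX Y x) (n + f) <= chi Y (n + f))%N.
  move=> ef; rewrite (chi_quo x (n + f) hY YX) leq_add2r; apply: lam_mono => //.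
  - move=> v [Xv hv]; apply: he => //; move: hv; apply: sump_mono => //.
    by apply: mpow_leq => //; rewrite leq_add2l.
  - exact: powX_sub.
  - apply: (fin_sub _ _ _ (fin_powX (n + f) hY YX)) => //; last by move=> v [].
    move=> v hv; split; first exact: powX_sub hv.
    by apply: submodZ => //; apply: submod_powX.
(* The block length must be at least [e] for [step] and at least [E] for the bound on the quotient;
   [e.+1 * E] is both, since [E] is positive. *)
exists (c * (size xs).+1)%N, (e.+1 * E)%N; split; first by rewrite muln_gt0.
move=> k _; elim: k => [|k IHk]; first by rewrite exp0n.
apply: leq_trans (leq_expS _ _) _.
have h := step (e.+1 * E)%N (e.+1 * E * k)%N.
rewrite (mulnS (e.+1 * E)) [(e.+1 * E + _)%N]addnC.
apply: leq_trans (leq_mul (leqnn _) (h _)); last by nia.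
rewrite mulnDr leq_add //.
have := hc k.+1 isT => h1.
rewrite -mulnA mulnCA leq_mul2l /=; apply: leq_trans h1 _.
rewrite leq_mul2l; apply/orP; right; apply: chi_mono => //; nia.
Qed.

End Chi.
End Growth.

(** * The degree of a polynomial from the growth of its sums *)

Section PolynomialGrowth.
Implicit Types Q R P : {poly rat}.

Lemma poly_growth_le Q s : (size Q <= s.+1)%N ->
  exists2 C : rat, 0 <= C & forall n, (0 < n)%N -> `|Q.[n%:R]| <= C * n%:R ^+ s.
Proof.
move=> sQ; exists (\sum_(i < size Q) `|Q`_i|); first by apply: sumr_ge0.
move=> n n0; rewrite horner_coef mulr_suml; apply: le_trans (ler_norm_sum _ _ _) _.
apply: ler_sum => i _; rewrite normrM ler_wpM2l // normrX normr_nat.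
rewrite -!natrX ler_nat leq_pexp2l //; have := ltn_ord i; lia.
Qed.

Lemma poly_growth_ge Q s : size Q = s.+1 ->
  exists (c : rat) n0, 0 < c /\ forall n, (n0 <= n)%N -> c * n%:R ^+ s <= `|Q.[n%:R]|.
Proof.
move=> sQ; set l := lead_coef Q.
have l0 : 0 < `|l| by rewrite normr_gt0 lead_coef_eq0 -size_poly_eq0 sQ.
pose Q' := Q - l *: 'X^s.
(* Multiplying the lower part [Q'] by ['X] expresses a bound of order [s - 1] without subtraction,
   so that [s = 0] is covered. *)
have [|C C0 hC] := @poly_growth_le ('X * Q') s.
  have sQ' : (size Q' <= s)%N.
    apply/leq_sizeP => j; rewrite leq_eqVlt => /orP[/eqP <-|sj].
      by rewrite coefB coefZ coefXn eqxx mulr1 /l lead_coefE sQ subrr.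
    by rewrite coefB coefZ coefXn gtn_eqF // mulr0 subr0 nth_default // sQ.
  by apply: leq_trans (size_polyMleq _ _) _; rewrite size_polyX.
have [n0 hn0] : exists n0 : nat, 2 * C / `|l| < n0%:R.
  by exists (Num.bound (2 * C / `|l|)); apply: archi_boundP; rewrite divr_ge0 ?mulr_ge0.
exists (`|l| / 2), n0.+1; split; first by rewrite divr_gt0.
move=> n nn; have n_gt0 : (0 < n)%N by apply: leq_trans nn.
have nR : (0 : rat) < n%:R by rewrite ltr0n.
have := hC n n_gt0; rewrite hornerM hornerX normrM (gtr0_norm nR) => hQ'.
have QE : Q.[n%:R] = Q'.[n%:R] + l * n%:R ^+ s by rewrite hornerD hornerN hornerZ hornerXn subrK.
have hn : 2 * C <= `|l| * n%:R.
  have : 2 * C / `|l| <= n%:R by apply: le_trans (ltW hn0) _; rewrite ler_nat ltnW.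
  by rewrite ler_pdivrMr // [n%:R * _]mulrC.
have tri : `|l| * n%:R ^+ s <= `|Q.[n%:R]| + `|Q'.[n%:R]|.
  have -> : `|l| * n%:R ^+ s = `|Q.[n%:R] - Q'.[n%:R]|.
    by rewrite QE addrAC subrr add0r normrM normrX normr_nat.
  exact: ler_normB.
have Xs : 0 <= n%:R ^+ s :> rat by rewrite exprn_ge0 // ler0n.
rewrite -(ler_pM2l nR).
move: (`|Q.[n%:R]|) (`|Q'.[n%:R]|) (n%:R ^+ s) tri Xs hQ' => u v w tri w0 hv.
have h1 : n%:R * (`|l| * w) <= n%:R * u + n%:R * v by rewrite -mulrDr ler_pM2l.
have h2 : 2 * C * w <= `|l| * n%:R * w by rewrite ler_wpM2r.
lra.
Qed.

Lemma not_bounded (C : rat) n0 : exists2 n, (n0 <= n)%N & C < n%:R.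
Proof.
exists (maxn n0 (Num.bound `|C|)); first exact: leq_maxl.
apply: le_lt_trans (ler_norm C) _; apply: lt_le_trans (archi_boundP (normr_ge0 C)) _.
by rewrite ler_nat leq_maxr.
Qed.

(** The sums of [h] agree eventually with an antidifference [R] of [P], and the two bounds force [R]
    to have degree exactly [t]; passing to [fdiff R] lowers the degree by one. *)
Theorem size_of_growth (h : nat -> nat) P (t n0 : nat) :
  (forall n, (n0 <= n)%N -> (h n)%:R = P.[n%:R]) ->
  (exists C, forall K, (\sum_(n < K) h n <= C * K.+1 ^ t)%N) ->
  (exists c E, (0 < E)%N /\
     forall k, (0 < k)%N -> (k ^ t <= c * \sum_(n < (E * k).+1) h n)%N) ->
  (0 < t)%N -> size P = t.
Proof.
move=> hP [C hC] [c [E [E0 hc]]] t0.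
have [R0 sR0 eR0] := fdiff_onto P.
pose S K := (\sum_(n < K) h n)%N.
pose R := R0 + ((S n0)%:R - R0.[n0%:R])%:P.
have dR : fdiff R = P.
  by rewrite /R fdiffD eR0 /fdiff comp_polyC subrr addr0.
have sRP : (size R <= (size P).+1)%N.
  by apply: leq_trans (size_polyD _ _) _; rewrite geq_max sR0 (leq_trans (size_polyC_leq1 _)).
have SR K : (n0 <= K)%N -> (S K)%:R = R.[K%:R].
  move=> /subnK <-; elim: (K - n0)%N => [|k IH].
    by rewrite add0n /R hornerD hornerC addrC subrK.
  rewrite addSn /S big_ord_recr /= natrD -/(S _) IH hP ?leq_addl // -dR fdiff_horner.
  by rewrite natr1 addrC subrK.
have up : (size R <= t.+1)%N.
  rewrite leqNgt; apply/negP => tR.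
  have [c1 [n1 [c10 h1]]] := @poly_growth_ge R (size R).-1 (esym (prednK (ltn_trans (ltn0Sn _) tR))).
  have [K nK hK] := not_bounded (C%:R * 2 ^+ t / c1) (maxn (maxn n0 n1) 1).
  move: nK; rewrite !geq_max -andbA => /and3P[K0 K1 K2].
  have Kp : (0 : rat) < K%:R by rewrite ltr0n.
  have := h1 K K1; rewrite -SR // normr_nat leNgt => /negP; apply.
  apply: (@le_lt_trans _ _ (C%:R * (2 ^+ t * K%:R ^+ t))).
    apply: (@le_trans _ _ ((C * K.+1 ^ t)%N%:R)); first by rewrite ler_nat; apply: hC.
    rewrite natrM ler_wpM2l ?ler0n // -exprMn natrX lerXn2r ?nnegrE ?mulr_ge0 ?ler0n //.
    by rewrite -natrM ler_nat; lia.
  apply: (@lt_le_trans _ _ (c1 * K%:R ^+ t.+1)).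
    rewrite [_ ^+ t.+1]exprS !mulrA ltr_pM2r ?exprn_gt0 //.
    by move: hK; rewrite ltr_pdivrMr // [_ * c1]mulrC.
  rewrite ler_pM2l // -!natrX ler_nat leq_pexp2l //; lia.
have low : (t < size R)%N.
  rewrite ltnNge; apply/negP => Rt.
  (* If [R] had size at most [t], then [K * S K] would be at most a multiple of K^t. At
     [K = E * k + 1] the hypothesis gives it order at least k^(t+1), while K^t is at most (2 E k)^t;
     large [k] is impossible. *)
  have [|C1 C10 h1] := @poly_growth_le ('X * R) t.
    by apply: leq_trans (size_polyMleq _ _) _; rewrite size_polyX.
  have [k nk hk] := not_bounded (c%:R * C1 * (2 * E%:R) ^+ t) (maxn n0 1).
  move: nk; rewrite geq_max => /andP[k0 k1].
  pose K := (E * k).+1.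
  have kK : (k <= K)%N by rewrite /K; nia.
  have kp : (0 : rat) < k%:R by rewrite ltr0n.
  have := h1 K isT; rewrite hornerM hornerX -SR; last by lia.
  rewrite normrM !normr_nat => h2.
  have h3 : k%:R ^+ t * K%:R <= c%:R * (C1 * K%:R ^+ t).
    apply: (@le_trans _ _ (c%:R * (S K)%:R * K%:R)).
      rewrite ler_wpM2r ?ler0n //; have := hc k k1; rewrite -/K -/(S K) => h4.
      by rewrite -natrX -natrM ler_nat.
    by rewrite -mulrA ler_wpM2l ?ler0n // mulrC.
  have h5 : K%:R ^+ t <= (2 * E%:R) ^+ t * k%:R ^+ t :> rat.
    rewrite -exprMn lerXn2r ?nnegrE ?mulr_ge0 ?ler0n //.
    by rewrite -!natrM ler_nat /K; nia.
  have h6 : k%:R ^+ t * K%:R <= c%:R * C1 * (2 * E%:R) ^+ t * k%:R ^+ t.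
    apply: le_trans h3 _; rewrite -!mulrA ler_wpM2l ?ler0n // ler_wpM2l //.
  move: h6; rewrite mulrC ler_pM2r ?exprn_gt0 // leNgt => /negP; apply.
  by apply: lt_le_trans hk _; rewrite ler_nat.
have sR : size R = t.+1 by apply/eqP; rewrite eqn_leq up low.
apply/eqP; rewrite eqn_leq; apply/andP; split; last by rewrite -ltnS -sR.
by rewrite -ltnS -sR -dR; apply: size_fdiff; rewrite -size_poly_eq0 sR.
Qed.

End PolynomialGrowth.

(** * Matrices over a local ring and homology modulo m^n *)

Section MatrixAct.
Variables (A : comNzRingType).

Lemma mx_actM (N : lmodType A) p q r (B : 'M[A]_(p, q)) (D : 'M[A]_(q, r)) y :
  mx_act N (B *m D) y = mx_act N D (mx_act N B y).
Proof.
apply/ffunP => k; rewrite !ffunE.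
under [RHS]eq_bigr do rewrite ffunE scaler_sumr.
rewrite exchange_big /=; apply: eq_bigr => j _.
rewrite mxE scaler_suml; apply: eq_bigr => i _.
by rewrite scalerA mulrC.
Qed.

Lemma mx_act1 (N : lmodType A) p y : mx_act N (1%:M : 'M[A]_p) y = y.
Proof.
apply/ffunP => k; rewrite ffunE (bigD1 k) //= mxE eqxx scale1r big1 ?addr0 // => i ik.
by rewrite mxE (negbTE ik) scale0r.
Qed.

Lemma mx_actD (N : lmodType A) p q (B D : 'M[A]_(p, q)) y :
  mx_act N (B + D) y = mx_act N B y + mx_act N D y.
Proof.
apply/ffunP => k; rewrite !ffunE -big_split /=; apply: eq_bigr => i _.
by rewrite mxE scalerDl.
Qed.

Lemma mx_act0 (N : lmodType A) p q y : mx_act N (0 : 'M[A]_(p, q)) y = 0.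
Proof. by apply/ffunP => k; rewrite !ffunE big1 // => i _; rewrite mxE scale0r. Qed.

Lemma mx_actB (N : lmodType A) p q (B D : 'M[A]_(p, q)) y :
  mx_act N (B - D) y = mx_act N B y - mx_act N D y.
Proof. by have := mx_actD (B - D) D y; rewrite subrK => ->; rewrite addrK. Qed.

Lemma mx_act_col (N : lmodType A) p1 p2 q (B : 'M[A]_(p1, q)) (C : 'M[A]_(p2, q)) y1 y2 :
  exists y, mx_act N (col_mx B C) y = mx_act N B y1 + mx_act N C y2.
Proof.
exists [ffun i => match fintype.split i with inl j => y1 j | inr j => y2 j end].
apply/ffunP => k; rewrite !ffunE big_split_ord /=; congr (_ + _); apply: eq_bigr => i _.
  by rewrite ffunE col_mxEu (unsplitK (inl i)).
by rewrite ffunE col_mxEd (unsplitK (inr i)).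
Qed.

Lemma mx_act_map (N Q : lmodType A) (f : {linear N -> Q}) p q (D : 'M[A]_(p, q)) (y : {ffun 'I_p -> N}) :
  mx_act Q D [ffun i => f (y i)] = [ffun i => f (mx_act N D y i)].
Proof.
apply/ffunP => k; rewrite !ffunE linear_sum; apply: eq_bigr => i _.
by rewrite ffunE linearZ.
Qed.

Lemma col_mulmx p q r (X : 'M[A]_(p, q)) (Y : 'M[A]_(q, r)) j :
  col j (X *m Y) = X *m col j Y.
Proof. by rewrite !colE mulmxA. Qed.

Definition coordp (N : lmodType A) (I : finType) (U : N -> Prop) (v : {ffun I -> N}) : Prop :=
  forall i, U (v i).
Arguments coordp {N I} U v.

Lemma submod_coordp (N : lmodType A) (I : finType) (U : N -> Prop) :
  submod U -> submod (coordp (I := I) U).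
Proof.
move=> hU; split; first by move=> i; rewrite ffunE; apply: submod0.
by move=> b u v Uu Uv i; rewrite !ffunE; apply: hU.2.
Qed.

Lemma coordp_mulp (N : lmodType A) (I : finType) a (U : N -> Prop) :
  mulp a (coordp (I := I) U) = coordp (I := I) (mulp a U).
Proof.
elim: a => [|x a IH]; apply: pred_ext => v /=.
  split=> [-> i|h]; first by rewrite ffunE.
  by apply/ffunP => i; rewrite h ffunE.
rewrite IH; split=> [[u [w [Uu gw ->]]] i|h].
  by exists (u i), (w i); rewrite !ffunE.
have [u hu] := choice h; have [w hw] := choice hu.
exists [ffun i => u i], [ffun i => w i]; split.
- by move=> i; rewrite ffunE; case: (hw i).
- by move=> i; rewrite ffunE; case: (hw i).
- by apply/ffunP => i; rewrite !ffunE; case: (hw i).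
Qed.

Lemma coordp_mpow (N : lmodType A) (I : finType) a n (U : N -> Prop) :
  mpow a n (coordp (I := I) U) = coordp (I := I) (mpow a n U).
Proof. by elim: n => //= n ->; rewrite coordp_mulp. Qed.

Lemma coordp_full (N : lmodType A) (I : finType) :
  coordp (I := I) (fullp (T := N)) = fullp (T := {ffun I -> N}).
Proof. by apply: pred_ext => v. Qed.

Lemma mx_act_coordp (N : lmodType A) p q (D : 'M[A]_(p, q)) (U : N -> Prop) y :
  submod U -> coordp U y -> coordp U (mx_act N D y).
Proof.
by move=> hU Uy i; rewrite ffunE; apply: submod_sum => // j _; apply: submodZ.
Qed.

End MatrixAct.
Arguments coordp {A N I} U v.

Section LocalMatrix.
Variables (A : comNzRingType) (nA : noetherian A) (m : {pred A}) (lm : is_local m).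
Variables (a : seq A) (am : forall x, x \in a -> x \in m).
Hypothesis ma : forall x, x \in m -> mulp a (fullp (T := A^o)) x.

(* Columns are cleared one at a time: if row i of D - D E D has a unit u in column j,
   E + c u^-1 w with c = (1 - E D) e_j and w = e_i (1 - D E) clears column j. *)
Lemma inner_inverse q r (D : 'M[A]_(q, r)) :
  exists E : 'M[A]_(r, q), E *m D *m E = E /\ forall i j, (D - D *m E *m D) i j \in m.
Proof.
suff h k : (k <= r)%N -> exists E : 'M[A]_(r, q), E *m D *m E = E /\
    forall i (j : 'I_r), (j < k)%N -> (D - D *m E *m D) i j \in m.
  by have [E [h1 h2]] := h r (leqnn r); exists E; split=> // i j; apply: h2.
elim: k => [|k IH] kr; first by exists 0; rewrite !mul0mx.
have [E [EDE hE]] := IH (ltnW kr).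
pose j0 := Ordinal kr.
have [hm|] := pselect (forall i, (D - D *m E *m D) i j0 \in m).
  exists E; split=> // i j; rewrite ltnS leq_eqVlt => /orP[/eqP jk|]; last exact: hE.
  by rewrite (_ : j = j0) //; apply: val_inj.
move=> /existsNP[i0 /negP /(unit_notin_max nA lm)[u uE]].
pose k1 : 'M[A]_q := 1%:M - D *m E.
pose k2 : 'M[A]_r := 1%:M - E *m D.
pose w : 'rV[A]_q := row i0 k1.
pose c : 'cV[A]_r := col j0 k2.
have k1D : k1 *m D = D - D *m E *m D by rewrite mulmxBl mul1mx.
have Dk2 : D *m k2 = D - D *m E *m D by rewrite mulmxBr mulmx1 mulmxA.
have k1DE : k1 *m D *m E = 0 by rewrite k1D mulmxBl -!mulmxA !(mulmxA E) EDE subrr.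
have EDk2 : E *m D *m k2 = 0 by rewrite -mulmxA Dk2 mulmxBr !mulmxA EDE subrr.
have wDE : w *m D *m E = 0 by rewrite /w -!row_mul k1DE row0.
have EDc : E *m D *m c = 0 by rewrite /c -col_mulmx EDk2 col0.
have wD : w *m D = row i0 (D - D *m E *m D) by rewrite /w -row_mul k1D.
have Dc : D *m c = col j0 (D - D *m E *m D) by rewrite /c -col_mulmx Dk2.
have wDc : u *: (w *m D *m c) = 1%:M.
  rewrite /c -col_mulmx /w -row_mul k1D mulmxBr mulmx1.
  have -> : row i0 (D - D *m E *m D) *m (E *m D) = 0.
    by rewrite -k1D row_mul -/w mulmxA wDE mul0mx.
  by rewrite subr0; apply/matrixP => i j; rewrite !ord1 !mxE; rewrite !mxE in uE.
pose E' := E + u *: (c *m w).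
have DE' : D *m E' *m D = D *m E *m D + u *: (D *m c *m (w *m D)).
  by rewrite /E' mulmxDr mulmxDl -scalemxAr -scalemxAl !mulmxA.
exists E'; split.
  have xDE : c *m w *m D *m E = 0 by rewrite -!mulmxA (mulmxA w) wDE mulmx0.
  have EDx : E *m D *m (c *m w) = 0 by rewrite mulmxA EDc mul0mx.
  have xDx : u *: (c *m w *m D *m (c *m w)) = c *m w.
    have -> : c *m w *m D *m (c *m w) = c *m (w *m D *m c) *m w by rewrite !mulmxA.
    by rewrite scalemxAl scalemxAr wDc mulmx1.
  rewrite /E' mulmxDr !mulmxDl -!scalemxAl -!scalemxAr EDE xDE EDx xDx.
  by rewrite !scaler0 !addr0 add0r.
move=> i j; rewrite ltnS leq_eqVlt DE' opprD addrA => hj.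
(* With X = D - D E D, the residue of [E'] is X minus [u] times column [j0] of X times row [i0] of
   X. It vanishes in column [j0] because [u * X i0 j0 = 1], and earlier columns stay in [m] because
   the entries of row [i0] there lie in [m]. *)
rewrite Dc wD.
have ent (X : 'M[A]_(q, r)) :
    (X - u *: (col j0 X *m row i0 X)) i j = X i j - u * (X i j0 * X i0 j).
  by rewrite !mxE big_ord1 !mxE.
rewrite ent; case/orP: hj => [/eqP jk|jk].
  have -> : j = j0 by apply: val_inj.
  rewrite mulrCA uE mulr1 subrr; exact: (submod0 (ideal_max lm)).
have := submodB (ideal_max lm) (hE i j jk)
  (idealM (u * (D - D *m E *m D) i j0) (ideal_max lm) (hE i0 j jk)).
by rewrite -mulrA.
Qed.

(** Surjectivity after tensoring with a nonzero [N] already splits [B]: the entries of [1 - E *m B]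
    must lie in [m], so [E *m B] is onto by Nakayama, and preimages of the basis vectors give
    [R]. *)
Lemma surj_split p q (B : 'M[A]_(p, q)) (N : lmodType A) : noeth N ->
  (exists v : N, v <> 0) -> (forall y, exists x, mx_act N B x = y) ->
  exists R : 'M[A]_(q, p), R *m B = 1%:M.
Proof.
move=> nN [v0 v0n] surj; have [E [EBE hE]] := inner_inverse B.
pose c := 1%:M - E *m B.
have Bc : B *m c = B - B *m E *m B by rewrite mulmxBr mulmx1 mulmxA.
have cm i j : c i j \in m.
  apply: contrapT => /negP/(unit_notin_max nA lm)[u uE].
  apply: v0n; have [s hs] := nN _ (submod_full N).
  apply: (@nakayama A nA m lm N (fullp (T := N)) (nullp (V := N)) a s) => //.
  - exact: submod_null.
  - by rewrite -hs => v _; exists 0, v; rewrite add0r.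
  move=> v _; exists 0, v; rewrite add0r; split=> //.
  (* If [c i j] is a unit, this preimage exhibits [v] as coordinate [j] of [B *m c] applied to [x].
     The entries of [B *m c] lie in [m], so [N = m N], against [N] being nonzero. *)
  have [x xE] := surj [ffun k => if k == i then u *: v else 0].
  have : mx_act N c (mx_act N B x) j = v.
    rewrite xE ffunE (bigD1 i) //= ffunE eqxx scalerA mulrC uE scale1r big1 ?addr0 // => k ki.
    by rewrite ffunE (negbTE ki) scaler0.
  rewrite -mx_actM Bc => <-; rewrite ffunE; apply: submod_sum => [|k _].
    exact: submod_gen.
  by apply: (max_mulp ma) => //; exact: hE.
have [s hs] := fg_noeth nA (fg_rV A q) (submod_full 'rV[A]_q).
pose f : {linear 'rV[A]_q -> 'rV[A]_q} := mulmxr (E *m B).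
have fsurj : subp (fullp (T := 'rV[A]_q)) (imgp f (fullp (T := 'rV[A]_q))).
  apply: (@nakayama A nA m lm _ _ _ a s) => //.
  - by apply: submod_img.
  - by rewrite -hs => v _; exists 0, v; rewrite add0r; split=> //; exists 0; rewrite ?linear0.
  move=> v _; exists (f v), (v *m c); split; first by exists v.
    rewrite mulmx_sum_row; apply: submod_sum => [|i _]; first exact: submod_gen.
    apply: submodZ; first exact: submod_gen.
    rewrite [row i c]row_sum_delta; apply: submod_sum => [|j _]; first exact: submod_gen.
    by apply: (max_mulp ma) => //; rewrite mxE.
  by rewrite /f /= /c mulmxBr mulmx1 addrC subrK.
have [g hg] := choice (fun v => let: ex_intro2 x _ e := fsurj v I in ex_intro (fun x => f x = v) x e).
exists ((\matrix_i g (delta_mx 0 i)) *m E); rewrite -mulmxA; apply/row_matrixP => i.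
by rewrite row_mul rowK [LHS]hg rowE mulmx1.
Qed.

End LocalMatrix.

(** * Homology with coefficients in a quotient, as a relative length *)

Section HomologyLength.
Variable A : comNzRingType.

(** Both lengths are pulled back by [len_corr] to [kermod g], where the two submodules are the
    same. *)
Lemma homology_length (U V W : lmodType A) (f : {linear U -> V}) (g : {linear V -> W}) l :
  (forall u, g (f u) = 0) ->
  has_length (homology f g) l <-> rlength (imgp f (fullp (T := U))) (fun v => g v = 0) l.
Proof.
move=> gf; rewrite has_lengthE.
have [h [hs hk]] : exists h : {linear kermod g -> homology f g},
    (forall q, exists v, h v = q) /\ forall z, h z = 0 <-> exists u, f u = val z.
  have [p [ps pk]] := quotmod_pi (@bndp A U V W f g).
  by exists p; split=> // z; rewrite pk inE; split=> /asboolP.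
have -> : fullp (T := homology f g) = sump (imgp h (fullp (T := kermod g))) (nullp (V := homology f g)).
  apply: pred_ext => q; split=> // _; have [v <-] := hs q; apply: sumpl; first exact: submod_null.
  by exists v.
rewrite len_corr //; last exact: submod_null.
pose i (z : kermod g) : V := val z.
have il : linear i by [].
have -> : (fun v => g v = 0) = sump (imgp (mklinear il) (fullp (T := kermod g))) (imgp f (fullp (T := U))).
  apply: pred_ext => v; split=> [gv|].
    apply: sumpl; first exact: submod_img.
    have kv : v \in kerp g by rewrite inE gv.
    by exists (exist _ v kv).
  case=> _ [_ [[z _ <-] [u _ <-] ->]]; rewrite linearD gf addr0 /=.
  by have := valP z; rewrite inE => /eqP.
rewrite len_corr //; last exact: submod_img.
suff -> : preimp h (fullp (T := kermod g)) (nullp (V := homology f g)) =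
  preimp (mklinear il) (fullp (T := kermod g)) (imgp f (fullp (T := U))) by [].
apply: pred_ext => z; split=> -[_ /=].
  by move=> /hk[u e]; split=> //; exists u.
by case=> u _ e; split=> //; apply/hk; exists u.
Qed.

Section Act.
Variables (N Q : lmodType A) (pi : {linear N -> Q}) (K : N -> Prop).
Hypotheses (pis : forall q, exists v, pi v = q) (piK : forall v, pi v = 0 <-> K v).
Variables (p q r : nat) (B : 'M[A]_(p, q)) (D : 'M[A]_(q, r)).
Hypothesis BD : B *m D = 0.
Hypothesis ex : forall w, mx_act N D w = 0 -> exists y, mx_act N B y = w.

(** Cycles over [Q] lift to the vectors [w] of [Z], those with [D w] in K^r, and boundaries lift to
    [im B + K^q]. As [im B] is the kernel of [D] over [N], applying [D] turns cycles modulo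
    boundaries into the quotient on the right. *)
Lemma act_homology_length l :
  has_length (homology (mx_act Q B) (mx_act Q D)) l <->
  rlength (imgp (mx_act N D) (coordp K)) (capp (imgp (mx_act N D) (fullp (T := {ffun 'I_q -> N}))) (coordp K)) l.
Proof.
have hK : submod K.
  suff -> : K = (fun v => pi v = 0) by exact: submod_ker.
  by apply: pred_ext => v; split=> /piK.
rewrite homology_length; last by move=> u; rewrite /= -mx_actM BD mx_act0.
pose pq (v : {ffun 'I_q -> N}) : {ffun 'I_q -> Q} := [ffun i => pi (v i)].
have pql : linear pq by move=> b u v; apply/ffunP => i; rewrite !ffunE linearP.
pose Z (w : {ffun 'I_q -> N}) : Prop := coordp K (mx_act N D w).
have hZ : submod Z by apply: (submod_preim (mx_act N D) (W := coordp K)); apply: submod_coordp.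
have DpqE w : mx_act Q D (pq w) = [ffun i => pi (mx_act N D w i)] by exact: mx_act_map.
have ZE w : Z w <-> mx_act Q D (pq w) = 0.
  rewrite DpqE; split=> [Zw|e i]; first by apply/ffunP => i; rewrite ffunE [RHS]ffunE; apply/piK.
  by apply/piK; have := congr1 (fun f : {ffun _} => f i) e; rewrite ffunE => ->; rewrite ffunE.
have pqs v : exists w, pq w = v.
  have [s hs] := choice (fun i => pis (v i)).
  by exists [ffun i => s i]; apply/ffunP => i; rewrite !ffunE.
have -> : (fun v => mx_act Q D v = 0) =
    sump (imgp (mklinear pql) Z) (imgp (mx_act Q B) (fullp (T := {ffun 'I_p -> Q}))).
  apply: pred_ext => v; split.
    have [w <-] := pqs v => /ZE Zw; apply: sumpl; first exact: submod_img.
    by exists w.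
  case=> _ [_ [[w /ZE Zw <-] [y _ <-] ->]]; rewrite linearD /= Zw.
  by rewrite -mx_actM BD mx_act0 addr0.
rewrite len_corr //; last exact: submod_img.
have -> : capp (imgp (mx_act N D) (fullp (T := {ffun 'I_q -> N}))) (coordp K) =
    sump (imgp (mx_act N D) Z) (imgp (mx_act N D) (coordp K)).
  apply: pred_ext => v; split=> [[[w _ <-] Kw]|].
    by apply: sumpl; [apply: submod_img; apply: submod_coordp|exists w].
  apply: sump_sub.
  - by apply: submod_cap; [apply: submod_img|apply: submod_coordp].
  - by move=> _ [w Zw <-]; split=> //; exists w.
  - move=> _ [w Kw <-]; split; first by exists w.
    exact: mx_act_coordp.
rewrite len_corr //; last by apply: submod_img; apply: submod_coordp.
suff -> : preimp (mklinear pql) Z (imgp (mx_act Q B) (fullp (T := {ffun 'I_p -> Q}))) =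
  preimp (mx_act N D) Z (imgp (mx_act N D) (coordp K)) by [].
apply: pred_ext => w; split=> -[Zw].
  case=> y' _ e; split=> //.
  have [s hs] := choice (fun i => pis (y' i)).
  pose y : {ffun 'I_p -> N} := [ffun i => s i].
  have yE : y' = [ffun i => pi (y i)] by apply/ffunP => i; rewrite !ffunE.
  exists (w - mx_act N B y).
    move=> i; apply/piK.
    have -> : (w - mx_act N B y) i = w i - mx_act N B y i by rewrite !ffunE.
    have h : pi (mx_act N B y i) = pi (w i).
      by have := congr1 (fun f : {ffun _} => f i) e; rewrite yE mx_act_map /= ffunE => ->; rewrite ffunE.
    by rewrite linearB h subrr.
  by rewrite linearB /= -mx_actM BD mx_act0 subr0.
case=> k Kk e; split=> //.
have [|y yE] := ex (w := w - k); first by rewrite linearB /= e subrr.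
exists [ffun i => pi (y i)] => //; rewrite mx_act_map /= yE.
apply/ffunP => i; rewrite !ffunE linearB /=.
by have /piK -> := Kk i; rewrite subr0.
Qed.

End Act.
End HomologyLength.

(** * The degree of the length polynomial *)

Section Core.
Variables (A : comNzRingType) (nA : noetherian A) (m : {pred A}) (lm : is_local m).
Variables (a : seq A) (am : forall x, x \in a -> x \in m).
Hypothesis ma : forall x, x \in m -> mulp a (fullp (T := A^o)) x.

Lemma exp_mulE (N : lmodType A) n v :
  v \in exp_mul N m n <-> mpow a n (fullp (T := N)) v.
Proof.
have hf k : submod (mpow a k (fullp (T := N))) by exact: submod_mpow.
split.
  rewrite inE => /asboolP[s hs ->]; elim: s hs => [|[z w] s IH] hs.
    by rewrite big_nil; apply: submod0.
  rewrite big_cons; apply: submodD => //; last by apply: IH => y ys; apply: hs; rewrite inE ys orbT.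
  have [/= hz _] := hs _ (mem_head _ _).
  elim: n z w hz {IH hs} => [|n IH] z w //=.
  rewrite inE => /asboolP[r hr ->]; rewrite scaler_suml.
  rewrite big_seq; apply: submod_sum => [|y yr]; first exact: submod_gen.
  have [y1 y2] := hr _ yr; rewrite -[y.1 *: y.2]/(y.1 * y.2) -scalerA.
  apply: (max_mulp ma) => //.
  exact: IH.
elim: n v => [|n IH] v /=.
  move=> _; rewrite inE; apply/asboolP; exists [:: (1, v)]; last by rewrite big_seq1 scale1r.
  by move=> z; rewrite inE => /eqP ->.
move: v; apply: (mulp_sub (W := fun v => v \in exp_mul N m n.+1)).
  exact/submod_pred/exp_mul_closed.
move=> x u xa /IH; rewrite !inE => /asboolP[s hs ->]; apply/asboolP.
exists [seq (x * z.1, z.2) | z <- s].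
  move=> _ /mapP[z /hs[z1 z2] ->]; split=> //=.
  rewrite inE; apply/asboolP; exists [:: (x, z.1)]; last by rewrite big_seq1.
  by move=> y; rewrite inE => /eqP -> /=; split=> //; apply: am.
rewrite big_map scaler_sumr; apply: eq_bigr => z _ /=; by rewrite scalerA.
Qed.

Variables (N : lmodType A) (fN : fg N).

Section Quos.
Variables (G : lmodType A) (X : G -> Prop) (hX : submod X).

Lemma sump_quoX xs (Y : G -> Prop) x :
  sump (mulp xs X) (quoX X Y x) = sump (mulp (x :: xs) X) Y.
Proof.
apply: pred_ext => v; split.
  move=> [p [_ [Pp [_ [q [[u Xu ->] Yq ->]]] ->]]]; exists (x *: u + p), q.
  split=> //; last by rewrite addrCA addrA.
  by exists u, p.
move=> [_ [q [[u [p [Xu Pp ->]]] Yq ->]]]; exists p, (x *: u + q); split=> //.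
  by exists (x *: u), q; split=> //; exists u.
by rewrite addrCA addrA.
Qed.

Lemma quosXE xs (Y : G -> Prop) : quosX X Y xs = sump (mulp xs X) Y.
Proof.
elim: xs Y => [|x xs IH] Y /=; last by rewrite IH sump_quoX.
apply: pred_ext => v; split=> [Yv|[_ [q [-> Yq ->]]]]; last by rewrite add0r.
by exists 0, v; rewrite add0r.
Qed.

Lemma regpE xs (Y : G -> Prop) :
  (forall k, (k < size xs)%N -> forall v, X v ->
     sump (mulp (take k xs) X) Y (xs`_k *: v) -> sump (mulp (take k xs) X) Y v) ->
  (exists2 v, X v & ~ sump (mulp xs X) Y v) -> regp X Y xs.
Proof.
have S0 (Y' : G -> Prop) : sump (mulp [::] X) Y' = Y' by rewrite -quosXE.
elim: xs Y => [|x xs IH] Y hk /=; first by move=> [v Xv]; rewrite (S0 Y); exists v.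
move=> ne; split.
  by move=> v Xv; have := hk 0%N isT v Xv; rewrite /= (S0 Y).
apply: IH; last by move: ne => [v Xv]; rewrite -sump_quoX; exists v.
by move=> k kx v Xv; rewrite sump_quoX; apply: (hk k.+1).
Qed.

End Quos.

Variables (xs : seq A) (xsm : forall x, x \in xs -> x \in m).
Let J k : N -> Prop := mulp (take k xs) (fullp (T := N)).
Hypothesis hreg : forall k, (k < size xs)%N -> forall v, J k (xs`_k *: v) -> J k v.
(** Equivalently, [N / (xs) N] has finite length: no prime other than [m] contains its
    annihilator. *)
Hypothesis hprim : forall P, primep P ->
  (forall b, (forall v, mulp xs (fullp (T := N)) (b *: v)) -> P b) -> forall x, x \in m -> P x.
Hypothesis N0 : exists v : N, v <> 0.
Variables (p q r : nat) (B : 'M[A]_(p, q)) (D : 'M[A]_(q, r)).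
Hypothesis BD : B *m D = 0.
(** Exactness with coefficients in [N / J k], written with representatives in [N]; [k = 0] is
    exactness over [N] itself. *)
Hypothesis hex : forall k, (k <= size xs)%N -> forall w,
  coordp (J k) (mx_act N D w) -> exists y, coordp (J k) (w - mx_act N B y).
(** Such an [E] exists precisely when the image of [D] is a direct summand; non-freeness of [M]
    enters in this form. *)
Hypothesis hD : ~ exists E, D = D *m E *m D.

Let G := {ffun 'I_r -> N}.
Let V := {ffun 'I_q -> N}.
Let nN : noeth N. Proof. exact: fg_noeth. Qed.
Let nG : noeth G. Proof. exact/(fg_noeth nA)/fg_ffun. Qed.
Let X : G -> Prop := imgp (mx_act N D) (fullp (T := V)).
Let hX : submod X. Proof. exact: submod_img. Qed.
Let full : G -> Prop := fullp (T := G).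
Let null : G -> Prop := nullp (V := G).

Lemma exact0 w : mx_act N D w = 0 -> exists y, mx_act N B y = w.
Proof.
move=> e; have [|y hy] := hex (k := 0%N) (w := w) (leq0n _).
  by move=> i; rewrite e ffunE /J take0.
exists y; apply/ffunP => i; have := hy i; rewrite /J take0 /= !ffunE => /eqP.
by rewrite subr_eq0 => /eqP.
Qed.

Let U n : G -> Prop := capp X (mpow a n full).
Let W n : G -> Prop := mpow a n X.

Let hU n : submod (U n).
Proof. by apply: submod_cap => //; apply: submod_mpow. Qed.
Let hW n : submod (W n). Proof. exact: submod_mpow. Qed.
Let WU n : subp (W n) (U n).
Proof. by move=> v Wv; split; [apply: mpow_sub Wv|apply: mpow_mono Wv]. Qed.
Let sU : stable a U.
Proof.
move=> x xa n v [Xv hv]; split; first exact: submodZ.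
by apply: (mpow_stable ma) => //; apply: am.
Qed.
Let sW : stable a W.
Proof. by move=> x xa n v; apply: (mpow_stable ma) => //; apply: am. Qed.
Let fU n : finlen (W n) (U n).
Proof. by apply: (fin_sub _ _ _ (fin_mpow nA lm ma nG n hX)) => // v []. Qed.

Let gU : evgen a U (fun=> null).
Proof.
apply: (evgen_sub nG (U := fun n => mpow a n full)) => //.
- by move=> n; apply: submod_mpow.
- by move=> n; apply: submod_null.
- by move=> n v ->; apply: submod0.
- by move=> n v [].
- by move=> x xa n v; apply: (mpow_stable ma) => //; apply: am.
- by move=> x xa n v ->; apply: scaler0.
- by exists 0%N => n _; rewrite sump_null.
Qed.

Definition hlen n := lam (W n) (U n).

Lemma hlen_poly : evpoly (fun n => (hlen n)%:R).
Proof.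
apply: (hilbert_poly nG (a := a)) => //.
have [n0 hn] := gU; exists n0 => n /hn s v /s; rewrite sump_null => gv.
exact: (sumpl (hW n.+1) gv).
Qed.

Lemma artin_rees : exists e, forall n, subp (U (n + e)) (W n).
Proof.
have [e he] := gU; exists e => n; elim: n => [|n IH]; first by move=> v [].
move=> v; rewrite addSn => /(he _ (leq_addl _ _)); rewrite sump_null /=.
exact: mulp_mono.
Qed.

Let xchi n := lam (W n) X.

Let xchiE n : chi a X null n = xchi n.
Proof. by rewrite /chi sump_null. Qed.

Lemma xchi_le : exists C, forall n, (xchi n <= C * n.+1 ^ size xs)%N.
Proof.
have [|||C hC] := @chi_le A nA m lm a ma G nG X hX xs xsm null.
- exact: submod_null.
- by move=> v ->; apply: submod0.
- rewrite quosXE sump_null.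
  apply: (@fin_of_primes A nA m lm G nG X _
    (fun b => forall v : N, mulp xs (fullp (T := N)) (b *: v))) => //.
  + exact: submod_gen.
  + exact: mulp_subU.
  + move=> b _ hb [w _ <-]; rewrite -linearZ -imgp_mulp -coordp_full coordp_mulp.
    by exists (b *: w) => // i; rewrite ffunE.
- by exists C => n; rewrite -xchiE.
Qed.

(** [U (n + e)] lies between [W (n + e)] and [W n], and the length of [W n / W (n + e)] is a
    difference of values of [xchi]. *)
Let hlen_diff e n : (forall k, subp (U (k + e)) (W k)) -> (hlen (n + e) + xchi n <= xchi (n + e))%N.
Proof.
move=> he.
have WW : subp (W (n + e)) (W n) by apply: mpow_leq; rewrite // leq_addr.
rewrite /xchi (lam_add (hW (n + e)) (hW n) hX WW) //; last first.
- exact: (fin_mpow nA lm ma nG).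
- exact: mpow_sub.
rewrite leq_add2r; apply: lam_mono => //; apply: (fin_sub _ WW _ (fin_mpow nA lm ma nG (n + e) hX)) => //.
exact: mpow_sub.
Qed.

Lemma sum_hlen_le : exists C, forall K, (\sum_(n < K) hlen n <= C * K.+1 ^ size xs)%N.
Proof.
have [e he] := artin_rees; have [C hC] := xchi_le.
have tel K : (\sum_(n < K) hlen (n + e) + \sum_(j < e) xchi j <= \sum_(j < e) xchi (K + j))%N.
  elim: K => [|K IH]; first by rewrite big_ord0 add0n; apply: leq_sum => j _; rewrite add0n.
  rewrite big_ord_recr /=.
  have s1 : (\sum_(j < e) xchi (K + j) + xchi (K + e) = xchi K + \sum_(j < e) xchi (K.+1 + j))%N.
    have <- : (\sum_(j < e.+1) xchi (K + j) = \sum_(j < e) xchi (K + j) + xchi (K + e))%N.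
      by rewrite big_ord_recr.
    rewrite big_ord_recl addn0; congr (_ + _)%N; apply: eq_bigr => j _.
    by rewrite /bump /= addnS.
  have hd := hlen_diff K he; rewrite -(leq_add2l (xchi K)) -s1.
  apply: leq_trans (leq_add IH hd).
  by have aux x y z u : (u + (x + y + z) <= x + z + (y + u))%N by lia.
pose C1 := \sum_(n < e) hlen n.
(* [C1] pays for the [e] terms before Artin-Rees applies. The rest telescopes with step [e] to [e]
   values of [xchi], and [(K + e).+1] is at most [e.+1 * K.+1]. *)
exists (C1 + e * (C * (e.+1) ^ size xs))%N => K.
apply: (@leq_trans (\sum_(n < K + e) hlen n)).
  by rewrite big_split_ord /= leq_addr.
rewrite addnC big_split_ord /= mulnDl; apply: leq_add.
  by rewrite leq_pmulr // expn_gt0.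
apply: (@leq_trans (\sum_(j < e) xchi (K + j))).
  apply: leq_trans (tel K); rewrite -[X in (X <= _)%N]addn0; apply: leq_add => //.
  by apply: leq_sum => n _; rewrite addnC.
apply: (@leq_trans (\sum_(j < e) C * (K + e).+1 ^ size xs)).
  apply: leq_sum => j _; apply: leq_trans (hC _) _; rewrite leq_mul2l; apply/orP; right.
  by apply: leq_expW; have := ltn_ord j; lia.
rewrite sum_nat_const card_ord -mulnA leq_mul2l; apply/orP; right.
rewrite -mulnA leq_mul2l -expnMn; apply/orP; right; apply: leq_expW; nia.
Qed.

(* D0 = D - D E D has entries in m, so X0 = im D0 satisfies m^n X0 <= m^(n+1) G;
   [B; D E] maps onto ker D0. *)
Lemma sum_hlen_ge : exists c E, (0 < E)%N /\
  forall k, (0 < k)%N -> (k ^ size xs <= c * \sum_(n < (E * k).+1) hlen n)%N.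
Proof.
have [E [EDE hE]] := inner_inverse nA lm D.
pose kap := 1%:M - D *m E.
pose D0 := D - D *m E *m D.
have kD : kap *m D = D0 by rewrite mulmxBl mul1mx.
have DEDE : D *m E *m D *m E = D *m E by rewrite -!mulmxA (mulmxA E) EDE.
have DED0 : D *m E *m D0 = 0 by rewrite mulmxBr !mulmxA DEDE subrr.
have D0ED : D0 *m (E *m D) = 0 by rewrite mulmxBl !mulmxA DEDE subrr.
have Bk : B *m kap = B by rewrite mulmxBr mulmx1 mulmxA BD mul0mx subr0.
pose B0 := col_mx B (D *m E).
have B0D0 : B0 *m D0 = 0 by rewrite mul_col_mx DED0 -kD mulmxA Bk BD col_mx0.
pose X0 : G -> Prop := imgp (mx_act N D0) (fullp (T := V)).
have hX0 : submod X0 by exact: submod_img.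
have actk w : mx_act N D0 w = mx_act N D (mx_act N kap w) by rewrite -kD mx_actM.
have hJ k : submod (J k) by exact: submod_gen.
(* Since [w] is the sum of [kap w] and [(D *m E) w], and [D0 w] is [D] applied to [kap w], exactness
   of [B], [D] modulo [J k] yields that of [B0], [D0]. *)
have ex0 k : (k <= size xs)%N -> forall w,
  coordp (J k) (mx_act N D0 w) -> exists y, coordp (J k) (w - mx_act N B0 y).
  move=> kx w; rewrite actk => /(hex kx)[y hy].
  have [z zE] := mx_act_col B (D *m E) y w.
  exists z; rewrite zE opprD addrCA addrC.
  by move: hy; rewrite /kap mx_actB mx_act1.
(* If [X0] were zero, [B0] would be onto over [N], hence have a left inverse [R]; then
   [D0 = R *m B0 *m D0 = 0], contrary to [hD]. *)
have hx0 : exists2 v, X0 v & v <> 0.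
  apply: contrapT => h0.
  have z0 w : mx_act N D0 w = 0.
    by apply: contrapT => nz; apply: h0; exists (mx_act N D0 w) => //; exists w.
  have [w|R hR] := surj_split nA lm am ma (B := B0) nN N0.
    have [|y hy] := ex0 0%N (leq0n _) w.
      by move=> i; rewrite z0 ffunE /J take0.
    exists y; apply/ffunP => i; have := hy i; rewrite /J take0 /= !ffunE => /eqP.
    by rewrite subr_eq0 => /eqP.
  apply: hD; exists E; apply/eqP; rewrite -subr_eq0 -/D0.
  by rewrite -[D0]mul1mx -hR -mulmxA B0D0 mulmx0.
have J0 k : mulp (take k xs) X0 = imgp (mx_act N D0) (coordp (J k)).
  by rewrite /J -coordp_mulp coordp_full imgp_mulp.
have J0s k v : mulp (take k xs) X0 v -> coordp (J k) v.
  by rewrite J0 => -[w Jw <-]; apply: mx_act_coordp.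
(* Regularity on [N] puts [D0 w] into [J k] coordinatewise, and exactness modulo [J k] changes [w]
   by an element of [im B0] into one with coordinates in [J k], so that [D0 w] lies in (x_1, ...,
   x_k) X0. *)
have reg0 : regp X0 null xs.
  apply: regpE => //.
    move=> k kx _ [w _ <-]; rewrite !sump_null => /J0s Jw.
    have /(ex0 k (ltnW kx))[y hy] : coordp (J k) (mx_act N D0 w).
      by move=> i; apply: hreg => //; have := Jw i; rewrite ffunE.
    rewrite J0; exists (w - mx_act N B0 y) => //.
    by rewrite linearB /= -mx_actM B0D0 mx_act0 subr0.
  rewrite sump_null; apply: contrapT => h0; case: hx0 => v Xv; apply.
  have [s hs] := nG hX0.
  apply: (@nakayama A nA m lm G X0 null xs s) => //.
  - exact: submod_null.
  - by move=> u ->; apply: submod0.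
  - by rewrite hs => x; apply: mem_spanp.
  - by rewrite -hs => u Xu; exists 0, u; rewrite add0r.
  - move=> u Xu; exists 0, u; rewrite add0r; split=> //.
    by apply: contrapT => nu; apply: h0; exists u.
have null0 : subp null X0 by move=> u ->; apply: submod0.
have [c [E1 [E10 hc]]] := chi_ge nA lm am ma nG hX0 xsm (submod_null G) null0 reg0.
exists c, E1; split=> // k k0; apply: leq_trans (hc k k0) _; rewrite leq_mul2l; apply/orP; right.
move: (E1 * k)%N => K {hc}.
have X0X : subp X0 X by move=> _ [w _ <-]; rewrite actk; exists (mx_act N kap w).
have X0m n : subp (mpow a n X0) (mpow a n.+1 full).
  rewrite -[n.+1]addn1 mpow_add; apply: mpow_mono => _ [w _ <-] /=.
  rewrite /full -coordp_full coordp_mulp => i; rewrite ffunE.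
  apply: submod_sum => [|j _]; first exact: submod_gen.
  by apply: (max_mulp ma) => //; apply: hE.
(* The map [1 - E *m D] fixes [X0] because [D0 *m (E *m D) = 0], and carries [D w] to [D0 w].
   Applied to [v = D w] with [w] in m^(n+1) V it returns [v] as an element of m^(n+1) X0. *)
have X0W n v : mpow a n X0 v -> W n.+1 v -> mpow a n.+1 X0 v.
  move=> hv.
  have [w0 hw0 e0] : imgp (mx_act N D0) (fullp (T := V)) v by apply: mpow_sub hv.
  have imgpow (M : 'M[A]_(q, r)) k' : mpow a k' (imgp (mx_act N M) (fullp (T := V))) =
      imgp (mx_act N M) (mpow a k' (fullp (T := V))).
    by elim: k' => //= k' ->; rewrite imgp_mulp.
  rewrite /W /X /X0 !imgpow => -[w hw e]; exists w => //.
  have vE : mx_act N (E *m D) v = 0.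
    by rewrite -e0 -mx_actM D0ED mx_act0.
  rewrite /D0 -mulmxA mx_actB [mx_act N (D *m _) w]mx_actM e vE.
  by rewrite subr0.
have fX0 n : finlen (mpow a n X0) X0 by exact: (fin_mpow nA lm ma nG).
have step n : (chi a X0 null n + lam (mpow a n.+1 X0) (mpow a n X0) = chi a X0 null n.+1)%N.
  rewrite /chi !sump_null addnC -lam_add //; try exact: submod_mpow.
  - exact: mpow_leq.
  - exact: mpow_sub.
have hge n : (lam (mpow a n.+1 X0) (mpow a n X0) <= hlen n.+1)%N.
  pose C := sump (imgp (idfun : {linear G -> G}) (mpow a n X0)) (W n.+1).
  have CE : C = sump (mpow a n X0) (W n.+1).
    by congr sump; apply: pred_ext => v; split=> [[u hu <-]|hv] //; exists v.
  have CU : subp C (U n.+1).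
    rewrite CE; apply: sump_sub => // v hv; split; last exact: X0m.
    by apply: X0X; apply: mpow_sub hv.
  have WC : subp (W n.+1) C by rewrite CE; apply: sumpr; apply: submod_mpow.
  apply: (@leq_trans (lam (W n.+1) C)); last by apply: lam_mono.
  have f0 : finlen (W n.+1) C by apply: (fin_sub _ WC CU (fU n.+1)).
  have f1 := iffLR (fin_corr _ (submod_mpow a n hX0) (hW n.+1)) f0.
  rewrite /C lam_corr //; last by apply: submod_mpow.
  apply: lam_mono => //; last exact: mpow_leq.
  by move=> v [hv Wv]; apply: X0W.
have sum_ge j : (chi a X0 null j <= \sum_(n < j) hlen n.+1)%N.
  elim: j => [|j IH]; first by rewrite chi0 //; apply: submod_null.
  by rewrite big_ord_recr /= -step leq_add.
rewrite big_ord_recl; apply: leq_trans (sum_ge K) _; exact: leq_addl.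
Qed.

Theorem core_length_degree : (0 < size xs)%N ->
  length_degree (fun n => homology (mx_act (quot_exp N m n) B) (mx_act (quot_exp N m n) D))
    ((size xs)%:Z - 1).
Proof.
move=> t0; have [P [n0 hP]] := hlen_poly.
exists P; last by rewrite (size_of_growth hP sum_hlen_le sum_hlen_ge t0).
exists n0 => n nn; exists (hlen n); last by rewrite -hP.
have [pi [pis pik]] := quotmod_pi (exp_mul N m n : submodClosed N).
have pik' v : pi v = 0 <-> mpow a n (fullp (T := N)) v by rewrite pik exp_mulE.
apply/(act_homology_length pis pik' BD exact0).
rewrite -!coordp_mpow !coordp_full.
have -> : imgp (mx_act N D) (mpow a n (fullp (T := V))) = W n.
  rewrite /W /X; elim: n {nn pi pis pik pik'} => //= n <-; exact: imgp_mulp.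
exact: lamP.
Qed.

End Core.

(** * Vanishing of Ext and Tor *)

Lemma mulp_rcons (A : comNzRingType) (V : lmodType A) (U : V -> Prop) xs x v :
  mulp (rcons xs x) U v <-> exists w u, [/\ mulp xs U w, U u & v = w + x *: u].
Proof.
elim: xs v => [|y xs IH] v /=.
  split=> [[u [_ [Uu -> ->]]]|[_ [u [-> Uu ->]]]]; first by exists 0, u; rewrite addrC.
  by exists u, 0; rewrite addrC.
split=> [[u [_ [Uu /IH[w [u' [gw Uu' ->]]] ->]]]|[_ [u [[u' [w [Uu' gw ->]]] Uu ->]]]].
  by exists (y *: u + w), u'; rewrite addrA; split=> //; exists u, w.
by exists u', (w + x *: u); rewrite addrA; split=> //; apply/IH; exists w, u.
Qed.

Section FreeCover.
Import freeg.

(* A projective module is a retract of a free one, so a map from a finitely generated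
   module to it factors through finitely many coordinates. *)
Lemma projective_coordinates (A : comNzRingType) (P S : lmodType A) (f : {linear S -> P}) :
  projective P -> fg S -> exists (T : seq P) (c : P -> {linear S -> A^o}),
    forall v, f v = \sum_(x <- T) (c x v : A) *: x.
Proof.
move=> pP [n [q qs]].
pose F : lmodType A := {freeg P / A}.
pose ev (D : F) : P := fglift (fun x : P => x) D.
pose evA : {additive F -> P} := HB.pack ev (GRing.isZmodMorphism.Build F P ev (lift_is_additive _)).
have evE (D : F) : ev D = \sum_(x <- dom D) coeff x D *: x.
  rewrite -{1}[D]freeg_sumE -[ev _]/(evA _) raddf_sum.
  by apply: eq_bigr => x _; rewrite /= /ev liftU.
have evT (D : F) (T : seq P) : uniq T -> {subset dom D <= T} ->
    ev D = \sum_(x <- T) coeff x D *: x.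
  move=> uT DT; rewrite evE [RHS](bigID (mem (dom D))) /= addrC.
  rewrite [X in _ = X + _]big1 ?add0r => [|x xD]; last by rewrite coeff_outdom // scale0r.
  rewrite -[RHS]big_filter; apply: perm_big; apply: uniq_perm; rewrite ?uniq_dom ?filter_uniq //.
  move=> x; rewrite mem_filter; apply/idP/andP => [xD|[]//]; by split=> //; apply: DT.
have evl : linear ev.
  move=> a u v; rewrite -[ev _]/(evA _) raddfD /=; congr (_ + _).
  rewrite -[a *: u]/(fgscale a u) /fgscale -[ev _]/(evA _) raddf_sum [ev u]evE scaler_sumr.
  by apply: eq_bigr => x _; rewrite /= /ev liftU scalerA.
have [|h hh] := pP F P (mklinear evl) (idfun : {linear P -> P}).
  by move=> x; exists << x >>; rewrite /= /ev liftU scale1r.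
have cl (x : P) : linear (fun v : S => coeff x (h (f v)) : A^o).
  by move=> a u v; rewrite !linearP coeffD coeffZ.
(* [T] collects the finite supports of the images of the [n] generators of [S]; a coordinate outside
   [T] vanishes on the generators, hence on all of [S]. *)
pose T := undup (flatten [seq dom (h (f (q (delta_mx 0 i)))) | i <- enum 'I_n]).
exists T, (fun x => mklinear (cl x)) => v /=.
apply: (@etrans _ _ (ev (h (f v)))); first by rewrite -[ev _]/(mklinear evl _) hh.
apply: evT; first exact: undup_uniq.
move=> x; apply: contraTT => xT; rewrite mem_dom negbK; apply/eqP.
rewrite -[LHS]/(mklinear (cl x) v); have [y <-] := qs v.
rewrite [y]row_sum_delta !linear_sum big1 // => i _; rewrite !linearZ /=.
rewrite coeff_outdom ?scaler0 //; apply: contra xT => xi; rewrite mem_undup.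
apply/flattenP; exists (dom (h (f (q (delta_mx 0 i))))) => //.
by apply/mapP; exists i; rewrite ?mem_enum.
Qed.
End FreeCover.

Definition rmul (A : comNzRingType) p q (D : 'M[A]_(p, q)) : {linear 'rV[A]_p -> 'rV[A]_q} :=
  mulmxr D.

(** * Ext into the ring, from a fixed injective resolution *)

Section Ext.
Variables (A : comNzRingType) (nA : noetherian A) (m : {pred A}) (lm : is_local m).
Variables (I : nat -> lmodType A) (d : forall j, {linear I j -> I j.+1}).
Variable e : {linear A^o -> I 0}.
Hypothesis Iinj : forall j, injective_mod (I j).
Hypothesis einj : injective e.
Hypothesis e_exact : exact_at e (d 0).
Hypothesis d_exact : forall j, exact_at (d j) (d j.+1).
Variable n0 : nat.
Hypothesis I0 : forall j, (n0 < j)%N -> forall u : I j, u = 0.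

(* Ext^(j+1)(L, A) = 0, computed from the injective resolution I of A *)
Definition ext0 (j : nat) (L : lmodType A) : Prop :=
  forall f : {linear L -> I j.+1}, (forall v, d j.+1 (f v) = 0) ->
    exists g : {linear L -> I j}, forall v, d j (g v) = f v.

Lemma d_comp0 j x : d j.+1 (d j x) = 0.
Proof. by apply/d_exact; exists x. Qed.

Section ShortExact.
Variables (L' L L'' : lmodType A) (i : {linear L' -> L}) (p : {linear L -> L''}).
Hypotheses (ii : injective i) (ps : forall c, exists v, p v = c) (ip : exact_at i p).

Lemma exact_comp0 x : p (i x) = 0. Proof. by apply/ip; exists x. Qed.

Lemma extend j (f : {linear L' -> I j}) : exists h : {linear L -> I j}, forall u, h (i u) = f u.
Proof. exact: Iinj. Qed.

Lemma factor_exact (X : lmodType A) (f : {linear L -> X}) : (forall u, f (i u) = 0) ->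
  exists h : {linear L'' -> X}, forall v, h (p v) = f v.
Proof. by move=> fi; apply: factor_surj => // v /ip[u <-]. Qed.

(** This lemma and the next two are the long exact Ext sequence, as statements about vanishing. Each
    extends a cochain from [L'] to [L] by injectivity and lets what vanishes on [L'] factor through
    [L'']; the index shift in the other two is that of the connecting map. *)
Lemma ext0_mid j : ext0 j L' -> ext0 j L'' -> ext0 j L.
Proof.
move=> h1 h2 f df; have [|g' hg'] := h1 (f \o i); first by move=> v; apply: df.
have [g hg] := extend g'.
have [|h hh] := @factor_exact _ (f \- (d j \o g)).
  by move=> u /=; rewrite hg hg' /= subrr.
have [|k hk] := h2 h.
  by move=> c; have [v <-] := ps c; rewrite hh /= linearB /= df d_comp0 subr0.
by exists (g \+ (k \o p)) => v; rewrite /= linearD /= hk hh /= addrC subrK.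
Qed.

Lemma ext0_left j : ext0 j.+1 L'' -> ext0 j L -> ext0 j L'.
Proof.
move=> h1 h2 f' df'; have [f hf] := extend f'.
have [|h hh] := @factor_exact _ (d j.+1 \o f); first by move=> u /=; rewrite hf.
have [|k hk] := h1 h; first by move=> c; have [v <-] := ps c; rewrite hh d_comp0.
have [|g hg] := h2 (f \- (k \o p)); first by move=> v; rewrite /= linearB /= hk hh subrr.
by exists (g \o i) => v; rewrite /= hg /= exact_comp0 linear0 subr0.
Qed.

Lemma ext0_right j : ext0 j.+1 L -> ext0 j L' -> ext0 j.+1 L''.
Proof.
move=> h1 h2 h dh; have [|f hf] := h1 (h \o p); first by move=> v /=; rewrite dh.
have [|g' hg'] := h2 (f \o i); first by move=> u; rewrite /= hf /= exact_comp0 linear0.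
have [g hg] := extend g'.
have [|k hk] := @factor_exact _ (f \- (d j \o g)).
  by move=> u /=; rewrite hg hg' /= subrr.
exists k => c; have [v <-] := ps c.
by rewrite hk /= linearB /= hf d_comp0 subr0.
Qed.

End ShortExact.

Lemma projective_rV n : projective 'rV[A]_n.
Proof. by move=> U W g f gs; apply: free_lift. Qed.

Lemma projective_regular : projective A^o.
Proof.
move=> U W g f gs; have [s hs] := gs (f 1).
have hl : linear (fun c : A^o => c *: s) by move=> b x y; rewrite scalerDl -scalerA.
exists (mklinear hl) => v /=; rewrite linearZ /= hs -linearZ; congr (f _); exact: mulr1.
Qed.

Lemma projective_ext0 (L : lmodType A) j : projective L -> ext0 j L.
Proof.
move=> pL f df; have [K [k [ki kP]]] := sub_exists (submod_ker (d j.+1)).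
have [|f' hf'] := factor_inj (f := f) ki; first by move=> v; apply/kP.
have [|d' hd'] := factor_inj (f := d j) ki; first by move=> v; apply/kP/d_comp0.
have [|h hh] := pL _ _ d' f'.
  move=> w; have : d j.+1 (k w) = 0 by apply/kP; exists w.
  by move=> /d_exact[u hu]; exists u; apply: ki; rewrite hd'.
by exists h => v; rewrite -hd' hh hf'.
Qed.

Lemma ext0_trivial j (L : lmodType A) : (forall v : L, v = 0) -> ext0 j L.
Proof.
move=> h0 f _; exists (\0 : {linear L -> I j}) => v.
by rewrite (h0 v) !linear0.
Qed.

Lemma ext0_large j (L : lmodType A) : (n0 <= j)%N -> ext0 j L.
Proof.
move=> nj f _; exists (\0 : {linear L -> I j}) => v.
by rewrite linear0 [RHS](I0 (j := j.+1)).
Qed.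

Lemma ext0_iso j (L L'' : lmodType A) (p : {linear L -> L''}) : injective p -> (forall c, exists v, p v = c) ->
  ext0 j L -> ext0 j L''.
Proof.
move=> pinj ps h f df; have [|g hg] := h (f \o p); first by move=> v; apply: df.
have [|k hk] := factor_surj (f := g) ps.
  by move=> v /eqP; rewrite -(linear0 p) => /eqP/pinj ->; rewrite linear0.
by exists k => c; have [v <-] := ps c; rewrite hk hg.
Qed.

(** Linearity is a condition on plain functions, so that cocycles and coboundaries are submodules of
    the module of all functions [L -> I j], where [nakayama] and [spanp] apply. *)
Definition cocycle j (L : lmodType A) (f : L -> I j) : Prop :=
  linear f /\ forall v, d j (f v) = 0.

(** With zero coboundaries in degree 0 the quotient is Ext^j(L, A) in every degree; [ext0 j] is thus
    about degree [j.+1] here. *)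
Definition coboundary j (L : lmodType A) : (L -> I j) -> Prop :=
  match j with
  | 0 => fun f => f = 0
  | j'.+1 => fun f => exists g : {linear L -> I j'}, forall v, d j' (g v) = f v
  end.

Lemma submod_cocycle j (L : lmodType A) : submod (@cocycle j L).
Proof.
split.
  split; last by move=> v; rewrite linear0.
  by move=> a u v; rewrite scaler0 addr0.
move=> a f g [fl df] [gl dg]; split.
  move=> b u v; have := fl b u v; have := gl b u v.
  rewrite -[(a *: f + g) _]/(a *: f _ + g _) -![(a *: f + g) _]/(a *: f _ + g _) => -> ->.
  by rewrite !scalerDr !scalerA (mulrC a) addrACA.
by move=> v; rewrite -[(a *: f + g) v]/(a *: f v + g v) linearP df dg scaler0 addr0.
Qed.

Lemma submod_coboundary j (L : lmodType A) : submod (@coboundary j L).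
Proof.
case: j => [|j]; first exact: submod_null.
split; first by exists (\0 : {linear L -> I j}) => v; rewrite linear0.
move=> a f g [f' hf] [g' hg]; exists ((a \*: f') \+ g') => v.
by rewrite /= linearD linearZ /= hf hg.
Qed.

Lemma coboundary_cocycle j (L : lmodType A) : subp (@coboundary j L) (@cocycle j L).
Proof.
case: j => [|j] f; first by move=> ->; apply: (submod0 (submod_cocycle _ _)).
move=> [g hg]; split=> [a u v|v]; last by rewrite -hg d_comp0.
by rewrite -!hg !linearP.
Qed.

(** [R] stands for a linear map defined only up to choices, such as a connecting map on cocycles;
    generators are moved along it without making it a function. *)
Lemma span_transport (V V' : lmodType A) (R : V -> V' -> Prop) (C : V' -> Prop) s :
  R 0 0 -> (forall a x y x' y', R x x' -> R y y' -> R (a *: x + y) (a *: x' + y')) ->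
  (forall x, x \in s -> exists2 y, C y & R x y) ->
  exists s', (forall y, y \in s' -> C y) /\
    forall x, spanp s x -> exists2 y, spanp s' y & R x y.
Proof.
move=> R0 RP; elim: s => [|x s IH] hs.
  by exists [::]; split=> // _ ->; exists 0.
have [|s' [Cs' hs']] := IH; first by move=> z zs; apply: hs; rewrite inE zs orbT.
have [y Cy Rxy] := hs x (mem_head _ _).
exists (y :: s'); split.
  by move=> z; rewrite inE => /orP[/eqP ->|/Cs'].
move=> _ [c [w [/hs'[w' sw' Rw] ->]]]; exists (c *: y + w'); last exact: RP.
by exists c, w'.
Qed.

Definition ext_fg j (L : lmodType A) : Prop := exists s : seq (L -> I j),
  (forall f, f \in s -> cocycle f) /\ subp (@cocycle j L) (sump (@coboundary j L) (spanp s)).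

(** In degree 0 cocycles are maps into the kernel of [d 0], that is, into [A]. Their values on the
    [n] generators of [L] embed them in A^n, which is Noetherian. *)
Lemma ext_fg_base (L : lmodType A) : fg L -> ext_fg 0 L.
Proof.
move=> [n [q qs]].
pose R (u : 'rV[A]_n) (f : L -> I 0) := forall i, e (u 0 i) = f (q (delta_mx 0 i)).
have R0 : R 0 0 by move=> i; rewrite mxE linear0.
have RP a x y x' y' : R x x' -> R y y' -> R (a *: x + y) (a *: x' + y').
  by move=> h1 h2 i; rewrite !mxE -[(_ + _) (q _)]/(a *: x' _ + y' _) -h1 -h2 -linearP.
have hT : submod (fun u => exists2 f, cocycle f & R u f).
  split; first by exists 0 => //; apply: submod0; exact: submod_cocycle.
  move=> a x y [f cf Rf] [g cg Rg]; exists (a *: f + g); last exact: RP.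
  exact: (submod_cocycle _ _).2.
have [s hs] := fg_noeth nA (fg_rV A n) hT.
have [|s' [Cs' hs']] := @span_transport _ _ R (@cocycle 0 L) s R0 RP.
  by move=> x xs; have := mem_spanp xs; rewrite -hs.
exists s'; split=> // f cf.
have [u hu] : exists u, R u f.
  have [s1 h1] := choice (fun i => (e_exact (f (q (delta_mx 0 i)))).1 (cf.2 _)).
  by exists (\row_i s1 i) => i; rewrite mxE.
have [|g sg Rg] := hs' u; first by rewrite -hs; exists f.
suff -> : f = g by exists 0, g; rewrite add0r; split.
have cg : cocycle g by apply: spanp_sub sg => //; exact: submod_cocycle.
apply/funext => v; have [y <-] := qs v.
have eqf (k : {linear 'rV[A]_n -> I 0}) : k y = \sum_i y 0 i *: k (delta_mx 0 i).
  by rewrite {1}[y]row_sum_delta linear_sum; apply: eq_bigr => i _; rewrite linearZ.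
rewrite -[f _]/((mklinear cf.1 \o q) y) -[g _]/((mklinear cg.1 \o q) y) !eqf.
by apply: eq_bigr => i _ /=; rewrite -hu -Rg.
Qed.

(** A primitive of [w] extends to [P], and subtracting its coboundary makes [x'] vanish on [S]
    without changing [d x']. So the connecting relation sends coboundaries to coboundaries. *)
Lemma coboundary_vanish j (S P : lmodType A) (i : {linear S -> P}) (x' : {linear P -> I j})
  (w : S -> I j) : injective i -> (forall u, x' (i u) = w u) -> coboundary w ->
  exists x'' : {linear P -> I j},
      (forall u, x'' (i u) = 0) /\ forall v, d j (x'' v) = d j (x' v).
Proof.
case: j x' w => [|j] x' w ii hx' /=.
  by move=> w0; exists x'; split=> // u; rewrite hx' w0.
move=> [h hh]; have [h' hh'] := extend ii h.
exists (x' \- (d j \o h')); split=> u /=.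
  by rewrite hx' hh' hh subrr.
by rewrite linearB d_comp0 subr0.
Qed.

(** Dimension shifting: as Ext^(j+1)(P, A) = 0, the connecting map from Ext^j(S, A) to Ext^(j+1)(L,
    A) is onto. The relation [R] is this map on cocycles. *)
Lemma ext_fg_step j (S P L : lmodType A) (i : {linear S -> P}) (p : {linear P -> L}) :
  injective i -> (forall c, exists v, p v = c) -> exact_at i p -> projective P ->
  ext_fg j S -> ext_fg j.+1 L.
Proof.
move=> ii ps ip pP [s [cs hs]].
pose R (x : S -> I j) (y : L -> I j.+1) := exists x' : {linear P -> I j},
  (forall u, x' (i u) = x u) /\ forall v, y (p v) = d j (x' v).
have R0 : R 0 0 by exists (\0 : {linear P -> I j}); split=> // v; rewrite linear0.
have RP a x y x' y' : R x x' -> R y y' -> R (a *: x + y) (a *: x' + y').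
  move=> [f [h1 h2]] [g [h3 h4]]; exists ((a \*: f) \+ g); split=> [u|v] /=.
    by rewrite h1 h3.
  by rewrite linearD linearZ /= -h2 -h4.
have lin_of y x : R x y -> linear y.
  move=> [x' [_ h]] a u v; have [u' <-] := ps u; have [v' <-] := ps v.
  by rewrite -linearP !h !linearP.
have conn x : cocycle x -> exists2 y, cocycle y & R x y.
  move=> [xl dx]; have [x' hx'] := extend ii (mklinear xl).
  have [|h hh] := factor_exact ps ip (f := d j \o x').
    by move=> u /=; rewrite hx' /= dx.
  exists h; last by exists x'; split=> // v; rewrite hh.
  split; first by move=> a u v; rewrite linearP.
  by move=> c; have [v <-] := ps c; rewrite hh d_comp0.
have cobR w y : coboundary w -> R w y -> coboundary y.
  move=> cw [x' [h1 h2]].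
  have [x'' [h3 h4]] := coboundary_vanish ii h1 cw.
  have [u hu] := factor_exact ps ip h3.
  by exists u => c; have [v <-] := ps c; rewrite hu h4 h2.
have [|s' [cs' hs']] := @span_transport _ _ R (@cocycle j.+1 L) s R0 RP.
  by move=> x /cs/conn.
exists s'; split=> // y cy.
have [|x' hx'] := projective_ext0 (j := j) pP (f := mklinear cy.1 \o p).
  by move=> v; apply: cy.2.
have Rxy : R (x' \o i) y by exists x'; split.
have cx : cocycle (x' \o i).
  split; first by move=> a u v; rewrite linearP.
  by move=> v /=; rewrite hx' /= (exact_comp0 ip); have := linear0 (mklinear cy.1).
have [w [z [cw sz xE]]] := hs _ cx.
have [y' sy' Rz] := hs' z sz.
exists (y - y'), y'; split=> //; last by rewrite subrK.
apply: (cobR w) => //; have := RP (-1) z (x' \o i) y' y Rz Rxy.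
by rewrite xE !scaleN1r addrCA addNr addr0 addrC.
Qed.

Lemma ext_fg_all j (L : lmodType A) : fg L -> ext_fg j L.
Proof.
elim: j L => [|j IH] L fL; first exact: ext_fg_base.
have [n [q qs]] := fL.
have [S [i [ii fS ex]]] := fg_ker q (fg_noeth nA (fg_rV A n)).
by apply: (ext_fg_step ii qs ex (projective_rV (n := n))); apply: IH.
Qed.

(* A regular element y acts surjectively on Ext^(j+1)(L, A), which vanishes by Nakayama. *)
Lemma ext0_regular j (L L'' : lmodType A) (p : {linear L -> L''}) y : fg L -> y \in m ->
  (forall v : L, y *: v = 0 -> v = 0) -> (forall c, exists v, p v = c) ->
  (forall v, p v = 0 <-> exists u, y *: u = v) ->
  ext0 j.+1 L'' -> ext0 j L.
Proof.
move=> fL ym reg ps py h f df.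
have [s [cs hs]] := ext_fg_all j.+1 fL.
have yi : injective (y \*: idfun : {linear L -> L}).
  move=> u v /= /eqP; rewrite -subr_eq0 -scalerBr => /eqP/reg/eqP.
  by rewrite subr_eq0 => /eqP.
have yp : exact_at (y \*: idfun : {linear L -> L}) p by move=> v; rewrite py.
have cf : cocycle f by split=> // a u v; rewrite linearP.
suff : coboundary (f : L -> I j.+1) by [].
apply: (@nakayama A nA m lm (L -> I j.+1) (@cocycle j.+1 L) (@coboundary j.+1 L) [:: y] s) => //.
- exact: submod_cocycle.
- exact: submod_coboundary.
- exact: coboundary_cocycle.
- by move=> x; rewrite inE => /eqP ->.
(* Here [f' (y *: v) = g v]. The coboundary of [f'] vanishes on [y L], so it comes from a cocycle on
   [L''], which bounds by hypothesis. Corrected by that primitive, [f'] becomes a cocycle whose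
   product with [y] is [g]. *)
move=> g [gl dg]; have [f' hf'] := extend yi (mklinear gl).
have [|k hk] := factor_exact ps yp (f := d j.+1 \o f').
  by move=> u /=; rewrite hf' /= dg.
have [|k' hk'] := h k.
  by move=> c; have [v <-] := ps c; rewrite hk d_comp0.
have gE : (g : L -> I j.+1) = y *: ((f' \- (k' \o p)) : L -> I j.+1).
  apply/funext => v; rewrite -[RHS]/(y *: (f' v - k' (p v))).
  have -> : y *: (f' v - k' (p v)) = f' (y *: v) - k' (p (y *: v)).
    by rewrite !linearZ /= scalerBr scalerN.
  have -> : p (y *: v) = 0 by apply/py; exists v.
  by rewrite linear0 subr0 hf'.
exists 0, g; split; first by apply: (submod0 (submod_coboundary _ _)).
  rewrite gE; apply: mem_mulp; rewrite ?mem_head //; first exact: submod_cocycle.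
  split; first by move=> a u v; rewrite linearP.
  by move=> v; rewrite /= linearB /= hk' hk subrr.
by rewrite add0r.
Qed.

Definition quo_of (V Q : lmodType A) (pi : {linear V -> Q}) (K : V -> Prop) : Prop :=
  (forall q, exists v, pi v = q) /\ forall v, pi v = 0 <-> K v.

Definition regc (M : lmodType A) (xs : seq A) : Prop :=
  forall k, (k < size xs)%N -> forall v : M,
    mulp (take k xs) (fullp (T := M)) (xs`_k *: v) -> mulp (take k xs) (fullp (T := M)) v.

Lemma quo_of_inj (V Q : lmodType A) (pi : {linear V -> Q}) :
  quo_of pi (mulp [::] (fullp (T := V))) -> injective pi.
Proof.
move=> [_ h] u v /eqP; rewrite -subr_eq0 -linearB => /eqP/h /= /eqP.
by rewrite subr_eq0 => /eqP.
Qed.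

Lemma quo_step (M Q Q' : lmodType A) (pi : {linear M -> Q}) (pi' : {linear M -> Q'}) xs k :
  (k < size xs)%N -> regc M xs ->
  quo_of pi (mulp (take k xs) (fullp (T := M))) ->
  quo_of pi' (mulp (take k.+1 xs) (fullp (T := M))) ->
  [/\ forall q : Q, xs`_k *: q = 0 -> q = 0 &
   exists p : {linear Q -> Q'}, (forall c, exists v, p v = c) /\
     forall v, p v = 0 <-> exists u, xs`_k *: u = v].
Proof.
move=> kx reg [s h] [s' h']; rewrite (take_nth 0 kx) in h'.
split.
  move=> q; have [v <-] := s q; rewrite -linearZ => /h/(reg k kx)/h //.
have [|p hp] := factor_surj (f := pi') s.
  move=> v /h hv; apply/h'/mulp_rcons; exists v, 0; rewrite scaler0 addr0; split=> //.
exists p; split; first by move=> c; have [v <-] := s' c; exists (pi v).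
move=> q; have [v <-] := s q; rewrite hp h' mulp_rcons; split.
  move=> [w [u [hw _ ->]]]; exists (pi u); rewrite linearD linearZ /=.
  by have -> : pi w = 0 by [apply/h]; rewrite add0r.
move=> [q' e']; have [u hu] := s q'; exists (v - xs`_k *: u), u; rewrite subrK; split=> //.
by apply/h; rewrite linearB linearZ /= hu e' subrr.
Qed.

(** Each regular element costs one degree: in the sequence Q0 -> Q0 -> Q, Ext^(j+2)(Q, A) lies
    between Ext^(j+1)(Q0, A) and Ext^(j+2)(Q0, A). *)
Lemma ext0_quo_up (M : lmodType A) xs : regc M xs -> (forall j, ext0 j M) ->
  forall k, (k <= size xs)%N -> forall (Q : lmodType A) (pi : {linear M -> Q}),
  quo_of pi (mulp (take k xs) (fullp (T := M))) -> forall j, (k <= j)%N -> ext0 j Q.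
Proof.
move=> reg hM; elim=> [|k IH] kx Q pi hpi j kj.
  by apply: (ext0_iso (p := pi)) (hM j); [apply: quo_of_inj; rewrite -(take0 xs)|case: hpi].
have hK : submod (mulp (take k xs) (fullp (T := M))) by exact: submod_gen.
have [Q0 [pi0 hpi0]] := quo_exists hK.
have [rg [p [ps hp]]] := quo_step kx reg hpi0 hpi.
case: j kj => // j kj.
apply: (@ext0_right _ _ _ (xs`_k *: idfun : {linear Q0 -> Q0}) p) => //.
- move=> u v /= /eqP; rewrite -subr_eq0 -scalerBr => /eqP/rg/eqP.
  by rewrite subr_eq0 => /eqP.
- by apply: (IH (ltnW kx) Q0 pi0 hpi0); apply: leqW.
- exact: (IH (ltnW kx) Q0 pi0 hpi0).
Qed.

(** The converse direction, resting on Nakayama through [ext0_regular]: undoing the division by one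
    regular element gains one degree of vanishing. *)
Lemma ext0_quo_down (M : lmodType A) xs : fg M -> (forall x, x \in xs -> x \in m) ->
  regc M xs -> forall n,
  (forall (Q : lmodType A) (pi : {linear M -> Q}),
     quo_of pi (mulp xs (fullp (T := M))) -> forall j, (n <= j)%N -> ext0 j Q) ->
  forall j, (n <= j + size xs)%N -> ext0 j M.
Proof.
move=> fM xm reg n hn.
suff h k : (k <= size xs)%N -> forall (Q : lmodType A) (pi : {linear M -> Q}),
    quo_of pi (mulp (take (size xs - k) xs) (fullp (T := M))) ->
    forall j, (n <= j + k)%N -> ext0 j Q.
  move=> j nj; apply: (h (size xs) (leqnn _) M (idfun : {linear M -> M})) => //.
  by rewrite subnn take0; split=> // v; exists v.
elim: k => [|k IH] kx Q pi hpi j nj.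
  by rewrite subn0 take_size in hpi; apply: hn hpi _ _; rewrite addn0 in nj.
have kx' : (size xs - k.+1 < size xs)%N by lia.
have e' : (size xs - k = (size xs - k.+1).+1)%N by lia.
have hK : submod (mulp (take (size xs - k) xs) (fullp (T := M))) by exact: submod_gen.
have [Q' [pi' hpi']] := quo_exists hK; have hpi1 := hpi'; rewrite e' in hpi1.
have [rg [p [ps hp]]] := quo_step kx' reg hpi hpi1.
apply: (ext0_regular (p := p) _ _ rg ps hp).
- exact: fg_surj fM hpi.1.
- by apply: xm; apply: mem_nth.
- by apply: (IH (ltnW kx) Q' pi' hpi'); rewrite addSnnS.
Qed.

(* Devissage along a prime filtration: for P <> m the module A/P has a regular element in m. *)
Lemma ext0_devissage j : (forall L, fg L -> ext0 j.+1 L) ->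
  (forall (Q : lmodType A) (pi : {linear A^o -> Q}),
     quo_of pi (fun x => (x : A) \in m) -> ext0 j Q) ->
  forall L, fg L -> ext0 j L.
Proof.
move=> hj hm L fL; have nL := fg_noeth nA fL.
suff h : forall K, submod K -> forall (Q : lmodType A) (pi : {linear L -> Q}),
    quo_of pi K -> ext0 j Q.
  apply: (h _ (submod_null L) L (idfun : {linear L -> L})).
  by split=> // v; exists v.
apply: (noeth_ind nL) => K hK IH Q pi [ps pk].
have [Kt|/existsNP[v nKv]] := pselect (forall v, K v).
  by apply: ext0_trivial => q; have [v <-] := ps q; apply/pk.
have [//|v1 [_ nv1 pv1 _]] := @ass_exists A nA L (fullp (T := L)) K (colon K v) v (submod_full L) hK Logic.I nKv.
have hK' : submod (sump K (line v1)) by apply: submod_add => //; apply: submod_line.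
have KK' : subp K (sump K (line v1)) by apply: sumpl; apply: submod_line.
have [Q' [pi' [ps' pk']]] := quo_exists hK'.
have hQ' : ext0 j Q'.
  apply: (IH _ hK' KK' _ Q' pi') => // e1; apply: nv1; rewrite -e1.
  by apply: sumpr => //; exists 1; rewrite scale1r.
have [|p hp] := factor_surj (f := pi') ps; first by move=> w /pk/KK'/pk'.
have [hP P1 PM] := pv1.
have [R [rho [rs rk]]] := quo_exists hP.
have fl : linear (fun c : A^o => pi (c *: v1)).
  by move=> b x y; rewrite scalerDl -linearZ -linearD scalerA.
have [|i hi] := factor_surj (f := mklinear fl) rs.
  by move=> c /rk hc; apply/pk.
have ii : injective i.
  move=> u w; have [u' <-] := rs u; have [w' <-] := rs w; rewrite !hi /= => /eqP.
  rewrite -subr_eq0 -linearB -scalerBl => /eqP/pk h1; apply/eqP.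
  by rewrite -subr_eq0 -linearB; apply/eqP/rk.
(* [L / K] is an extension of [L / (K + A v1)], covered by Noetherian induction, by [A / P] with
   [P = colon K v1]; it remains to treat [A / P]. *)
apply: (@ext0_mid R Q Q' i p) => //.
- by move=> c; have [w <-] := ps' c; exists (pi w).
- move=> q; have [w <-] := ps q; rewrite hp pk'; split.
    move=> [k [_ [Kk [c ->] ->]]]; exists (rho c); rewrite hi /= linearD.
    by have /pk -> := Kk; rewrite add0r.
  move=> [r hr]; have [c hc] := rs r; move: hr; rewrite -hc hi /= => hr.
  exists (w - c *: v1), (c *: v1); rewrite subrK; split=> //; last by exists c.
  by apply/pk; rewrite linearB /= hr subrr.
have [Pm|] := pselect (forall y, y \in m -> colon K v1 y).
  apply: (hm R rho); split=> // c; rewrite rk; split=> [h1|/Pm //].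
  exact: (prime_sub_max nA lm pv1).
move=> /existsNP[y /not_implyP[ym nPy]].
have fR : fg R by exact: fg_surj (fg_regular A) rs.
have hy : submod (imgp (y \*: idfun : {linear R -> R}) (fullp (T := R))) by exact: submod_img.
have [R' [tau [ts tk]]] := quo_exists hy.
apply: (ext0_regular (p := tau) fR ym _ ts).
- move=> r; have [c <-] := rs r; rewrite -linearZ => /rk /PM[//|h1]; exact/rk.
- by move=> r; rewrite tk; split=> [[u _ <-]|[u <-]]; exists u.
by apply: hj; apply: fg_surj ts.
Qed.

(* Bounding the injective dimension of A by the length of a maximal regular sequence ys:
   A/m embeds into A/(ys). *)
Theorem ext0_vanish (ys : seq A) (v0 : A^o) : regc A^o ys ->
  ~ mulp ys (fullp (T := A^o)) v0 ->
  (forall z, z \in m -> mulp ys (fullp (T := A^o)) (z *: v0)) ->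
  forall L, fg L -> forall j, (size ys <= j)%N -> ext0 j L.
Proof.
move=> reg nv0 zv0.
have hJ : submod (mulp ys (fullp (T := A^o))) by exact: submod_gen.
(* Descending induction on [j] from [n0], where the resolution stops. Devissage reduces to A/m, and
   [ext0_left] for A/m inside A/(ys) uses the cokernel one degree higher, known by induction, and
   A/(ys), known for [size ys <= j]. *)
suff h k j : (n0 <= j + k)%N -> (size ys <= j)%N -> forall L, fg L -> ext0 j L.
  by move=> L fL j yj; apply: (h n0 j) => //; apply: leq_addl.
elim: k j => [|k IH] j nj yj L fL; first by apply: ext0_large; rewrite addn0 in nj.
move: L fL; apply: ext0_devissage.
  by move=> L fL; apply: IH => //; rewrite ?addSnnS // leqW.
move=> Q pi [ps pk].
have [B [rho [rs rk]]] := quo_exists hJ.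
have hB : ext0 j B.
  apply: (ext0_quo_up reg _ (leqnn _) (pi := rho)) => //.
    by move=> i; apply: projective_ext0; apply: projective_regular.
  by rewrite take_size.
have fl : linear (fun c : A^o => rho (c *: v0)).
  by move=> b x y; rewrite scalerDl -linearZ -linearD scalerA.
have [|i hi] := factor_surj (f := mklinear fl) ps.
  by move=> c /pk cm; apply/rk/zv0.
have ii : injective i.
  move=> u w; have [u' <-] := ps u; have [w' <-] := ps w; rewrite !hi /= => /eqP.
  rewrite -subr_eq0 -linearB -scalerBl => /eqP/rk h1; apply/eqP.
  rewrite -subr_eq0 -linearB; apply/eqP/pk; apply: contrapT => /negP/(unit_notin_max nA lm)[b bE].
  by apply: nv0; rewrite -[v0]scale1r -bE -scalerA; apply: submodZ.
have [C [p [ps' pk']]] := quo_exists (submod_img i (submod_full Q)).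
apply: (@ext0_left Q B C i p) => //.
- by move=> b; rewrite pk'; split=> [[u _ <-]|[u <-]]; exists u.
apply: IH; [by rewrite addSnnS|exact: leqW|].
by apply: (fg_surj (f := p \o rho)); [apply: fg_regular|move=> c; have [b <-] := ps' c; have [x <-] := rs b; exists x].
Qed.

Definition ext_acyclic (L : lmodType A) : Prop := forall j, ext0 j L.

(* Ext^1(L, N) = 0 for all L with Ext^j(L, A) = 0, j >= 1. *)
Definition perp (N : lmodType A) : Prop :=
  forall n (S L : lmodType A) (i : {linear S -> 'rV[A]_n}) (p : {linear 'rV[A]_n -> L}),
  injective i -> (forall c, exists v, p v = c) -> exact_at i p -> ext_acyclic L ->
  forall f : {linear S -> N}, exists g : {linear 'rV[A]_n -> N}, forall v, g (i v) = f v.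

Lemma acyclic_syzygy n (S L : lmodType A) (i : {linear S -> 'rV[A]_n}) (p : {linear 'rV[A]_n -> L}) :
  injective i -> (forall c, exists v, p v = c) -> exact_at i p ->
  ext_acyclic L -> ext_acyclic S.
Proof.
move=> ii ps ip h j; apply: (ext0_left ii ps ip) => //.
by apply: projective_ext0; apply: projective_rV.
Qed.

(** A map from the syzygy to [A] extends into [I 0]. Vanishing of Ext^1(L, A) provides a correction
    through [L] after which the extension is killed by [d 0], so it takes values in [A]. *)
Lemma perp_regular : perp A^o.
Proof.
move=> n S L i p ii ps ip h f.
have [f' hf'] := extend ii (e \o f).
have [|k hk] := factor_exact ps ip (f := d 0 \o f').
  by move=> u; rewrite /= hf' /=; apply/e_exact; exists (f u).
have [|g hg] := h 0%N k; first by move=> c; have [v <-] := ps c; rewrite hk d_comp0.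
have [|psi hpsi] := factor_inj (f := f' \- (g \o p)) einj.
  by move=> v; apply/e_exact; rewrite /= linearB /= hg hk subrr.
exists psi => v; apply: einj; rewrite hpsi /= hf' /=.
by rewrite (exact_comp0 ip) linear0 subr0.
Qed.

(** Ext^1(L, N) lies between Ext^1(L, P) and Ext^2(L, K), and the latter is Ext^1(S, K) for the
    syzygy [S] of [L], which is again acyclic. *)
Lemma perp_coker (K P N : lmodType A) (k : {linear K -> P}) (q : {linear P -> N}) :
  injective k -> (forall c, exists v, q v = c) -> exact_at k q ->
  perp K -> perp P -> perp N.
Proof.
move=> ki qs kq pK pP n S L i p ii ps ip hL f.
have fS : fg S := fg_submod (fg_noeth nA (fg_rV A n)) ii.
have hS := acyclic_syzygy ii ps ip hL.
have [n1 [p1 ps1]] := fS.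
have [S1 [i1 [ii1 _ ip1]]] := fg_ker p1 (fg_noeth nA (fg_rV A n1)).
have [psi hpsi] := free_lift (f \o p1) qs.
have [|chi hchi] := factor_inj (f := psi \o i1) ki.
  by move=> v; apply/kq; rewrite /= hpsi /= (exact_comp0 ip1) linear0.
have [chi' hchi'] := pK _ _ _ i1 p1 ii1 ps1 ip1 hS chi.
have [|th hth] := factor_exact ps1 ip1 (f := psi \- (k \o chi')).
  by move=> u; rewrite /= hchi' hchi /= subrr.
have [th' hth'] := pP _ _ _ i p ii ps ip hL th.
exists (q \o th') => v; rewrite /= hth'; have [u <-] := ps1 v.
by rewrite hth /= linearB /= hpsi (iffRL (kq _)) ?subr0 //; exists (chi' u).
Qed.

Lemma perp_trivial (N : lmodType A) : (forall v : N, v = 0) -> perp N.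
Proof.
move=> h0 n S L i p _ _ _ _ f; exists (\0 : {linear 'rV[A]_n -> N}) => v.
by rewrite (h0 (f v)) (h0 (_ (i v))).
Qed.

(** The modules of a finite projective resolution may be infinitely generated. The syzygy [S] is
    finitely generated, so a map from it to [P] has finitely many coordinates in [A], each extended
    by [perp_regular]. *)
Lemma perp_projective (P : lmodType A) : projective P -> perp P.
Proof.
move=> pP n S L i p ii ps ip hL f.
have fS : fg S := fg_submod (fg_noeth nA (fg_rV A n)) ii.
have [T [c hc]] := projective_coordinates f pP fS.
have [g hg] := choice (fun x => perp_regular ii ps ip hL (c x)).
have gl : linear (fun v : 'rV[A]_n => \sum_(x <- T) (g x v : A) *: x).
  move=> a u v; rewrite scaler_sumr -big_split /=; apply: eq_bigr => x _.
  by rewrite linearP scalerDl -scalerA.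
by exists (mklinear gl) => v; rewrite hc /=; apply: eq_bigr => x _; rewrite hg.
Qed.

Lemma perp_projdim (N : lmodType A) : finite_projdim N -> perp N.
Proof.
move=> [P [dP [eP [pP es ex0 exd [n1 hn1]]]]].
(* The cokernels of the resolution are treated from its zero end towards [N]; [k] is the remaining
   distance to an index past [n1]. *)
suff h k j : (n1 < j + k)%N -> forall (C : lmodType A) (q : {linear P j -> C}),
    (forall c, exists v, q v = c) -> exact_at (dP j) q -> perp C.
  exact: (h n1.+1 0%N (ltnSn _) N eP es ex0).
elim: k j => [|k IH] j nj C q qs qe.
  apply: perp_trivial => c; have [v <-] := qs c.
  by rewrite addn0 in nj; rewrite (hn1 j nj v) linear0.
have [C1 [q1 [qs1 qk1]]] := quo_exists (submod_img (dP j.+1) (submod_full _)).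
have qe1 : exact_at (dP j.+1) q1.
  by move=> v; rewrite qk1; split=> [[u _ <-]|[u <-]]; exists u.
have [|ka hka] := factor_surj (f := dP j) qs1.
  by move=> v /qe1 hv; apply/exd.
apply: (perp_coker (k := ka) (q := q)) => //.
- move=> x y; have [u <-] := qs1 x; have [v <-] := qs1 y; rewrite !hka => /eqP.
  rewrite -subr_eq0 -linearB => /eqP/exd/qe1/eqP; by rewrite linearB subr_eq0 => /eqP.
- move=> v; rewrite qe; split=> [[u <-]|[c <-]]; first by exists (q1 u).
  by have [u <-] := qs1 c; exists u.
- by apply: (IH j.+1 _ C1 q1) => //; rewrite addSnnS.
- exact: perp_projective.
Qed.

(** [perp_coker] applies to multiplication by each regular element. This gives Tor and Ext vanishing
    with coefficients in N/(x_1, ..., x_k)N. *)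
Lemma perp_quo (N : lmodType A) xs : regc N xs -> perp N ->
  forall k, (k <= size xs)%N -> forall (Q : lmodType A) (pi : {linear N -> Q}),
  quo_of pi (mulp (take k xs) (fullp (T := N))) -> perp Q.
Proof.
move=> reg hN; elim=> [|k IH] kx Q pi hpi.
  rewrite take0 in hpi; have inj := quo_of_inj hpi; case: hpi => ps pk.
  apply: (perp_coker (K := 'rV[A]_0) (k := (\0 : {linear 'rV[A]_0 -> N})) (q := pi)) => //.
  - by move=> u v _; apply/rowP; case.
  - by move=> v; rewrite pk /=; split=> [->|[u <-]] //; exists 0.
  - by apply: perp_trivial => v; apply/rowP; case.
have hK : submod (mulp (take k xs) (fullp (T := N))) by exact: submod_gen.
have [Q0 [pi0 hpi0]] := quo_exists hK.
have [rg [p [ps hp]]] := quo_step kx reg hpi0 hpi.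
have pQ0 : perp Q0 by apply: (IH (ltnW kx) Q0 pi0 hpi0).
apply: (perp_coker (k := xs`_k *: idfun : {linear Q0 -> Q0}) (q := p)) => //.
move=> u v /= /eqP; rewrite -subr_eq0 -scalerBr => /eqP/rg/eqP.
by rewrite subr_eq0 => /eqP.
Qed.

(* y is a map F_b -> N killing im D1 = ker D2, hence a map on im D2, which extends. *)
Lemma perp_dual_exact (N : lmodType A) p q r (D1 : 'M[A]_(p, q)) (D2 : 'M[A]_(q, r))
  (C : lmodType A) (c : {linear 'rV[A]_r -> C}) :
  exact_at (fun x : 'rV_p => x *m D1) (fun x : 'rV_q => x *m D2) ->
  (forall z, exists v, c v = z) -> exact_at (fun x : 'rV_q => x *m D2) c ->
  ext_acyclic C -> perp N ->
  forall y, mx_act N D1^T y = 0 -> exists z, mx_act N D2^T z = y.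
Proof.
move=> ex cs cex aC pN y hy.
have fl : linear (fun u : 'rV[A]_q => \sum_k u 0 k *: y k).
  move=> a u v; rewrite scaler_sumr -big_split /=; apply: eq_bigr => k _.
  by rewrite !mxE scalerDl scalerA.
pose f := mklinear fl.
have fD1 w : f (w *m D1) = 0.
  rewrite /f /=; under eq_bigr do rewrite mxE scaler_suml.
  rewrite exchange_big big1 //= => l _.
  under eq_bigr do rewrite -scalerA.
  rewrite -scaler_sumr; have := congr1 (fun g : {ffun _} => g l) hy.
  rewrite !ffunE; under eq_bigr do rewrite mxE.
  by move=> ->; rewrite scaler0.
have [S [i [ii iP]]] := sub_exists (submod_ker c).
have ie : exact_at i c by move=> v; exact: iP.
have [|s hs] := factor_inj (f := mulmxr D2) ii.
  by move=> v; apply/iP/cex; exists v.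
have ss z : exists u, s u = z.
  have : c (i z) = 0 by apply/iP; exists z.
  by move=> /cex[u hu]; exists u; apply: ii; rewrite hs.
have [|f' hf'] := factor_surj (f := f) ss.
  move=> v sv; have /ex[w <-] : v *m D2 = 0 by have := hs v; rewrite sv linear0.
  exact: fD1.
have [psi hpsi] := pN _ _ _ i c ii cs ie aC f'.
exists [ffun k => psi (delta_mx 0 k)]; apply/ffunP => l.
have -> : y l = f (delta_mx 0 l).
  rewrite /f /= (bigD1 l) //= big1 => [|k kl]; first by rewrite mxE !eqxx scale1r addr0.
  by rewrite mxE (negbTE kl) andbF scale0r.
rewrite -hf' -hpsi hs /= -rowE [row l D2]row_sum_delta linear_sum ffunE.
by apply: eq_bigr => k _; rewrite linearZ ffunE !mxE.
Qed.

(** * Acyclicity of the resolution and of its dual *)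

Section Resolution.
Variables (M : lmodType A) (aM : ext_acyclic M) (F : free_resolution M).

(** The cokernel of [diff F 0] is [M], and that of [diff F j.+1] is the image of [diff F j], a
    syzygy of the cokernel of [diff F j]. *)
Lemma acyclic_cokernel j (C : lmodType A) (q : {linear 'rV[A]_(rank F j) -> C}) :
  (forall c, exists v, q v = c) -> exact_at (fun x : 'rV_(rank F j.+1) => x *m diff F j) q ->
  ext_acyclic C.
Proof.
elim: j C q => [|j IH] C q qs qe.
  have [|p hp] := factor_surj (f := q) (aug_surj F).
    by move=> v /aug_exact hv; apply/qe.
  move=> i. apply: (ext0_iso (p := p) _ _ (@aM i)).
    move=> x y; have [u <-] := aug_surj F x; have [v <-] := aug_surj F y.
    rewrite !hp => /eqP; rewrite -subr_eq0 -linearB => /eqP/qe/aug_exact/eqP.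
    by rewrite linearB subr_eq0 => /eqP.
  by move=> c; have [v <-] := qs c; exists (aug F v).
have [C0 [q0 [qs0 qk0]]] := quo_exists (submod_img (rmul (diff F j)) (submod_full _)).
have [|ka hka] := factor_surj (f := rmul (diff F j)) qs.
  by move=> v /qe hv; apply/diff_exact.
apply: (acyclic_syzygy (i := ka) (p := q0)) => //.
- move=> x y; have [u <-] := qs x; have [v <-] := qs y; rewrite !hka => /eqP.
  rewrite -subr_eq0 -linearB => /eqP/diff_exact/qe/eqP; by rewrite linearB subr_eq0 => /eqP.
- move=> v; rewrite qk0; split=> [[u _ <-]|[c <-]]; first by exists (q u); rewrite hka.
  by have [u <-] := qs c; exists u; rewrite ?hka.
- apply: (IH C0 q0) => // v; rewrite qk0; split=> [[u _ <-]|[u <-]]; by exists u.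
Qed.

Lemma ext_exact (N : lmodType A) : perp N ->
  forall j y, mx_act N (diff F j.+1)^T y = 0 -> exists z, mx_act N (diff F j)^T z = y.
Proof.
move=> pN j y.
have [C [q [qs qk]]] := quo_exists (submod_img (rmul (diff F j)) (submod_full _)).
have qe : exact_at (fun x : 'rV_(rank F j.+1) => x *m diff F j) q.
  by move=> v; rewrite qk; split=> [[u _ <-]|[u <-]]; exists u.
apply: (perp_dual_exact (diff_exact (f := F) (j := j)) qs qe) pN _.
exact: acyclic_cokernel qs qe.
Qed.

Lemma dual_exact j : exact_at (fun x : 'rV_(rank F j) => x *m (diff F j)^T)
  (fun x : 'rV_(rank F j.+1) => x *m (diff F j.+1)^T).
Proof.
have actE p q (D : 'M[A]_(p, q)) (y : {ffun 'I_p -> A^o}) k :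
    mx_act A^o D y k = ((\row_i (y i : A)) *m D) 0 k.
  by rewrite ffunE mxE; apply: eq_bigr => i _; rewrite mxE mulrC.
move=> x; split=> [hx|[y <-]].
  pose y : {ffun 'I_(rank F j.+1) -> A^o} := [ffun k => x 0 k].
  have yx : \row_i (y i : A) = x by apply/rowP => i; rewrite mxE ffunE.
  have [|z hz] := ext_exact perp_regular (j := j) (y := y).
    by apply/ffunP => k; rewrite actE yx hx ffunE mxE.
  exists (\row_i (z i : A)); apply/rowP => k.
  by rewrite -actE hz ffunE.
rewrite -mulmxA -trmx_mul.
suff -> : diff F j.+1 *m diff F j = 0 by rewrite trmx0 mulmx0.
apply/row_matrixP => i; rewrite row_mul row0.
by apply/(diff_exact (f := F)); exists (delta_mx 0 i); rewrite -rowE.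
Qed.

(** The exact dual complex continues without end to the right, so [C] is a syzygy of arbitrarily
    high order. Each step trades its Ext for that of the next cokernel one degree higher, until the
    degree passes the end [n0] of the injective resolution. *)
Lemma acyclic_dual_cokernel k j (C : lmodType A) (q : {linear 'rV[A]_(rank F j.+2) -> C}) :
  (forall c, exists v, q v = c) ->
  exact_at (fun x : 'rV_(rank F j.+1) => x *m (diff F j.+1)^T) q ->
  forall i, (n0 <= i + k)%N -> ext0 i C.
Proof.
elim: k j C q => [|k IH] j C q qs qe i ik; first by apply: ext0_large; rewrite addn0 in ik.
have [C0 [q0 [qs0 qk0]]] := quo_exists (submod_img (rmul (diff F j.+2)^T) (submod_full _)).
have qe0 : exact_at (fun x : 'rV_(rank F j.+2) => x *m (diff F j.+2)^T) q0.
  by move=> v; rewrite qk0; split=> [[u _ <-]|[u <-]]; exists u.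
have [|ka hka] := factor_surj (f := rmul (diff F j.+2)^T) qs.
  by move=> v /qe hv; apply/(@dual_exact j.+1).
apply: (ext0_left (i := ka) (p := q0)) => //.
- move=> x y; have [u <-] := qs x; have [v <-] := qs y; rewrite !hka => /eqP.
  rewrite -subr_eq0 -linearB => /eqP/(@dual_exact j.+1)/qe/eqP; by rewrite linearB subr_eq0 => /eqP.
- move=> v; rewrite qe0; split=> [[u <-]|[c <-]]; first by exists (q u); rewrite hka.
  by have [u <-] := qs c; exists u; rewrite ?hka.
- by apply: (IH j.+1 C0 q0) => //; rewrite addSnnS.
- by apply: projective_ext0; apply: projective_rV.
Qed.

(** The dual of the dual complex is [F] itself, so [perp_dual_exact] applied to the transposed
    differentials yields exactness of [F] tensored with [N]. *)
Lemma tor_exact (N : lmodType A) : perp N ->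
  forall j y, mx_act N (diff F j) y = 0 -> exists z, mx_act N (diff F j.+1) z = y.
Proof.
move=> pN j y.
have [C [q [qs qk]]] := quo_exists (submod_img (rmul (diff F j.+1)^T) (submod_full _)).
have qe : exact_at (fun x : 'rV_(rank F j.+1) => x *m (diff F j.+1)^T) q.
  by move=> v; rewrite qk; split=> [[u _ <-]|[u <-]]; exists u.
have := perp_dual_exact (@dual_exact j) qs qe _ pN (y := y).
rewrite !trmxK; apply=> i; exact: (acyclic_dual_cokernel (k := n0) qs qe (leq_addl _ _)).
Qed.

End Resolution.

End Ext.

(** * The theorem *)

Section Freeness.
Variables (A : comNzRingType) (nA : noetherian A) (m : {pred A}) (lm : is_local m).

Lemma drop_generator (M : lmodType A) n (q : {linear 'rV[A]_n.+1 -> M}) u i b :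
  (forall v, exists x, q x = v) -> q u = 0 -> b * u 0 i = 1 ->
  exists q' : {linear 'rV[A]_n -> M}, forall v, exists x, q' x = v.
Proof.
move=> qs qu bu.
pose f (w : 'rV[A]_n) : M := \sum_j w 0 j *: q (delta_mx 0 (lift i j)).
have fl : linear f.
  move=> c x y; rewrite /f scaler_sumr -big_split /=; apply: eq_bigr => j _.
  by rewrite !mxE scalerDl scalerA.
exists (mklinear fl) => v; have [x <-] := qs v.
pose x' := x - (x 0 i * b) *: u.
have qx' : q x' = q x by rewrite linearB linearZ /= qu scaler0 subr0.
have x'i : x' 0 i = 0 by rewrite !mxE -mulrA bu mulr1 subrr.
have -> : q x = \sum_j x' 0 (lift i j) *: q (delta_mx 0 (lift i j)).
  rewrite -qx' {1}[x']row_sum_delta linear_sum /= (bigD1_ord i) //= x'i scale0r linear0 add0r.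
  by apply: eq_bigr => j _; rewrite linearZ.
by exists (\row_j x' 0 (lift i j)); apply: eq_bigr => j _; rewrite mxE.
Qed.

(** With the least number [n] of generators, relations have coordinates in [m], by [drop_generator].
    The idempotent [g] projects onto the kernel of [q], so its image is contained in [m] times
    itself and vanishes by Nakayama. *)
Lemma free_of_split_surj (M : lmodType A) k (p : {linear 'rV[A]_k -> M}) (s : {linear M -> 'rV[A]_k}) :
  (forall v, p (s v) = v) -> is_free M.
Proof.
move=> ps; have [a [am ma]] := max_gens nA lm.
have ex : exists n, `[< exists q : {linear 'rV[A]_n -> M}, forall v, exists x, q x = v >].
  by exists k; apply/asboolP; exists p => v; exists (s v).
case: (ex_minnP ex) => n /asboolP[q qs] nmin.
have kerm u i : q u = 0 -> u 0 i \in m.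
  case: n q qs nmin u i => [|n] q qs nmin u i qu; first by case: i.
  apply: contrapT => /negP/(unit_notin_max nA lm)[b bu].
  suff : (n.+1 <= n)%N by rewrite ltnn.
  by apply: nmin; apply/asboolP; exact: drop_generator bu.
have [h hh] := free_lift p qs.
have qhs v : q (h (s v)) = v by rewrite hh ps.
pose g : {linear 'rV[A]_n -> 'rV[A]_n} := idfun \- (h \o s \o q).
have qg u : q (g u) = 0 by rewrite /g /= linearB /= qhs subrr.
have gg u : g (g u) = g u.
  have h0 : h (s (q (g u))) = 0 by rewrite qg !linear0.
  by rewrite -[LHS]/(g u - h (s (q (g u)))) h0 subr0.
have g0 : subp (imgp g (fullp (T := 'rV[A]_n))) (nullp (V := 'rV[A]_n)).
  have hU := submod_img g (submod_full 'rV[A]_n).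
  have [t ht] := fg_noeth nA (fg_rV A n) hU.
  apply: (@nakayama A nA m lm _ _ _ a t) => //.
  - exact: submod_null.
  - by move=> v ->; apply: submod0.
  - by rewrite ht => x; apply: mem_spanp.
  - by rewrite -ht => v hv; exists 0, v; rewrite add0r.
  move=> _ [u _ <-]; exists 0, (g u); rewrite add0r; split=> //.
  rewrite -gg [X in g X]row_sum_delta linear_sum; apply: submod_sum => [|i _].
    exact: submod_gen.
  rewrite linearZ /=; apply: (max_mulp ma) => //; first exact: kerm (qg u).
  by exists (delta_mx 0 i).
exists n, q; exists (h \o s) => v; last exact: qhs.
have : g v = 0 by apply: g0; exists v.
by rewrite /g /= => /eqP; rewrite subr_eq0 eq_sym => /eqP.
Qed.

(** Splitting moves down the resolution: if [B = B *m E *m B], then [c = 1 - E *m B] is killed by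
    [B], so dual exactness gives [c = D *m Y], and [D *m Y *m D = c *m D = D] because [B *m D = 0].
    At [j = 0] the augmentation splits and [M] is a summand of a free module. *)
Lemma regular_diff_free (M : lmodType A) (F : free_resolution M) :
  (forall j, exact_at (fun x : 'rV_(rank F j) => x *m (diff F j)^T)
     (fun x : 'rV_(rank F j.+1) => x *m (diff F j.+1)^T)) ->
  forall j E, diff F j = diff F j *m E *m diff F j -> is_free M.
Proof.
move=> dual; elim=> [|j IH] E DED.
  pose f : 'M[A]_(rank F 0) := 1%:M - E *m diff F 0.
  have Df : diff F 0 *m f = 0 by rewrite mulmxBr mulmx1 mulmxA -DED subrr.
  have [|s hs] := factor_surj (f := rmul f) (aug_surj F).
    by move=> v /aug_exact[u <-]; rewrite /rmul /= -mulmxA Df mulmx0.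
  apply: (free_of_split_surj (p := aug F) (s := s)) => v.
  have [u <-] := aug_surj F v; rewrite hs /rmul /= mulmxBr mulmx1 linearB /=.
  have -> : aug F (u *m (E *m diff F 0)) = 0.
    by apply/aug_exact; exists (u *m E); rewrite mulmxA.
  by rewrite subr0.
set B := diff F j.+1 in DED; set D := diff F j.
have BD : B *m D = 0.
  apply/row_matrixP => i; rewrite row_mul row0.
  by apply/(diff_exact (f := F)); exists (delta_mx 0 i); rewrite -rowE.
pose c := 1%:M - E *m B.
have Bc : B *m c = 0 by rewrite mulmxBr mulmx1 mulmxA -DED subrr.
have hc i : exists y, y *m D^T = row i c^T.
  by apply/dual; rewrite -row_mul -trmx_mul Bc trmx0 row0.
have [y hy] := choice hc.
have cE : c = D *m (\matrix_i y i)^T.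
  apply: (can_inj trmxK); rewrite trmx_mul trmxK; apply/row_matrixP => i.
  by rewrite row_mul rowK hy.
apply: (IH (\matrix_i y i)^T); rewrite -cE mulmxBl mul1mx -mulmxA BD mulmx0 subr0 //.
Qed.

End Freeness.

(** * Regular sequences and chains of primes *)

Section PrimeChains.
Variables (A : comNzRingType) (nA : noetherian A) (V : lmodType A).

Definition pchain (I : A -> Prop) (k : nat) : Prop := exists p : nat -> A -> Prop,
  (forall j, primep (p j) /\ subp I (p j)) /\
  forall j, (j < k)%N -> subp (p j) (p j.+1) /\ exists2 x, p j.+1 x & ~ p j x.

Lemma pchainE (I : {pred A}) k : pchain (fun x => x \in I) k <->
  exists p : nat -> {pred A},
    (forall j, prime_ideal (p j) /\ {subset I <= p j}) /\ strict_chain p k.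
Proof.
split=> -[p [h1 h2]].
  exists (fun j => [pred x | `[< p j x >]] : {pred A}); split=> j.
    have [pp Ip] := h1 j; split; first exact: primep_pred.
    by move=> x /Ip hx; rewrite inE; apply/asboolP.
  move=> /h2[s [x x1 x2]]; split; last by exists x; rewrite !inE; apply/asboolP.
  by move=> y; rewrite !inE => /asboolP/s/asboolP.
exists (fun j x => x \in p j); split=> j.
  by have [pp Ip] := h1 j; split; [exact: prime_idealE|exact: Ip].
by move=> /h2[s [x x1 x2]]; split; [exact: s|exists x => //; apply/negP].
Qed.

Definition ann_quo (W : V -> Prop) (b : A) : Prop := forall v, W (b *: v).

Lemma ideal_ann_quo W : submod W -> ideal (ann_quo W).
Proof.
move=> hW; split; first by move=> v; rewrite scale0r; apply: submod0.
by move=> a x y hx hy v; rewrite scalerDl -scalerA; apply: hW.2.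
Qed.

(* The new bottom prime avoids the products s x^k with s outside the old one. *)
Lemma pchain_step (W : V -> Prop) (x : A) k : submod W ->
  (forall v, W (x *: v) -> W v) ->
  pchain (ann_quo (sump W (fun v => exists2 u, fullp (T := V) u & v = x *: u))) k ->
  pchain (ann_quo W) k.+1.
Proof.
move=> hW reg [p [h1 h2]].
set W' := sump W _ in h1.
have WW' : subp W W' by apply: sumpl; apply: submod_scale.
have [[hP P1 PM] IP] := h1 0%N; set P := p 0%N in hP P1 PM IP.
have Px : P x.
  by apply: IP => v; apply: sumpr => //; exists v.
have regn n v : W (x ^+ n *: v) -> W v.
  elim: n v => [|n IH] v; first by rewrite expr0 scale1r.
  by rewrite exprS -scalerA => /reg/IH.
pose S b := exists s n, ~ P s /\ b = s * x ^+ n.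
have [||||Q [pQ IQ QS]] := @prime_avoiding_mult A nA S (ann_quo W).
- by exists 1, 0%N; rewrite expr0 mulr1.
- move=> _ _ [s [n [Ps ->]]] [s' [n' [Ps' ->]]]; exists (s * s'), (n + n')%N.
  by split; [case/PM|rewrite exprD mulrACA].
- exact: ideal_ann_quo.
- move=> _ [s [n [Ps ->]]] h; apply: Ps; apply: IP => v; apply: WW'.
  by apply: (regn n); rewrite scalerA mulrC; apply: h.
exists (fun j => if j is j'.+1 then p j' else Q); split=> [[|j]|[|j]].
- by split.
- by have [pj Ij] := h1 j; split=> // b hb; apply: Ij => v; apply: WW'.
- move=> _; split.
    move=> b Qb; apply: contrapT => nPb; apply: (QS b) => //.
    by exists b, 0%N; rewrite expr0 mulr1.
  by exists x => // Qx; apply: (QS x) => //; exists 1, 1%N; rewrite expr1 mul1r.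
- exact: h2.
Qed.

(** In terms of dimension, dim V is at least dim V/(xs)V plus the length of [xs]. It serves both to
    bound regular sequences in [A] and to show that [N / (xs) N] has finite length. *)
Lemma pchain_regular xs k : regc V xs ->
  pchain (ann_quo (mulp xs (fullp (T := V)))) k ->
  pchain (ann_quo (nullp (V := V))) (k + size xs).
Proof.
move=> reg h0.
suff h j : (j <= size xs)%N -> pchain (ann_quo (mulp (take (size xs - j) xs) (fullp (T := V)))) (k + j).
  by have := h (size xs) (leqnn _); rewrite subnn take0.
elim: j => [|j IH] jx; first by rewrite subn0 take_size addn0.
have jx' : (size xs - j.+1 < size xs)%N by lia.
have := IH (ltnW jx); have -> : (size xs - j = (size xs - j.+1).+1)%N by lia.
rewrite (take_nth 0 jx') addnS => hc.
apply: (@pchain_step _ (xs`_(size xs - j.+1))).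
- exact: submod_gen.
- exact: reg.
suff <- : mulp (rcons (take (size xs - j.+1) xs) xs`_(size xs - j.+1)) (fullp (T := V)) =
   sump (mulp (take (size xs - j.+1) xs) (fullp (T := V)))
     (fun v => exists2 u, fullp (T := V) u & v = xs`_(size xs - j.+1) *: u) by [].
apply: pred_ext => v; rewrite mulp_rcons; split.
  by move=> [w [u [hw hu ->]]]; exists w, (xs`_(size xs - j.+1) *: u); split=> //; exists u.
by move=> [w [_ [hw [u hu ->] ->]]]; exists w, u.
Qed.

Lemma seq_mulE xs (v : V) : v \in seq_mul V xs <-> mulp xs (fullp (T := V)) v.
Proof.
rewrite inE; split=> [/asboolP[y ->]|h].
  by apply: submod_sum => [|j _]; [exact: submod_gen|apply: mem_mulp => //; exact: mem_nth].
apply/asboolP; elim: xs v h => [|x xs IH] v /=; first by move=> ->; exists (fun=> 0); rewrite big_ord0.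
move=> [u [w [_ /IH[y ->] ->]]]; exists (fun j => if j is j'.+1 then y j' else u).
by rewrite big_ord_recl.
Qed.

Lemma regular_seq_regc xs : regular_seq V xs -> regc V xs.
Proof. by move=> [h _] k kx v /seq_mulE/(h k kx)/seq_mulE. Qed.

End PrimeChains.

Lemma is_max_uniq P k l : is_max P k -> is_max P l -> k = l.
Proof. by move=> [h1 h2] [h3 h4]; apply/eqP; rewrite eqn_leq h4 // h2. Qed.

Lemma exact_mod (A : comNzRingType) (N Q : lmodType A) (pi : {linear N -> Q}) (K : N -> Prop)
  p q r (B : 'M[A]_(p, q)) (D : 'M[A]_(q, r)) : quo_of pi K ->
  (forall y, mx_act Q D y = 0 -> exists z, mx_act Q B z = y) ->
  forall w, coordp K (mx_act N D w) -> exists y, coordp K (w - mx_act N B y).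
Proof.
move=> [ps pk] ex w hw.
have [|z hz] := ex [ffun i => pi (w i)].
  rewrite mx_act_map; apply/ffunP => i; rewrite ffunE [RHS]ffunE; exact/pk.
have [y hy] := choice (fun i => ps (z i)).
exists [ffun i => y i] => i; apply/pk.
have -> : (w - mx_act N B [ffun i => y i]) i = w i - mx_act N B [ffun i => y i] i by rewrite !ffunE.
have zE : z = [ffun i => pi ([ffun i => y i] i)] by apply/ffunP => k; rewrite !ffunE hy.
have h : pi (mx_act N B [ffun i => y i] i) = pi (w i).
  have := congr1 (fun f : {ffun _} => f i) hz; rewrite zE mx_act_map ffunE => ->.
  by rewrite ffunE.
by rewrite linearB h subrr.
Qed.

Theorem mainTheorem3 (A : comNzRingType) (m : {pred A}) (d t : nat)
  (N M : lmodType A)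
  (hA : gorenstein_local m) (hreg : ~ regular_local m)
  (hd : ring_dim A d) (hd1 : (1 <= d)%N)
  (hNfg : fin_gen N) (hN : perfect m N)
  (ht : mod_dim N t) (ht1 : (1 <= t)%N)
  (hMfg : fin_gen M) (hM : max_cohen_macaulay m M) (hMfree : ~ is_free M)
  (F : free_resolution M) (i : nat) (hi : (1 <= i)%N) :
  Tor_degree m N F i (t%:Z - 1) /\ Ext_degree m N F i (t%:Z - 1).
Proof.
case: hA => nA lm [I [dI [eI [Iinj einj e_exact d_exact [n0 I0]]]]].
have [a [am ma]] := max_gens nA lm.
have fN := fin_gen_fg hNfg; have fM := fin_gen_fg hMfg.
(* Over A/(xs) the chain consisting of [m] alone exists; each element of [xs] lengthens it by one
   prime of [A]. *)
have reg_le xs : regc A^o xs -> ~ mulp xs (fullp (T := A^o)) (1 : A^o) -> (size xs <= d)%N.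
  move=> rx n1; apply: hd.2; apply/pchainE.
  have hJ : submod (mulp xs (fullp (T := A^o))) by exact: submod_gen.
  have hann b : ann_quo (mulp xs (fullp (T := A^o))) b -> b \in m.
    move=> hb; apply: (proper_sub_max nA lm (I := ann_quo (mulp xs (fullp (T := A^o))))) => //.
      exact: ideal_ann_quo.
    by move=> /(_ 1); rewrite scale1r.
  have c0 : pchain (ann_quo (mulp xs (fullp (T := A^o)))) 0.
    by exists (fun _ x => x \in m); split=> // j; split; [exact: max_primep|exact: hann].
  have [p [h1 h2]] := pchain_regular nA rx c0.
  exists p; split=> // j; have [pj _] := h1 j; split=> // x; rewrite inE => /eqP ->.
  by case: pj => hp _ _; apply: (submod0 hp).
have sub1 xs : (forall x, x \in xs -> x \in m) -> ~ mulp xs (fullp (T := A^o)) (1 : A^o).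
  move=> xm h1; move/negP: (max_not1 lm); apply.
  apply: (mulp_sub (W := fun x : A^o => (x : A) \in m)) h1; first exact: (ideal_max lm).
  move=> x u /xm hx _; rewrite [_ *: _]mulrC; exact: (idealM _ (ideal_max lm)).
have [ys [[ysm yreg] ymax]] : exists ys, ((forall x, x \in ys -> x \in m) /\ regc A^o ys) /\
    forall zs, (forall x, x \in zs -> x \in m) -> regc A^o zs -> (size zs <= size ys)%N.
  have [||r [[ys [<- [h1 h2]]] h3] _] := @is_max_exists
    (fun k => exists ys, size ys = k /\ (forall x, x \in ys -> x \in m) /\ regc A^o ys) 0%N d.
  - by exists [::].
  - by move=> j [ys [<- [h1 h2]]]; apply: reg_le => //; apply: sub1.
  by exists ys; split=> // zs z1 z2; apply: h3; exists zs.
have ysd : (size ys <= d)%N by apply: reg_le => //; apply: sub1.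
have hJ : submod (mulp ys (fullp (T := A^o))) by exact: submod_gen.
(* A regular [z] would prolong [ys] beyond its maximal length, so there is a socle element [v0],
   generating a copy of A/m in A/(ys). *)
have [[z zm zreg]|[v0 nv0 zv0]] := regular_or_socle nA lm (noeth_regular nA) hJ.
  suff : (size (rcons ys z) <= size ys)%N by rewrite size_rcons ltnn.
  apply: ymax.
    by move=> x; rewrite mem_rcons inE => /orP[/eqP ->|/ysm].
  move=> k; rewrite size_rcons ltnS leq_eqVlt => /orP[/eqP ->|ky] v.
    by rewrite nth_rcons ltnn eqxx -cats1 take_size_cat //; apply: zreg.
  by rewrite nth_rcons ky -cats1 takel_cat ?(ltnW ky) //; apply: yreg.
have vanish := ext0_vanish nA lm Iinj e_exact d_exact I0 yreg nv0 zv0.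
have aM : ext_acyclic dI M.
  have [[r [[xs [sx xm rx]] _] hr] [d' hd' hMd]] := hM.
  have rd : r = d.
    by rewrite (is_max_uniq hr hMd); apply: is_max_uniq hd' hd.
  move=> j; apply: (ext0_quo_down nA lm Iinj e_exact d_exact fM xm (regular_seq_regc rx) (n := size ys)).
    by move=> Q pi hpi k; apply: vanish; apply: fg_surj fM hpi.1.
  by rewrite sx rd; apply: leq_trans ysd (leq_addl _ _).
have [[v1 v1n] [r [[xs [sx xm rx]] _] hr] pdN] := hN.
have rt : r = t by apply: is_max_uniq hr ht.
have rcx := regular_seq_regc rx.
have pN := perp_projdim nA Iinj einj e_exact d_exact pdN.
(* A prime [P] over the annihilator of [N / (xs) N] and different from [m] would give the chain
   [P < m], hence one of length [t.+1] over the annihilator of [N], exceeding its dimension. *)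
have hprim P : primep P ->
    (forall b, (forall v, mulp xs (fullp (T := N)) (b *: v)) -> P b) -> forall x, x \in m -> P x.
  move=> pP IP x xm1; apply: contrapT => nPx.
  have c1 : pchain (ann_quo (mulp xs (fullp (T := N)))) 1.
    exists (fun j b => if j is 0 then P b else b \in m); split=> [[|j]|[|j]] //.
    - by split; [exact: max_primep|move=> b /IP; exact: (prime_sub_max nA lm)].
    - by move=> _; split; [exact: (prime_sub_max nA lm)|exists x].
  have := pchain_regular nA rcx c1; rewrite sx rt add1n => -[p [h1 h2]].
  suff : (t.+1 <= t)%N by rewrite ltnn.
  apply: ht.2; apply/pchainE; exists p; split=> // j; have [pj hj] := h1 j; split=> // b.
  by rewrite inE => /asboolP hb; apply: hj.
have N0 : exists v : N, v <> 0 by exists v1; apply/eqP.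
have hJk k : submod (mulp (take k xs) (fullp (T := N))) by exact: submod_gen.
have dual := dual_exact Iinj einj e_exact d_exact aM (F := F).
have nreg j E : diff F j <> diff F j *m E *m diff F j.
  by move=> h; apply: hMfree; exact: (regular_diff_free nA lm dual h).
have DD j : diff F j.+1 *m diff F j = 0.
  apply/row_matrixP => l; rewrite row_mul row0.
  by apply/(diff_exact (f := F)); exists (delta_mx 0 l); rewrite -rowE.
(* In degree [j.+1] the outgoing differential is [diff F j] for Tor and the transpose of
   [diff F j.+1] for Ext; [nreg] covers both, since transposing preserves the existence of [E]. *)
case: i hi => // j _; rewrite -rt -sx; split.
  apply: (core_length_degree nA lm am ma fN xm rcx hprim N0 (DD j)).
  - move=> k kx; have [Q [pi hpi]] := quo_exists (hJk k).
    apply: (exact_mod hpi).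
    exact: (tor_exact Iinj einj e_exact d_exact I0 aM (perp_quo nA Iinj d_exact rcx pN kx hpi)).
  - by move=> [E hE]; apply: (nreg j E).
  - by rewrite sx rt.
apply: (core_length_degree nA lm am ma fN xm rcx hprim N0 (B := (diff F j)^T) (D := (diff F j.+1)^T)).
- by rewrite -trmx_mul DD trmx0.
- move=> k kx; have [Q [pi hpi]] := quo_exists (hJk k).
  apply: (exact_mod hpi).
  exact: (ext_exact Iinj d_exact aM (perp_quo nA Iinj d_exact rcx pN kx hpi)).
- move=> [E hE]; apply: (nreg j.+1 E^T); apply: (can_inj trmxK).
  by rewrite {1}hE !trmx_mul !trmxK mulmxA.
- by rewrite sx rt.
Qed.
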